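(* (i) $\mathcal H^{s(\lambda)}(A_\lambda)=0$ for $\mathcal L_2$-a.e. $\lambda\in\mathcal M\cap B_{1/\sqrt2}(0)$. (ii) $\mathcal P^{s(\lambda)}(A_\lambda)<\infty$ for all $\lambda\in\mathbb D$, and $\mathcal P^{s(\lambda)}(A_\lambda)>0$ for $\mathcal L_2$-a.e. $\lambda\in\mathcal M\cap B_{1/\sqrt2}(0)$; moreover for any $0<r<R<1/\sqrt2$, $$\dim_H\{\lambda\in\mathcal M:\ r<|\lambda|<R,\ \mathcal P^{s(\lambda)}(A_\lambda)=0\}\le\frac{\log 2}{-\log R}<2.$$ (iii) For $\mathcal L_2$-a.e. $\lambda\in\mathcal M\cap B_{1/\sqrt2}(0)$ the measure $\nu_\lambda$ is equivalent (mutually absolutely continuous) to $\mathcal P^{s(\lambda)}|_{A_\lambda}$.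
   Context: $\mathbb D$ is the open unit disc, $B_r(0)$ the open disc of radius $r$ about $0$, $\mathcal L_2$ area measure. $A_\lambda=\{\sum_{n\ge0}a_n\lambda^n:a_n\in\{-1,1\}\}$; $\mathcal M=\{\lambda\in\mathbb D:\ \exists (a_k)_{k\ge1},\ a_k\in\{-1,0,1\},\ 1+\sum_{k\ge1}a_k\lambda^k=0\}$. $s(\lambda)=\frac{\log2}{-\log|\lambda|}$. $\mathcal H^s$ and $\mathcal P^s$ denote $s$-dimensional Hausdorff and packing measure; $\dim_H$ is Hausdorff dimension. $\nu_\lambda$ is the distribution of $\sum_{n\ge0}\pm\lambda^n$ with independent signs, each $\pm$ with probability $1/2$. *)

(* Defs.v *)
From mathcomp Require Import all_boot all_order all_algebra.
From mathcomp Require Import all_classical all_reals all_analysis.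
Import numFieldNormedType.Exports.
Set Implicit Arguments. Unset Strict Implicit. Unset Printing Implicit Defensive.
Import Order.TTheory GRing.Theory Num.Theory.
Local Open Scope classical_set_scope.
Local Open Scope ring_scope.

Section Defs.
Variable R : realType.

Notation C := (R * R)%type.

Definition cmul (z w : C) : C := (z.1 * w.1 - z.2 * w.2, z.1 * w.2 + z.2 * w.1).
Definition cexp (z : C) (n : nat) : C := iter n (cmul z) (1, 0).
Definition cscale (c : R) (z : C) : C := (c * z.1, c * z.2).
Definition cnorm (z : C) : R := Num.sqrt (z.1 ^+ 2 + z.2 ^+ 2).
Definition cdist (z w : C) : R := cnorm (z - w).

Definition psum (a : nat -> R) (l : C) (N : nat) : C :=
  \sum_(n < N) cscale (a n) (cexp l n).

Definition Aset (l : C) : set C :=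
  [set z | exists a : nat -> R, (forall n, a n = 1 \/ a n = -1) /\
                                psum a l N @[N --> \oo] --> z].

Definition Mset : set C :=
  [set l | cnorm l < 1 /\
     exists a : nat -> R, a 0%N = 1 /\
       (forall k, (0 < k)%N -> a k = 1 \/ a k = 0 \/ a k = -1) /\
       psum a l N @[N --> \oo] --> (0 : C)].

Definition sdim (l : C) : R := if l == 0 then 0 else ln 2 / (- ln (cnorm l)).

(** |diam U|^s with the usual conventions |diam emptyset|^s = 0, 0^0 = 1:
    the supremum of 0 and of |x - y|^s over x, y in U. *)
Definition diam_pow (s : R) (U : set C) : \bar R :=
  ereal_sup ([set 0%E] `|`
             [set r | exists x y, U x /\ U y /\ r = ((cdist x y) `^ s)%:E]).

Definition hausdorff_delta (s delta : R) (E : set C) : \bar R :=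
  ereal_inf [set v | exists U : nat -> set C,
     E `<=` \bigcup_i U i /\
     (forall i x y, U i x -> U i y -> cdist x y <= delta) /\
     v = (\sum_(i <oo) diam_pow s (U i))%E].

Definition hausdorff_measure (s : R) (E : set C) : \bar R :=
  ereal_sup [set hausdorff_delta s delta E | delta in [set d : R | 0 < d]].

Definition cball (x : C) (r : R) : set C := [set y | cdist x y <= r].

Definition packing_delta (s delta : R) (E : set C) : \bar R :=
  ereal_sup [set v | exists (J : set nat) (x : nat -> C) (r : nat -> R),
     (forall i, J i -> E (x i) /\ 0 < r i <= delta) /\
     (forall i j, J i -> J j -> i <> j -> [disjoint cball (x i) (r i) & cball (x j) (r j)]) /\
     v = (\esum_(i in J) ((2 * r i) `^ s)%:E)%E].

Definition packing_premeasure (s : R) (E : set C) : \bar R :=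
  ereal_inf [set packing_delta s delta E | delta in [set d : R | 0 < d]].

Definition packing_measure (s : R) (E : set C) : \bar R :=
  ereal_inf [set v | exists F : nat -> set C,
     E `<=` \bigcup_i F i /\ v = (\sum_(i <oo) packing_premeasure s (F i))%E].

Definition hausdorff_dim (E : set C) : \bar R :=
  ereal_inf [set s%:E | s in [set s : R | 0 <= s /\ hausdorff_measure s E = 0%E]].

Definition area : set (measurableTypeR R * measurableTypeR R)%type -> \bar R :=
  (lebesgue_measure \x lebesgue_measure)%E.

(** eps is a sequence of independent random signs, each +-1 with probability 1/2:
    every eps n is measurable, takes values in {-1,1}, and for every n and every
    sign pattern b the cylinder {eps_0 = b_0, ..., eps_{n-1} = b_{n-1}} has
    probability 2^-n. *)
Definition fair_signs d (Omega : measurableType d) (P : probability Omega R)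
    (eps : nat -> Omega -> R) : Prop :=
  (forall n, measurable_fun setT (eps n)) /\
  (forall n w, eps n w = 1 \/ eps n w = -1) /\
  (forall (n : nat) (b : nat -> R), (forall i, b i = 1 \/ b i = -1) ->
     P [set w | forall i, (i < n)%N -> eps i w = b i] = ((2 ^- n : R)%:E)).

(** nu_lambda (the law of sum_n eps_n lambda^n) is equivalent to P^s|_A:
    for every such realisation and every Borel set E,
    nu_lambda(E) = 0 <-> P^s(A cap E) = 0, where nu_lambda(E) is the probability
    of the event {w : the series sum_n eps_n(w) lambda^n converges to a point of E}
    (the series always converges since |lambda| < 1, and limits are unique). *)
Definition nu_equiv_packing (l : C) : Prop :=
  forall d (Omega : measurableType d) (P : probability Omega R)
         (eps : nat -> Omega -> R),
    fair_signs P eps ->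
    forall E : set (measurableTypeR R * measurableTypeR R)%type, measurable E ->
      (P [set w | exists z, E z /\ psum (fun n => eps n w) l N @[N --> \oo] --> z]
         = 0%E <->
       packing_measure (sdim l) (Aset l `&` E) = 0%E).

End Defs.

(* Main.v *)
(**
Code points of A_l by sequences of signs and write p_u for the polynomial with
sign coefficients u.  If f is a polynomial with coefficients in [-1,1] and
constant term 1, then f cannot be small together with |f(l2) - f(l1)| / |l2 - l1|
at two points l1, l2 of the disc of radius 1/sqrt 2 that lie on the same side of
the real axis and away from it: otherwise f would almost have four zeros there
(with the conjugates), and reflecting them in |z|^2 = 3/4 contradicts the size
of the weighted l^2 norm of f.

(i) For l in M the truncations of a series vanishing at l are small at l, so a
chord step yields nearby parameters at which two words u <> v of equal length n
satisfy |p_u - p_v| <= e |l|^n.  Hence the parameters without such words form a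
porous, thus null, set.  When such words exist for every e, iteration gives
2^k words of equal length n with points within |l|^n of each other; covering A_l
by cylinders that end with such a block shows that its Hausdorff measure is 0.

(ii) The pieces of A_l in disjoint balls centred on it correspond to pairwise
incomparable words, and Kraft's inequality bounds the packing measure.  Suppose
that at all large levels n at most K 2^n pairs of words have points closer
than a multiple of |l|^n.  Most words then have boundedly many close neighbours,
while a set of small packing premeasure has a |l|^n-net with few points at every
fine scale n; so such a set meets few cylinders, and countably many of small total
premeasure cannot exhaust the coin-tossing space.  The number of close pairs is
controlled when, after normalisation, the number of close pairs of level j with
different first letters decays like q^j; by transversality the parameters where
this fails are covered by about (2 / q)^j balls of radius of order R^j, with q < 1
arbitrarily close to 1.

(iii) An open set of small probability is exhausted by the disjoint cylinders
whose surrounding ball first enters it, so law-null sets are packing-null.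
Conversely, a closed set F of positive probability has rescaled copies along words
that have probability arbitrarily close to 1.  If F were packing-null, these copies
together with a law-null set would cover A_l, and its packing measure would vanish.
*)
From HB Require Import structures.
From mathcomp Require Import all_boot all_order all_algebra.
From mathcomp Require Import all_classical all_reals all_analysis.
From mathcomp Require Import measurable_realfun ring lra.
Require Import Defs.
Import numFieldNormedType.Exports.
Import Order.TTheory GRing.Theory Num.Theory.
Local Open Scope classical_set_scope.
Local Open Scope ring_scope.

(** * Complex numbers as pairs *)

Section ComplexPlane.
Context {R : realType}.
Local Notation C := (R * R)%type.
Implicit Types (z w l : C) (s : seq R).

Lemma cpair_eq z w : z.1 = w.1 -> z.2 = w.2 -> z = w.
Proof. by case: z w => [a b] [c d] /= -> ->. Qed.

Lemma cnorm_ge0 z : 0 <= cnorm z. Proof. exact: sqrtr_ge0. Qed.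
Hint Resolve cnorm_ge0 : core.

Lemma sqr_cnorm z : cnorm z ^+ 2 = z.1 ^+ 2 + z.2 ^+ 2.
Proof. by rewrite sqr_sqrtr// addr_ge0// sqr_ge0. Qed.

Lemma cnorm_le z (a : R) : 0 <= a -> z.1 ^+ 2 + z.2 ^+ 2 <= a ^+ 2 -> cnorm z <= a.
Proof.
by move=> a0 h; rewrite -(@ler_pXn2r _ 2)// ?nnegrE// sqr_cnorm.
Qed.

Lemma cnorm0 : cnorm (0 : C) = 0.
Proof. by rewrite /cnorm /= expr0n addr0 sqrtr0. Qed.

Lemma cnorm_eq0 z : cnorm z = 0 -> z = 0.
Proof.
move=> h; have := sqr_cnorm z; rewrite h expr0n /= => /esym/eqP.
rewrite paddr_eq0 ?sqr_ge0// !sqrf_eq0 => /andP[/eqP a /eqP b].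
exact: cpair_eq.
Qed.

Lemma cnorm_gt0 z : z != 0 -> 0 < cnorm z.
Proof.
move=> z0; rewrite lt_neqAle cnorm_ge0 andbT eq_sym.
by apply: contra z0 => /eqP/cnorm_eq0 ->.
Qed.

Lemma cnormM z w : cnorm (cmul z w) = cnorm z * cnorm w.
Proof.
rewrite /cnorm -sqrtrM ?addr_ge0 ?sqr_ge0//=; congr Num.sqrt; ring.
Qed.

Lemma cnormN z : cnorm (- z) = cnorm z.
Proof. by rewrite /cnorm /= !sqrrN. Qed.

Lemma cdistC z w : cdist z w = cdist w z.
Proof. by rewrite /cdist -cnormN opprB. Qed.

Lemma cdistxx z : cdist z z = 0.
Proof. by rewrite /cdist subrr cnorm0. Qed.

Lemma cdist_ge0 z w : 0 <= cdist z w. Proof. exact: cnorm_ge0. Qed.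
Hint Resolve cdist_ge0 : core.

Lemma ler_cnormD z w : cnorm (z + w) <= cnorm z + cnorm w.
Proof.
apply: cnorm_le; first by rewrite addr_ge0.
rewrite (sqrrD (cnorm z)) !sqr_cnorm /=.
suff : z.1 * w.1 + z.2 * w.2 <= cnorm z * cnorm w by lra.
apply: le_trans (ler_norm _) _.
rewrite -(@ler_pXn2r _ 2)// ?nnegrE ?mulr_ge0// real_normK ?num_real//.
rewrite exprMn !sqr_cnorm; have := sqr_ge0 (z.1 * w.2 - z.2 * w.1); nra.
Qed.

Lemma ler_cnormB z w : cnorm (z - w) <= cnorm z + cnorm w.
Proof. by rewrite -[cnorm w]cnormN ler_cnormD. Qed.

Lemma ler_cdistD y z w : cdist z w <= cdist z y + cdist y w.
Proof. by rewrite /cdist -[z - w](subrKA y) ler_cnormD. Qed.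

Lemma lerB_cnorm z w : cnorm z - cnorm w <= cnorm (z - w).
Proof. by have := ler_cnormD (z - w) w; rewrite subrK; lra. Qed.

Lemma cnorm_re z : `|z.1| <= cnorm z.
Proof. by rewrite -sqrtr_sqr ler_wsqrtr// lerDl sqr_ge0. Qed.

Lemma cnorm_im z : `|z.2| <= cnorm z.
Proof. by rewrite -sqrtr_sqr ler_wsqrtr// lerDr sqr_ge0. Qed.

Lemma cnorm_real (a : R) : cnorm (a, 0) = `|a|.
Proof. by rewrite /cnorm /= expr0n addr0 sqrtr_sqr. Qed.

Lemma cnorm_le_sum z : cnorm z <= `|z.1| + `|z.2|.
Proof.
apply: cnorm_le; first by rewrite addr_ge0.
rewrite (sqrrD `|z.1|) !real_normK ?num_real//.
have h : 0 <= `|z.1| * `|z.2| by rewrite mulr_ge0.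
lra.
Qed.

Lemma cmulC z w : cmul z w = cmul w z.
Proof. by rewrite /cmul; congr (_, _); ring. Qed.

Lemma cmulA z w l : cmul z (cmul w l) = cmul (cmul z w) l.
Proof. by rewrite /cmul /=; congr (_, _); ring. Qed.

Lemma cmulDr z w l : cmul z (w + l) = cmul z w + cmul z l.
Proof. by rewrite /cmul /=; apply: cpair_eq => /=; ring. Qed.

Lemma cmulBr z w l : cmul z (w - l) = cmul z w - cmul z l.
Proof. by rewrite /cmul /=; apply: cpair_eq => /=; ring. Qed.

Lemma cmul1 z : cmul (1, 0) z = z.
Proof. by apply: cpair_eq => /=; ring. Qed.

Lemma cmulr1 z : cmul z (1, 0) = z.
Proof. by rewrite cmulC cmul1. Qed.

Lemma cmulr0 z : cmul z 0 = 0.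
Proof. by apply: cpair_eq => /=; ring. Qed.

Lemma cnorm_cexp l n : cnorm (cexp l n) = cnorm l ^+ n.
Proof.
elim: n => [|n IH]; first by rewrite /cexp /= cnorm_real normr1.
by rewrite /cexp iterS -/(cexp l n) cnormM IH exprS.
Qed.

Lemma cscaleE (a : R) z : cscale a z = cmul (a, 0) z.
Proof. by rewrite /cscale /cmul /=; congr (_, _); ring. Qed.

Definition cinv z : C := (z.1 / cnorm z ^+ 2, - z.2 / cnorm z ^+ 2).

Lemma cmulV z : z != 0 -> cmul z (cinv z) = (1, 0).
Proof.
move=> z0; have h : cnorm z ^+ 2 != 0 by rewrite expf_neq0// gt_eqF// cnorm_gt0.
rewrite /cmul /cinv /=; have := sqr_cnorm z; move: h; set n := cnorm z ^+ 2 => h e.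
by congr (_, _); [rewrite -[RHS](divff h) {3}e; field | field].
Qed.

Lemma cnormV z : z != 0 -> cnorm (cinv z) = (cnorm z)^-1.
Proof.
move=> z0; have h := cnorm_gt0 _ z0.
have := cnormM z (cinv z); rewrite cmulV// cnorm_real normr1 => e.
by rewrite -[LHS](mulKf (lt0r_neq0 h)) -e mulr1.
Qed.

(** Horner evaluation at [l] of the real polynomial with coefficient list [s], constant term
    first. *)
Definition hev s l : C := foldr (fun a acc => (a, 0) + cmul l acc) 0 s.

Lemma hev_cat s t l : hev (s ++ t) l = hev s l + cmul (cexp l (size s)) (hev t l).
Proof.
elim: s => [|a s IH] /=; first by rewrite add0r /cexp /= cmul1.
by rewrite IH cmulDr cmulA addrA.
Qed.

Lemma psum_hev (a : nat -> R) l n : psum a l n = hev (mkseq a n) l.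
Proof.
elim: n => [|n IH]; first by rewrite /psum big_ord0.
rewrite /psum big_ord_recr -/(psum a l n) IH mkseqS -cats1 hev_cat size_mkseq /=.
by rewrite cmulr0 addr0 cscaleE cmulC.
Qed.

Lemma cnormZ (a : R) z : cnorm (cscale a z) = `|a| * cnorm z.
Proof. by rewrite cscaleE cnormM cnorm_real. Qed.

Lemma hev_bound s l (q : R) : all (fun a => `|a| <= 1) s ->
  cnorm l <= q -> q < 1 -> cnorm (hev s l) <= (1 - q)^-1.
Proof.
move=> + lq q1; have q0 : 0 <= q by exact: le_trans (cnorm_ge0 l) lq.
have d0 : 0 < 1 - q by rewrite subr_gt0.
elim: s => [|a s IH] /=; first by rewrite cnorm0 invr_ge0 ltW.
move=> /andP[a1 /IH h]; apply: le_trans (ler_cnormD _ _) _.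
rewrite cnorm_real cnormM.
have -> : (1 - q)^-1 = 1 + q * (1 - q)^-1.
  by apply: (mulfI (lt0r_neq0 d0)); rewrite mulrDr mulrCA divff ?lt0r_neq0//; ring.
by rewrite lerD// ler_pM.
Qed.

(* The difference quotient (f(x) - f(y)) / (x - y), equal to f'(x) when x = y. *)
Fixpoint dq s (x y : C) : C :=
  if s is a :: s' then hev s' x + cmul y (dq s' x y) else 0.

Lemma dqP s x y : hev s x - hev s y = cmul (x - y) (dq s x y).
Proof.
elim: s => [|a s IH] /=; first by rewrite cmulr0 subr0.
have -> : (a, 0) + cmul x (hev s x) - ((a, 0) + cmul y (hev s y)) =
  cmul (x - y) (hev s x) + cmul y (hev s x - hev s y).
  by apply: cpair_eq => /=; ring.
by rewrite IH; apply: cpair_eq => /=; ring.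
Qed.

(** The constant solves [c = 4 + 3/4 * c], where 4 bounds [hev] on the disc of radius 3/4. In the
    same way the 64 of [dq_lip] solves [c = 16 + 3/4 * c]. *)
Lemma dq_bound s x y : all (fun a => `|a| <= 1) s ->
  cnorm x <= 3/4 -> cnorm y <= 3/4 -> cnorm (dq s x y) <= 16.
Proof.
move=> + hx hy; elim: s => [|a s IH] /=; first by rewrite cnorm0.
move=> /andP[a1 hs]; apply: le_trans (ler_cnormD _ _) _; rewrite cnormM.
have := @hev_bound s x (3/4) hs hx ltac:(lra).
have := IH hs; have := cnorm_ge0 (dq s x y); have := cnorm_ge0 y.
have -> : (1 - 3/4 : R)^-1 = 4 by field.
nra.
Qed.

Lemma hev_lip s x y : all (fun a => `|a| <= 1) s ->
  cnorm x <= 3/4 -> cnorm y <= 3/4 -> cdist (hev s x) (hev s y) <= 16 * cdist x y.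
Proof.
move=> hs hx hy; rewrite /cdist dqP cnormM mulrC ler_wpM2r//; exact: dq_bound.
Qed.

Lemma dq_lip s x x' y : all (fun a => `|a| <= 1) s ->
  cnorm x <= 3/4 -> cnorm x' <= 3/4 -> cnorm y <= 3/4 ->
  cdist (dq s x y) (dq s x' y) <= 64 * cdist x x'.
Proof.
move=> + hx hx' hy; elim: s => [|a s IH] /=; first by rewrite cdistxx mulr_ge0.
move=> /andP[a1 hs]; rewrite /cdist.
have -> : hev s x + cmul y (dq s x y) - (hev s x' + cmul y (dq s x' y)) =
  (hev s x - hev s x') + cmul y (dq s x y - dq s x' y).
  by apply: cpair_eq => /=; ring.
apply: le_trans (ler_cnormD _ _) _; rewrite cnormM.
have := @hev_lip s x x' hs hx hx'; have := IH hs; rewrite /cdist.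
have := cnorm_ge0 (dq s x y - dq s x' y); have := cnorm_ge0 y.
have := cnorm_ge0 (x - x').
nra.
Qed.

End ComplexPlane.
#[global] Hint Extern 0 (is_true (0 <= cnorm _)) => solve [exact: cnorm_ge0] : core.
#[global] Hint Extern 0 (is_true (0 <= cdist _ _)) => solve [exact: cdist_ge0] : core.

(** * Transversality *)

Section WeightedNorm.
Context {R : realFieldType}.
Implicit Types (f g h : {poly R}).
Variable t : R.

(** For [t > 0] this is the L^2 inner product over the circle |z|^2 = t with normalised arc length,
    cut off at degree [M]. *)
Definition wdot M f g := \sum_(k < M) f`_k * g`_k * t ^+ k.

Lemma wdotMX M f g : (size f < M)%N -> wdot M (f * 'X) (g * 'X) = t * wdot M f g.
Proof.
case: M => // M; rewrite ltnS => sf; rewrite /wdot big_ord_recl big_ord_recr /=.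
rewrite !coefMX /= mul0r mul0r add0r [f`_M]nth_default// !mul0r addr0 mulr_sumr.
by apply: eq_bigr => i _; rewrite !coefMX /= /bump /= add1n exprS; ring.
Qed.

Definition quad (c2 c1 c0 : R) : {poly R} := c2 *: 'X^2 + c1 *: 'X + c0%:P.

Lemma coef_quadM c2 c1 c0 h k :
  (quad c2 c1 c0 * h)`_k = c2 * (h * 'X * 'X)`_k + c1 * (h * 'X)`_k + c0 * h`_k.
Proof.
have -> : quad c2 c1 c0 * h = c2 *: (h * 'X * 'X) + c1 *: (h * 'X) + c0 *: h.
  by rewrite /quad -!mul_polyC; ring.
by rewrite !coefD !coefZ.
Qed.

(** Multiplying both arguments by ['X] scales [wdot] by [t], so the quadratic factor enters only
    through three expressions in its coefficients. The reflection below leaves each of them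
    unchanged. *)
Lemma wdot_quad M c2 c1 c0 h : ((size h).+1 < M)%N ->
  wdot M (quad c2 c1 c0 * h) (quad c2 c1 c0 * h) =
  (c2 ^+ 2 * t ^+ 2 + c1 ^+ 2 * t + c0 ^+ 2) * wdot M h h +
  2 * c1 * (c2 * t + c0) * wdot M (h * 'X) h + 2 * c2 * c0 * wdot M (h * 'X * 'X) h.
Proof.
move=> sM; have sM1 : (size h < M)%N by exact: ltn_trans sM.
have sM2 : (size (h * 'X)%R < M)%N.
  have [->|h0] := eqVneq h 0; first by rewrite mul0r size_poly0 (leq_ltn_trans _ sM1).
  by rewrite size_mulX.
have e1 := wdotMX M h h sM1; have e2 := wdotMX M (h * 'X) h sM2.
have e3 := wdotMX M (h * 'X) (h * 'X) sM2.
transitivity (c2 ^+ 2 * wdot M (h * 'X * 'X) (h * 'X * 'X) +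
  c1 ^+ 2 * wdot M (h * 'X) (h * 'X) + c0 ^+ 2 * wdot M h h +
  2 * c2 * c1 * wdot M (h * 'X * 'X) (h * 'X) + 2 * c1 * c0 * wdot M (h * 'X) h +
  2 * c2 * c0 * wdot M (h * 'X * 'X) h).
  rewrite /wdot !mulr_sumr -!big_split; apply: eq_bigr => k _ /=.
  by rewrite !coef_quadM; ring.
by rewrite e3 e2 e1; ring.
Qed.

(* On |z|^2 = t the polynomials z^2 - 2 a z + b and t - 2 a z + (b/t) z^2 have equal
   modulus: the second is obtained from the first by a Blaschke-type reflection of its roots. *)
Lemma wdot_reflect M (a b : R) h : t != 0 -> ((size h).+1 < M)%N ->
  wdot M (quad 1 (- (2 * a)) b * h) (quad 1 (- (2 * a)) b * h) =
  wdot M (quad (b / t) (- (2 * a)) t * h) (quad (b / t) (- (2 * a)) t * h).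
Proof. by move=> t0 sM; rewrite !wdot_quad//; field. Qed.

Lemma size_quad c2 c1 c0 : (size (quad c2 c1 c0) <= 3)%N.
Proof.
rewrite /quad (leq_trans (size_polyD _ _))// geq_max; apply/andP; split; last first.
  by rewrite (leq_trans (size_polyC_leq1 _)).
rewrite (leq_trans (size_polyD _ _))// geq_max; apply/andP; split.
  by rewrite (leq_trans (size_scale_leq _ _))// size_polyXn.
by rewrite (leq_trans (size_scale_leq _ _))// size_polyX.
Qed.

Lemma size_quadM c2 c1 c0 h : (size (quad c2 c1 c0 * h)%R <= (size h).+2)%N.
Proof.
rewrite (leq_trans (size_polyMleq _ _))//.
by rewrite -subn1 leq_subLR add1n (leq_trans (leq_add (size_quad _ _ _) (leqnn _))).
Qed.

End WeightedNorm.

(** * Polynomials with almost four zeros *)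

Section Transversality.
Context {R : realType}.
Local Notation C := (R * R)%type.

Lemma wdot_ge0_coef0 (t : R) M (f : {poly R}) : 0 <= t -> f`_0 ^+ 2 <= wdot t M.+1 f f.
Proof.
move=> t0; rewrite /wdot big_ord_recl expr0 mulr1 expr2 lerDl sumr_ge0// => k _.
by rewrite mulr_ge0 ?exprn_ge0// -expr2 sqr_ge0.
Qed.

Lemma wdot_le (c : R) M (f : {poly R}) : 0 <= c -> (forall k, `|f`_k| <= c) ->
  wdot (3/4) M f f <= 4 * c ^+ 2.
Proof.
move=> c0 fc; apply: (@le_trans _ _ (\sum_(k < M) c ^+ 2 * (3/4) ^+ k)).
  apply: ler_sum => k _; have q0 : 0 <= (3/4 : R) ^+ k by rewrite exprn_ge0//; lra.
  rewrite ler_wpM2r//.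
  by rewrite -expr2 -[f`_k ^+ 2]real_normK ?num_real// lerXn2r ?nnegrE.
have -> : \sum_(k < M) c ^+ 2 * (3/4) ^+ k = 4 * c ^+ 2 * (1 - (3/4) ^+ M).
  elim: M => [|M IH]; first by rewrite big_ord0 expr0 subrr mulr0.
  by rewrite big_ord_recr /= IH [_ ^+ M.+1]exprS; field.
have h1 : 0 <= (3/4 : R) ^+ M by rewrite exprn_ge0//; lra.
have := sqr_ge0 c; nra.
Qed.

(* A Jensen-type bound: with four zeros of modulus at most 2^(-1/2), the weighted
   l^2 norm at t = 3/4 would be too large. *)
Lemma no_two_quadratic_factors (h : {poly R}) (a1 b1 a2 b2 s : R) :
  0 < b1 <= 1/2 -> 0 < b2 <= 1/2 -> 0 <= s -> s <= 1/18 ->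
  let F := quad 1 (- (2 * a1)) b1 * (quad 1 (- (2 * a2)) b2 * h) in
  1 - s <= F`_0 -> (forall k, `|F`_k| <= 1 + s) -> False.
Proof.
move=> /andP[b10 b1h] /andP[b20 b2h] s0 s1 F F0 Fk.
have t0 : (3/4 : R) != 0 by apply/eqP; lra.
pose M := (size h).+4.+4.
have N1 : wdot (3/4) M F F <= 4 * (1 + s) ^+ 2 by apply: wdot_le => //; lra.
(* Both quadratic factors are reflected in turn; [mulrCA] brings the second one to the front. *)
have E : wdot (3/4) M F F = wdot (3/4) M
   (quad (b2 / (3/4)) (- (2 * a2)) (3/4) * (quad (b1 / (3/4)) (- (2 * a1)) (3/4) * h))
   (quad (b2 / (3/4)) (- (2 * a2)) (3/4) * (quad (b1 / (3/4)) (- (2 * a1)) (3/4) * h)).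
  rewrite /F wdot_reflect//; last first.
    by rewrite /M !ltnS (leq_trans (size_quadM _ _ _ _))// !ltnS -addn4 leq_addr.
  rewrite mulrCA wdot_reflect//.
  by rewrite /M !ltnS (leq_trans (size_quadM _ _ _ _))// !ltnS -addn4 leq_addr.
have := @wdot_ge0_coef0 (3/4) (size h).+4.+3 (quad (b2 / (3/4)) (- (2 * a2)) (3/4) *
  (quad (b1 / (3/4)) (- (2 * a1)) (3/4) * h)) ltac:(lra).
rewrite -/M -E !coef_quadM !coefMX /= !mulr0 !add0r => N2.
move: F0; rewrite /F !coef_quadM !coefMX /= !mulr0 !add0r => F0.
have bb : b1 * b2 <= 1/4 by nra.
have h0 : 0 < h`_0.
  rewrite ltNge; apply/negP => hn; have : b1 * (b2 * h`_0) <= 0; last lra.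
  by rewrite mulrA; apply: mulr_ge0_le0 => //; rewrite mulr_ge0// ltW.
have h4 : 4 * (1 - s) <= h`_0 by rewrite mulrA in F0; nra.
(* The reflected product has constant term 9/16 times that of [h], hence at least [9/4 * (1 - s)];
   its square is at most the weighted norm [4 * (1 + s) ^+ 2]. For [s <= 1/18] this is
   impossible. *)
have : 9/4 * (1 - s) <= 2 * (1 + s); last lra.
rewrite -(@ler_pXn2r _ 2)// ?nnegrE; [|lra|lra].
apply: (@le_trans _ _ ((3/4 * (3/4 * h`_0)) ^+ 2)); last by rewrite exprMn; lra.
by rewrite lerXn2r ?nnegrE//; lra.
Qed.

Definition ev (p : {poly R}) (z : C) : C := hev (polyseq p) z.

Lemma hev_psum s (z : C) n : (size s <= n)%N -> hev s z = psum (nth 0 s) z n.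
Proof.
move=> sn; rewrite psum_hev -(subnKC sn); set k := (n - _)%N.
have -> : mkseq (nth 0 s) (size s + k) = s ++ nseq k 0.
  apply: (@eq_from_nth _ 0); first by rewrite size_mkseq size_cat size_nseq.
  move=> i; rewrite size_mkseq => ik; rewrite nth_mkseq// nth_cat.
  by case: ltnP => // is_; rewrite nth_default// nth_nseq if_same.
rewrite hev_cat; have -> : hev (nseq k 0) z = 0; last by rewrite cmulr0 addr0.
elim: k => //= k ->; rewrite cmulr0 addr0 //.
Qed.

Lemma ev_psum (p : {poly R}) z n : (size p <= n)%N -> ev p z = psum (fun i => p`_i) z n.
Proof. exact: hev_psum. Qed.

Lemma ev_Poly s z : ev (Poly s) z = hev s z.
Proof.
rewrite (@ev_psum _ _ (size s)) ?size_Poly// (@hev_psum _ _ (size s))//.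
by rewrite /psum; apply: eq_bigr => i _; rewrite coef_Poly.
Qed.

Lemma evD p q z : ev (p + q) z = ev p z + ev q z.
Proof.
pose n := maxn (size p) (size q).
rewrite !(@ev_psum _ _ n) ?leq_maxl ?leq_maxr ?size_polyD// /psum -big_split.
apply: eq_bigr => i _; rewrite coefD; apply: cpair_eq => /=; ring.
Qed.

Lemma evZ c p z : ev (c *: p) z = cscale c (ev p z).
Proof.
rewrite !(@ev_psum _ _ (size p)) ?size_scale_leq// /psum.
rewrite cscaleE; elim/big_ind2 : _ => [|x y x' y' -> ->|i _]; first by rewrite cmulr0.
  by rewrite cmulDr.
rewrite coefZ; apply: cpair_eq => /=; ring.
Qed.

Lemma evMX p z : ev (p * 'X) z = cmul z (ev p z).
Proof.
have [->|p0] := eqVneq p 0; first by rewrite mul0r /ev polyseq0 /= cmulr0.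
by rewrite /ev polyseqMX//= add0r.
Qed.

Lemma evC c z : ev c%:P z = (c, 0).
Proof.
rewrite /ev polyseqC; case: eqVneq => [->|_] //=.
by rewrite cmulr0 addr0.
Qed.

Lemma ev_quadM c2 c1 c0 p z : ev (quad c2 c1 c0 * p) z =
  cmul (cscale c2 (cmul z z) + cscale c1 z + (c0, 0)) (ev p z).
Proof.
have -> : quad c2 c1 c0 * p = c2 *: (p * 'X * 'X) + c1 *: (p * 'X) + c0 *: p.
  by apply/polyP => k; rewrite coef_quadM !coefD !coefZ.
rewrite !evD !evZ !evMX; apply: cpair_eq => /=; ring.
Qed.

Lemma poly_size2E (r : {poly R}) : (size r <= 2)%N -> r = r`_1 *: 'X + (r`_0)%:P.
Proof.
move=> sr; apply/polyP => -[|[|k]]; rewrite coefD coefZ coefX coefC /=.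
- by rewrite mulr0 add0r.
- by rewrite mulr1 addr0.
- by rewrite mulr0 addr0 nth_default// (leq_trans sr).
Qed.

Lemma size_monic_quad (c1 c0 : R) : size (quad 1 c1 c0) = 3%N.
Proof.
rewrite /quad scale1r -addrA size_polyDl size_polyXn//.
rewrite (leq_ltn_trans (size_polyD _ _))// gtn_max; apply/andP; split.
  by rewrite (leq_ltn_trans (size_scale_leq _ _))// size_polyX.
by rewrite (leq_ltn_trans (size_polyC_leq1 _)).
Qed.

Lemma div_quad (c1 c0 : R) (f : {poly R}) :
  exists g al be, f = quad 1 c1 c0 * g + (al *: 'X + be%:P).
Proof.
exists (f %/ quad 1 c1 c0), (f %% quad 1 c1 c0)`_1, (f %% quad 1 c1 c0)`_0.
rewrite -poly_size2E; first by rewrite [X in X + _]mulrC -divp_eq.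
have Q0 : quad 1 c1 c0 != 0 by rewrite -size_poly_gt0 size_monic_quad.
by have := ltn_modp f (quad 1 c1 c0); rewrite Q0 size_monic_quad.
Qed.

(** The imaginary part of the value is [al * l.2], which controls the slope because [l] is away from
    the real axis; the real part then controls the constant. *)
Lemma linear_coef_bound (al be eta e : R) (l : C) : 0 < eta -> eta <= 1 ->
  eta <= `|l.2| -> cnorm l <= 1 -> 0 <= e ->
  cnorm (cscale al l + (be, 0)) <= e -> `|al| <= e / eta /\ `|be| <= 2 * e / eta.
Proof.
move=> e0 e1 hl l1 ee h.
have hal : `|al| <= e / eta.
  rewrite ler_pdivlMr//; apply: le_trans (le_trans (cnorm_im _) h).
  by rewrite /= addr0 normrM ler_wpM2l.
split => //; have h2 : `|al * l.1 + be| <= e by exact: le_trans (cnorm_re _) h.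
have h3 : `|al * l.1| <= e / eta.
  rewrite normrM -[leRHS]mulr1 ler_pM//; exact: le_trans (cnorm_re _) l1.
have h4 : e <= e / eta by rewrite ler_pdivlMr// -[leRHS]mulr1 ler_wpM2l.
have -> : be = (al * l.1 + be) - al * l.1 by ring.
by apply: le_trans (ler_normB _ _) _; rewrite -mulrA; lra.
Qed.

Lemma quad_remainder_bound (u al be ga de a b : R) k :
  `|al| <= u -> `|be| <= 2 * u -> `|ga| <= u -> `|de| <= 2 * u -> `|a| <= 1 -> `|b| <= 1 ->
  `|(al *: 'X + be%:P + quad 1 (- (2 * a)) b * (ga *: 'X + de%:P) : {poly R})`_k| <= 8 * u.
Proof.
move=> hal hbe hga hde ha hb.
have u0 : 0 <= u by exact: le_trans (normr_ge0 _) hal.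
have Pm (x y c : R) : `|x| <= 1 -> `|y| <= c -> `|x * y| <= c.
  by move=> hx hy; rewrite normrM -[c]mul1r ler_pM.
have := Pm _ _ _ ha hde; have := Pm _ _ _ hb hde.
have := Pm _ _ _ ha hga; have := Pm _ _ _ hb hga.
rewrite coefD coef_quadM !coefMX !coefD !coefZ !coefX !coefC.
move: hal hbe hga hde; clear -u0.
case: k => [|[|[|[|k]]]] /=; rewrite ?(mulr0, mulr1, addr0, add0r, mul1r); last first.
- by rewrite normr0; lra.
- by move=> *; lra.
- rewrite !ler_norml => _ _ /andP[? ?] /andP[? ?] _ /andP[? ?] _ _.
  by apply/andP; split; lra.
- rewrite !ler_norml => /andP[? ?] _ _ _ /andP[? ?] _ _ /andP[? ?].
  by apply/andP; split; lra.
- rewrite !ler_norml => _ /andP[? ?] _ _ _ _ /andP[? ?] _.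
  by apply/andP; split; lra.
Qed.

(** Divide f by the real quadratic with roots l1 and its conjugate, then the quotient g by the one
    for l2. A small f(l1) makes the first remainder small; if the chord bound failed, g(l2) and so
    the second remainder would be small too. Then f would be nearly a multiple of both quadratics,
    against [no_two_quadratic_factors]. *)
Lemma transversality (s : seq R) (l1 l2 : C) (eta : R) :
  all (fun a => `|a| <= 1) s -> 0 < eta -> eta <= 1 ->
  cnorm l1 ^+ 2 <= 1/2 -> cnorm l2 ^+ 2 <= 1/2 ->
  eta <= `|l1.2| -> eta <= `|l2.2| -> 2 * eta <= `|l2.2 + l1.2| ->
  cnorm (hev (1 :: s) l1) <= eta ^+ 3 / 200 ->
  eta ^+ 3 / 200 * cdist l2 l1 <= cdist (hev (1 :: s) l2) (hev (1 :: s) l1).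
Proof.
move=> hs e0 e1 n1 n2 i1 i2 i12 small; rewrite leNgt; apply/negP => lt12.
set ka := eta ^+ 3 / 200 in small lt12.
have ka0 : 0 <= ka by rewrite /ka divr_ge0 ?exprn_ge0 ?ler0n// ltW.
have d12 : 0 < cdist l2 l1.
  rewrite lt_neqAle eq_sym cdist_ge0 andbT; apply/eqP => /cnorm_eq0 /eqP.
  by rewrite subr_eq0 => /eqP e12; move: lt12; rewrite e12 !cdistxx mulr0 ltxx.
have c1 : cnorm l1 <= 1 by have := cnorm_ge0 l1; nra.
have c2 : cnorm l2 <= 1 by have := cnorm_ge0 l2; nra.
pose f : {poly R} := Poly (1 :: s).
have f1 k : `|f`_k| <= 1.
  rewrite /f coef_Poly; case: (ltnP k (size (1 :: s))) => [|h].
    by case: k => [|k] /=; [rewrite normr1|rewrite ltnS => ks; exact: (all_nthP 0 hs)].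
  by rewrite nth_default// normr0.
have f0 : f`_0 = 1 by rewrite /f coef_Poly.
have [g [al [be fE]]] := div_quad (- (2 * l1.1)) (cnorm l1 ^+ 2) f.
have [h [ga [de gE]]] := div_quad (- (2 * l2.1)) (cnorm l2 ^+ 2) g.
have root (l : C) : cscale 1 (cmul l l) + cscale (- (2 * l.1)) l + (cnorm l ^+ 2, 0) = 0.
  by rewrite sqr_cnorm; apply: cpair_eq => /=; ring.
have lin c d z : ev (c *: 'X + d%:P) z = cscale c z + (d, 0).
  by rewrite evD evZ evC -['X]mul1r evMX evC cmulr1.
have fl1 : hev (1 :: s) l1 = cscale al l1 + (be, 0).
  by rewrite -ev_Poly -/f fE evD ev_quadM root lin cmulC cmulr0 add0r.
have [hal hbe] : `|al| <= ka / eta /\ `|be| <= 2 * ka / eta.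
  by apply: (linear_coef_bound _ _ _ _ l1) => //; rewrite -fl1.
have gl2 : ev g l2 = cscale ga l2 + (de, 0).
  by rewrite gE evD ev_quadM root lin cmulC cmulr0 add0r.
have ge : cnorm (ev g l2) <= ka / eta ^+ 2.
  (* The first quadratic is (z - l1)(z - conj l1), so the chord of f, corrected by the slope [al],
     is (l2 - conj l1) g(l2) times l2 - l1. The distance from l2 to conj l1 is at least
     [2 * eta]. *)
  have E : hev (1 :: s) l2 - hev (1 :: s) l1 - cscale al (l2 - l1) =
      cmul (l2 - l1) (cmul (l2 - (l1.1, - l1.2)) (ev g l2)).
    rewrite fl1 -ev_Poly -/f fE evD ev_quadM lin sqr_cnorm.
    by apply: cpair_eq => /=; ring.
  have := ler_cnormB (hev (1 :: s) l2 - hev (1 :: s) l1) (cscale al (l2 - l1)).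
  rewrite E !cnormM cnormZ -!/(cdist _ _) => B.
  have i12' : 2 * eta <= cdist l2 (l1.1, - l1.2).
    by apply: le_trans i12 (le_trans _ (cnorm_im _)); rewrite /= opprK.
  have B2 : cdist l2 (l1.1, - l1.2) * cnorm (ev g l2) <= ka + `|al|.
    rewrite -(ler_pM2l d12); apply: le_trans B _; nra.
  have kk : ka <= ka / eta by rewrite ler_pdivlMr// -[leRHS]mulr1 ler_wpM2l.
  rewrite expr2 invfM mulrA ler_pdivlMr// mulrC.
  have := cnorm_ge0 (ev g l2); nra.
have [hga hde] : `|ga| <= ka / eta ^+ 2 / eta /\ `|de| <= 2 * (ka / eta ^+ 2) / eta.
  apply: (linear_coef_bound _ _ _ _ l2) => //; last by rewrite -gl2.
  by rewrite divr_ge0// exprn_ge0// ltW.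
(* Three divisions by [eta] are spent, which explains the cube in [ka]. The total error is then
   [8/200], below the [1/18] allowed in [no_two_quadratic_factors]. *)
have k3 : ka / eta ^+ 2 / eta = 1/200.
  by rewrite /ka; field; rewrite gt_eqF.
have k1 : ka / eta <= 1/200.
  have -> : ka / eta = eta ^+ 2 / 200 by rewrite /ka; field; rewrite gt_eqF.
  by rewrite ler_pM2r ?invr_gt0// expr_le1// ltW.
rewrite k3 in hga; rewrite -mulrA k3 in hde; rewrite -mulrA in hbe.
have {hal} hal : `|al| <= 1/200 by exact: le_trans hal k1.
have {hbe} hbe : `|be| <= 2 * (1/200) by apply: le_trans hbe _; rewrite ler_pM2l.
have p1 (l : C) : cnorm l ^+ 2 <= 1/2 -> `|l.1| <= 1.
  by move=> hl; have := cnorm_re l; have := normr_ge0 l.1; clear -hl; nra.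
have pos (l : C) : cnorm l ^+ 2 <= 1/2 -> eta <= `|l.2| -> 0 < cnorm l ^+ 2 <= 1/2.
  move=> hl hi; rewrite hl andbT exprn_gt0//.
  exact: lt_le_trans (lt_le_trans e0 hi) (cnorm_im _).
pose b1 := cnorm l1 ^+ 2; have b1h : 0 < b1 <= 1/2 by exact: pos.
have a1h := p1 _ n1.
have b1' : `|b1| <= 1.
  by case/andP: b1h => h1 h2; rewrite gtr0_norm//; apply: le_trans h2 _; rewrite ler_pdivrMr// mul1r ler1n.
pose F := quad 1 (- (2 * l1.1)) b1 * (quad 1 (- (2 * l2.1)) (cnorm l2 ^+ 2) * h).
have FE : F = f - (al *: 'X + be%:P) - quad 1 (- (2 * l1.1)) b1 * (ga *: 'X + de%:P).
  by rewrite /F -/b1 fE {1}gE -/b1; ring.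
have Fd k : `|F`_k - f`_k| <= 8 * (1/200).
  have E : F - f = - (al *: 'X + be%:P + quad 1 (- (2 * l1.1)) b1 * (ga *: 'X + de%:P)).
    by rewrite FE; ring.
  by rewrite -coefB E coefN normrN; apply: quad_remainder_bound.
clear -Fd f0 f1 n1 n2 i2 b1h pos.
apply: (@no_two_quadratic_factors h l1.1 b1 l2.1 (cnorm l2 ^+ 2) (8 * (1/200))); rewrite -/F.
- by [].
- exact: pos.
- lra.
- lra.
- by have := Fd 0%N; rewrite f0 ler_norml => /andP[h1 _]; clear -h1; lra.
- move=> k; have -> : F`_k = f`_k + (F`_k - f`_k) by ring.
  exact: le_trans (ler_normD _ _) (lerD (f1 _) (Fd _)).
Qed.

End Transversality.

(** * Covers by balls *)

Section Series.
Context {R : realType}.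

Lemma pair_enumeration : exists g : nat -> nat * nat,
  (forall p, exists k, g k = p) /\
  forall f : nat -> nat -> \bar R, (forall i j, (0 <= f i j)%E) ->
    (\sum_(k <oo) f (g k).1 (g k).2 = \sum_(i <oo) \sum_(j <oo) f i j)%E.
Proof.
have /ppcard_eqP[g] : ([set: nat] #= [set: nat * nat])%card.
  by rewrite card_eq_sym; exact: card_nat2.
exists g; split=> [p|f f0].
  by have [k _ <-] := @surj _ _ _ _ g p I; exists k.
rewrite (@nneseries_esumT _ (fun k => f (g k).1 (g k).2)); last by move=> k; exact: f0.
rewrite [RHS]nneseries_esumT; last by move=> i; apply: nneseries_ge0 => *; exact: f0.
rewrite (eq_esum (fun i _ => nneseries_esumT (f0 i))) esum_esum//.
rewrite -[LHS](reindex_esum _ [set: nat * nat] _ (fun p => f p.1 p.2)); last exact: 'bij_g.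
by congr esum; apply/seteqP; split => -[].
Qed.

Lemma nneseries_term_le (f : nat -> \bar R) k : (forall i, (0 <= f i)%E) ->
  (f k <= \sum_(i <oo) f i)%E.
Proof.
move=> f0; apply: le_trans (nneseries_lim_ge k.+1 _); last by move=> *; exact: f0.
by rewrite big_nat_recr//= leeDr// sume_ge0// => *; exact: f0.
Qed.

End Series.

(** * Null sets defined by ball covers *)

Section Covers.
Context {R : realType}.
Local Notation C := (R * R)%type.
Implicit Types (E : set C) (s e : R).

(** Radius 0 is allowed, so that a finite cover can be padded by points, which have weight 0 for
    [s > 0]. *)
Definition ball_cover s e E := exists (c : nat -> C) (r : nat -> R),
  [/\ forall i, 0 <= r i, E `<=` \bigcup_i cball (c i) (r i) &
      (\sum_(i <oo) ((r i) `^ s)%:E <= e%:E)%E].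

Definition null_set s E := forall e, 0 < e -> ball_cover s e E.

Lemma ball_cover_sub s e E F : E `<=` F -> ball_cover s e F -> ball_cover s e E.
Proof. by move=> EF [c [r [r0 cv sm]]]; exists c, r; split => // x /EF/cv. Qed.

Lemma ball_cover_bigcup s e (E : nat -> set C) (d : nat -> R) :
  (forall k, ball_cover s (d k) (E k)) -> (\sum_(k <oo) (d k)%:E <= e%:E)%E ->
  ball_cover s e (\bigcup_k E k).
Proof.
move=> cv sd; have {cv} /choice[c /choice[r cr]] := cv.
have [g [gs gE]] := pair_enumeration (R := R).
exists (fun k => c (g k).1 (g k).2), (fun k => r (g k).1 (g k).2); split.
- by move=> k; have [+ _ _] := cr (g k).1; apply.
- move=> x [k _ Ex]; have [_ + _] := cr k => /(_ x Ex)[i _ xi].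
  by have [m gm] := gs (k, i); exists m => //=; rewrite gm.
- rewrite (gE (fun i j => ((r i j) `^ s)%:E)); last by move=> *; rewrite lee_fin powR_ge0.
  apply: le_trans sd; apply: lee_nneseries => k _; first by move=> _; apply: nneseries_ge0 => *; rewrite lee_fin powR_ge0.
  by have [] := cr k.
Qed.

Lemma null_setS s E F : E `<=` F -> null_set s F -> null_set s E.
Proof. by move=> EF h e e0; apply: ball_cover_sub EF (h e e0). Qed.

Lemma null_set_bigcup s (E : nat -> set C) :
  (forall k, null_set s (E k)) -> null_set s (\bigcup_k E k).
Proof.
move=> h e e0; apply: (ball_cover_bigcup _ _ _ (fun k => e / (2 ^ k.+1)%:R)).
  by move=> k; apply: h; rewrite divr_gt0// ltr0n expn_gt0.
by apply: (epsilon_trick0 xpredT); exact: ltW.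
Qed.

Lemma null_setU s E F : null_set s E -> null_set s F -> null_set s (E `|` F).
Proof.
move=> hE hF; apply: (@null_setS _ _ (\bigcup_k (if k is 0%N then E else F))).
  by move=> x [Ex|Fx]; [exists 0%N|exists 1%N].
by apply: null_set_bigcup => -[].
Qed.

Lemma ball_cover_finite s e E (xs : seq C) (rho : R) : 0 < s -> 0 <= rho ->
  (forall x, E x -> exists2 c, c \in xs & cdist c x <= rho) ->
  (size xs)%:R * rho `^ s <= e -> ball_cover s e E.
Proof.
move=> s0 r0 cv sz.
exists (nth 0 xs), (fun i => if (i < size xs)%N then rho else 0); split.
- by move=> i; case: ifP.
- move=> x /cv[c cxs cx]; exists (index c xs) => //.
  by rewrite index_mem cxs /cball /= nth_index.
- rewrite (nneseries_split 0 (size xs)); last first.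
    by move=> k _; rewrite lee_fin powR_ge0.
  rewrite [X in (_ + X)%E]eseries0 ?adde0; last first.
    by move=> i /= ni _; rewrite ltnNge ni /= powR0// gt_eqF.
  rewrite add0n big_nat (eq_bigr (fun=> (rho `^ s)%:E)); last by move=> i /= ->.
  by rewrite -big_nat sumEFin lee_fin big_const_nat subn0 iter_addr addr0 -mulr_natl.
Qed.

(** The covers in [null_set] carry no bound on the radii, but a small total weight forces every
    single radius to be small. *)
Lemma null_set_hausdorff s E : 0 < s -> null_set s E -> hausdorff_measure s E = 0%E.
Proof.
move=> s0 hE.
have dp0 U : (0 <= diam_pow s U)%E by apply: ereal_sup_ubound; left.
have d0 d : (0 <= hausdorff_delta s d E)%E.
  by apply: le_ereal_inf_tmp => v [U [_ [_ ->]]]; apply: nneseries_ge0.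
apply/eqP; rewrite eq_le; apply/andP; split; last first.
  by apply: le_trans (d0 1) _; apply: ereal_sup_ubound; exists 1 => //=.
apply: ge_ereal_sup => _ [d /= dpos <-].
apply/lee_addgt0Pr => e e0; rewrite add0e.
pose e' := Num.min (e / 2 `^ s) ((d / 2) `^ s).
have e'0 : 0 < e' by rewrite lt_min divr_gt0 ?powR_gt0// divr_gt0.
have [c [r [r0 cv sm]]] := hE _ e'0.
have rd k : 2 * r k <= d.
  have : r k `^ s <= (d / 2) `^ s.
    rewrite -lee_fin; apply: le_trans (le_trans sm _).
      by apply: (nneseries_term_le (fun i => (r i `^ s)%:E)) => i; rewrite lee_fin powR_ge0.
    by rewrite lee_fin ge_min lexx orbT.
  have dd : 0 <= d / 2 by rewrite divr_ge0// ltW.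
  move=> h; have : r k <= d / 2; last by lra.
  rewrite leNgt; apply/negP => lt; suff : (d / 2) `^ s < r k `^ s by rewrite ltNge h.
  by rewrite gt0_ltr_powR// nnegrE.
have bd k x y : cball (c k) (r k) x -> cball (c k) (r k) y -> cdist x y <= 2 * r k.
  rewrite /cball /= => h1 h2; apply: le_trans (ler_cdistD (c k) _ _) _.
  by rewrite mulr_natl mulr2n lerD// cdistC.
apply: (@le_trans _ _ (\sum_(i <oo) diam_pow s (cball (c i) (r i)))%E).
  apply: ereal_inf_lbound; exists (fun i => cball (c i) (r i)); split => //; split => //.
  by move=> i x y hx hy; apply: le_trans (bd _ _ _ hx hy) (rd _).
apply: (@le_trans _ _ (\sum_(i <oo) ((2 `^ s)%:E * (r i `^ s)%:E))%E).
  apply: lee_nneseries => // k _; apply: ge_ereal_sup => _ [->|[x [y [hx [hy ->]]]]].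
    by rewrite -EFinM lee_fin mulr_ge0// powR_ge0.
  rewrite -EFinM -powRM ?r0// lee_fin; apply: ge0_ler_powR; rewrite ?nnegrE ?cdist_ge0 ?mulr_ge0 ?r0//.
    exact: ltW.
  exact: (bd _ _ _ hx hy).
rewrite nneseriesZl; last by move=> *; rewrite lee_fin powR_ge0.
apply: (@le_trans _ _ ((2 `^ s)%:E * e'%:E)%E).
  by rewrite lee_pmul2l// lte_fin powR_gt0.
rewrite -EFinM lee_fin mulrC -ler_pdivlMr ?powR_gt0//.
by rewrite ge_min lexx.
Qed.

Lemma area_square (c : C) (r : R) : 0 <= r ->
  area (`[c.1 - r, c.1 + r]%classic `*` `[c.2 - r, c.2 + r]%classic) = (4 * r `^ 2)%:E.
Proof.
move=> r0; rewrite /area product_measure1E//.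
have lit (a : R) : lebesgue_measure `[a - r, a + r]%classic = (2 * r)%:E.
  rewrite lebesgue_measure_itv /= lte_fin.
  have [->|rp] := eqVneq r 0; first by rewrite subr0 addr0 ltxx mulr0.
  by rewrite ltrD2l gtrN ?lt_neqAle 1?eq_sym ?rp// -EFinB; congr EFin; ring.
apply: (etrans (congr2 mule (lit _) (lit _))).
by rewrite -EFinM powR_mulrn//; congr EFin; ring.
Qed.

(** Circumscribed squares replace the balls. Their unions are measurable for the product, and
    intersecting over a sequence of covers gives a measurable null superset. *)
Lemma null_set_negligible E : null_set 2 E -> (@area R).-negligible E.
Proof.
move=> hE.
pose mu : {measure set (measurableTypeR R * measurableTypeR R)%type -> \bar R} :=
  (lebesgue_measure \x lebesgue_measure)%E.
have /choice[c /choice[r cr]] := fun k : nat => hE k.+1%:R^-1 ltac:(by rewrite invr_gt0 ltr0n).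
pose sq k i : set (measurableTypeR R * measurableTypeR R)%type :=
  `[(c k i).1 - r k i, (c k i).1 + r k i]%classic `*`
  `[(c k i).2 - r k i, (c k i).2 + r k i]%classic.
have msq k i : measurable (sq k i) by apply: measurableX; exact: measurable_itv.
pose U k := \bigcup_i sq k i.
have mU k : measurable (U k) by exact: bigcup_measurable.
exists (\bigcap_k U k); split; first exact: bigcap_measurable.
- change (mu (\bigcap_k U k) = 0%E); apply/eqP; rewrite eq_le measure_ge0 andbT.
  apply/lee_addgt0Pr => e e0; rewrite add0e.
  pose k := Num.truncn (4 / e).
  apply: (@le_trans _ _ (mu (U k))).
    by apply: le_measure; rewrite ?inE//; [exact: bigcap_measurable|exact: bigcap_inf].
  apply: (le_trans (measure_sigma_subadditive mu (msq k) (mU k) (fun x => id))).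
  have [r0 _ sm] := cr k.
  rewrite (eq_eseriesr (g := fun i => ((4 : R)%:E * (r k i `^ 2)%:E)%E)); last first.
    by move=> i _; rewrite -EFinM -(area_square (c k i)).
  rewrite nneseriesZl; last by move=> *; rewrite lee_fin powR_ge0.
  apply: (@le_trans _ _ ((4 : R)%:E * (k.+1%:R^-1)%:E)%E); first by rewrite lee_pmul2l.
  rewrite -EFinM lee_fin ler_pdivrMr ?ltr0n// mulrC -ler_pdivrMr//.
  by apply: ltW; rewrite truncnS_gt.
- move=> x Ex k _; have [_ + _] := cr k => /(_ x Ex)[i _]; rewrite /cball /= => xi.
  exists i => //; split; rewrite /= in_itv /=.
    have := le_trans (cnorm_re _) xi; rewrite /= ler_norml => /andP[? ?].
    by apply/andP; split; lra.
  have := le_trans (cnorm_im _) xi; rewrite /= ler_norml => /andP[? ?].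
  by apply/andP; split; lra.
Qed.

End Covers.

(** * Porous sets have area zero *)

Section Porous.
Context {R : realType}.
Local Notation C := (R * R)%type.
Implicit Types (B : set C) (a x y z : C) (l rho c : R).

Lemma geometric_small (q e : R) : 0 <= q -> q < 1 -> 0 < e ->
  exists m, forall n, (m <= n)%N -> q ^+ n < e.
Proof.
move=> q0 q1 e0; have : (fun n => q ^+ n) @ \oo --> (0 : R).
  by apply: cvg_expr; rewrite ger0_norm.
move=> /cvgrPdist_lt/(_ e e0)[m _ h]; exists m => n mn.
have := h n mn; rewrite sub0r normrN ger0_norm// exprn_ge0//.
Qed.

Lemma truncn_bounds (x : R) : 0 <= x -> (Num.truncn x)%:R <= x < (Num.truncn x).+1%:R.
Proof. by move=> x0; rewrite truncnS_gt andbT truncn_le. Qed.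

Lemma grid_cell (a x l : R) K : (0 < K)%N -> 0 < l -> a <= x <= a + l ->
  exists2 i, (i < K)%N & a + i%:R * (l / K%:R) <= x <= a + i%:R * (l / K%:R) + l / K%:R.
Proof.
move=> K0 l0 /andP[ax xl]; have d0 : 0 < l / K%:R by rewrite divr_gt0// ltr0n.
set d := l / K%:R; have lE : l = K%:R * d.
  by rewrite /d mulrCA divff ?mulr1// pnatr_eq0 -lt0n.
have u0 : 0 <= (x - a) / d by rewrite divr_ge0 ?subr_ge0// ltW.
have /andP[t1 t2] := truncn_bounds _ u0; set t := Num.truncn _ in t1 t2.
rewrite ler_pdivlMr// in t1; rewrite ltr_pdivrMr// -natr1 mulrDl mul1r in t2.
case: (ltnP t K) => tK; first by exists t => //; apply/andP; split; lra.
(* The integer part reaches [K] only at the right endpoint, which belongs to the last cell. *)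
exists K.-1; first by rewrite prednK.
have Kd : K%:R * d = K.-1%:R * d + d by rewrite -{1}(prednK K0) -natr1 mulrDl mul1r.
have : K%:R * d <= t%:R * d by rewrite ler_pM2r// ler_nat.
by move=> h; apply/andP; split; lra.
Qed.

Definition square a l : set C :=
  [set z | a.1 <= z.1 <= a.1 + l /\ a.2 <= z.2 <= a.2 + l].

Definition subsquare a l K (p : nat * nat) : C :=
  (a.1 + p.1%:R * (l / K%:R), a.2 + p.2%:R * (l / K%:R)).

Lemma square_grid a l K z : (0 < K)%N -> 0 < l -> square a l z ->
  exists i j, [/\ (i < K)%N, (j < K)%N & square (subsquare a l K (i, j)) (l / K%:R) z].
Proof.
move=> K0 l0 [z1 z2].
have [i iK hi] := grid_cell _ _ _ _ K0 l0 z1.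
by have [j jK hj] := grid_cell _ _ _ _ K0 l0 z2; exists i, j.
Qed.

Lemma square_cdist a l y z : square a l y -> square a l z -> cdist y z <= 2 * l.
Proof.
move=> [/andP[? ?] /andP[? ?]] [/andP[? ?] /andP[? ?]].
apply: le_trans (cnorm_le_sum _) _; rewrite mulr_natl mulr2n; apply: lerD => /=.
  by rewrite ler_norml; apply/andP; split; lra.
by rewrite ler_norml; apply/andP; split; lra.
Qed.

Definition porous c rho0 B := forall x rho, B x -> 0 < rho <= rho0 ->
  exists2 y, cdist x y <= rho & forall z, cdist y z <= c * rho -> ~ B z.

(** Either the subsquare just above and to the right of the centre misses [B], or it contains a
    point of [B]. In the second case the hole at scale [l / 4] is centred inside the square, and its
    radius exceeds the diameter of the subsquare containing that centre. *)
Lemma porous_empty_subsquare c rho0 B a l k :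
  0 < c -> 0 < l -> l <= rho0 -> (1 < k)%N -> 4 <= c * k%:R -> porous c rho0 B ->
  exists p : 'I_(2 * k) * 'I_(2 * k), forall z,
    square (subsquare a l (2 * k) (val p.1, val p.2)) (l / (2 * k)%:R) z -> ~ B z.
Proof.
move=> c0 l0 lr k1 ck pB; have k0 : (0 < k)%N by exact: ltn_trans k1.
have K0 : (0 < 2 * k)%N by rewrite muln_gt0.
have kK : (k < 2 * k)%N by rewrite mul2n -addnn -[ltnLHS]addn0 ltn_add2l.
pose d := l / (2 * k)%:R; have d0 : 0 < d by rewrite divr_gt0// ltr0n.
have kd : k%:R * d = l / 2.
  by rewrite /d natrM; field; rewrite pnatr_eq0 -lt0n.
have d4 : d <= l / 4.
  have : 2 * d <= k%:R * d by rewrite ler_pM2r// ler_nat.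
  by rewrite kd; lra.
have [[x [hx Bx]]|emp] := pselect (exists x, square (subsquare a l (2 * k) (k, k)) d x /\ B x);
    last first.
  by exists (Ordinal kK, Ordinal kK) => z hz Bz; apply: emp; exists z.
have [y xy hy] := pB x (l / 4) Bx ltac:(by apply/andP; split; lra).
have sy : square a l y.
  have h1 := le_trans (cnorm_re _) xy; have h2 := le_trans (cnorm_im _) xy.
  move: h1 h2 hx; rewrite /square /= kd !ler_norml.
  move=> /andP[? ?] /andP[? ?] [/andP[? ?] /andP[? ?]].
  by split; apply/andP; split; lra.
have [i [j [iK jK hij]]] := square_grid _ _ _ _ K0 l0 sy.
exists (Ordinal iK, Ordinal jK) => z hz; apply: hy.
apply: le_trans (square_cdist _ _ _ _ hij hz) _; rewrite -/d.
have : 4 * d <= c * k%:R * d by rewrite ler_pM2r.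
by rewrite -mulrA kd; lra.
Qed.

(** At every level one of the [(2 * k) ^ 2] subsquares of each remaining square is discarded. *)
Lemma porous_cover c rho0 B k m : 0 < c -> (1 < k)%N -> 4 <= c * k%:R ->
  porous c rho0 B -> forall a l, 0 < l -> l <= rho0 ->
  exists2 xs : seq C, (size xs <= ((2 * k) ^ 2).-1 ^ m)%N &
    forall z, square a l z -> B z ->
      exists2 b, b \in xs & square b (l / (2 * k)%:R ^+ m) z.
Proof.
move=> c0 k1 ck pB; elim: m => [|m IH] a l l0 lr.
  by exists [:: a] => // z hz _; exists a; rewrite ?inE// expr0 divr1.
have K0 : (0 < 2 * k)%N by rewrite muln_gt0/= ltnW.
have [p0 hp0] := @porous_empty_subsquare c rho0 B a l k c0 l0 lr k1 ck pB.
pose d := l / (2 * k)%:R; have d0 : 0 < d by rewrite divr_gt0// ltr0n.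
have dr : d <= rho0.
  by apply: le_trans lr; rewrite ler_pdivrMr ?ltr0n// ler_peMr ?ler1n// ltW.
have /choice[f hf] : forall p : 'I_(2 * k) * 'I_(2 * k), exists xs : seq C,
    (size xs <= ((2 * k) ^ 2).-1 ^ m)%N /\
    forall z, square (subsquare a l (2 * k) (val p.1, val p.2)) d z -> B z ->
      exists2 b, b \in xs & square b (d / (2 * k)%:R ^+ m) z.
  by move=> p; have [xs h1 h2] := IH (subsquare a l (2 * k) (val p.1, val p.2)) d d0 dr; exists xs.
exists (flatten [seq f p | p <- enum (predC1 p0)]).
  rewrite size_flatten /shape -map_comp sumnE big_map expnS.
  apply: (@leq_trans (\sum_(p <- enum (predC1 p0)) ((2 * k) ^ 2).-1 ^ m)).
    by apply: leq_sum => p _; have [] := hf p.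
  by rewrite big_const_seq count_predT iter_addn addn0 mulnC -cardE cardC1 card_prod !card_ord mulnn.
move=> z hz Bz; have [i [j [iK jK hij]]] := square_grid _ _ _ _ K0 l0 hz.
have pp0 : (Ordinal iK, Ordinal jK) != p0.
  by apply/eqP => e; apply: hp0 Bz; rewrite -e.
have [_ /(_ z hij Bz)[b bx hb]] := hf (Ordinal iK, Ordinal jK).
exists b; last by rewrite exprS invfM mulrA.
apply/flattenP; exists (f (Ordinal iK, Ordinal jK)) => //.
by apply: map_f; rewrite mem_enum.
Qed.

Lemma porous_null_square c rho0 B a l : 0 < c -> 0 < l -> l <= rho0 -> porous c rho0 B ->
  null_set 2 (B `&` square a l).
Proof.
move=> c0 l0 lr pB e e0.
pose k := (Num.truncn (4 / c)).+2.
have ck : 4 <= c * k%:R.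
  rewrite mulrC -ler_pdivrMr//; apply: ltW.
  by apply: lt_le_trans (truncnS_gt _) _; rewrite ler_nat.
(* The share of the area that survives one subdivision. *)
pose q : R := (((2 * k) ^ 2).-1)%:R / ((2 * k) ^ 2)%:R.
have K0 : (0 < (2 * k) ^ 2)%N by rewrite expn_gt0 muln_gt0.
have q0 : 0 <= q by rewrite divr_ge0.
have q1 : q < 1 by rewrite ltr_pdivrMr ?ltr0n// mul1r ltr_nat prednK.
have [m hm] := geometric_small q (e / (4 * l ^+ 2)) q0 q1
  ltac:(by rewrite divr_gt0// mulr_gt0// exprn_gt0).
have [xs sx hx] := @porous_cover c rho0 B k m c0 isT ck pB a l l0 lr.
have dm : 0 < l / (2 * k)%:R ^+ m by rewrite divr_gt0// exprn_gt0// ltr0n muln_gt0.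
apply: (@ball_cover_finite _ _ _ _ xs (2 * (l / (2 * k)%:R ^+ m))) => //.
- by rewrite mulr_ge0// ltW.
- move=> z [Bz hz]; have [b bx hb] := hx z hz Bz; exists b => //.
  apply: (square_cdist b) => //; split; apply/andP; split=> //; rewrite lerDl ltW//.
- rewrite powR_mulrn; last by rewrite mulr_ge0// ltW.
  have := hm m (leqnn m); rewrite ltr_pdivlMr ?mulr_gt0 ?exprn_gt0// => h.
  apply: le_trans (ltW h).
  have -> : q ^+ m * (4 * l ^+ 2) =
     ((((2 * k) ^ 2).-1 ^ m)%N)%:R * (2 * (l / (2 * k)%:R ^+ m)) ^+ 2.
    rewrite /q expr_div_n [((2 * k) ^ 2)%:R]natrX exprAC natrX.
    by move: (_ ^+ m) (_ ^+ m) dm => A X dm; rewrite exprMn expr_div_n; ring.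
  by rewrite ler_wpM2r ?sqr_ge0// ler_nat.
Qed.

Lemma porous_null c rho0 B : 0 < c -> 0 < rho0 -> porous c rho0 B ->
  (forall z, B z -> cnorm z <= 1) -> null_set 2 B.
Proof.
move=> c0 r0 pB B1.
pose N := (Num.truncn (2 / rho0)).+1.
have Nr : 2 / N%:R <= rho0.
  by rewrite ler_pdivrMr ?ltr0n// mulrC -ler_pdivrMr//; apply/ltW/truncnS_gt.
apply: (@null_setS _ _ _
  (\bigcup_i \bigcup_j (B `&` square (subsquare (-1, -1) 2 N (i, j)) (2 / N%:R)))).
  move=> z Bz; have sz : square (-1, -1) 2 z.
    have := le_trans (cnorm_re _) (B1 _ Bz); have := le_trans (cnorm_im _) (B1 _ Bz).
    rewrite !ler_norml => /andP[? ?] /andP[? ?].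
    by split => /=; apply/andP; split; lra.
  have [i [j [_ _ hij]]] := square_grid _ _ N _ isT (ltr0Sn R 1) sz.
  by exists i => //; exists j.
apply: null_set_bigcup => i; apply: null_set_bigcup => j.
by apply: (@porous_null_square c rho0) => //; rewrite divr_gt0// ltr0n.
Qed.

End Porous.

(** * Code points *)

Section Codes.
Context {R : realType}.
Local Notation C := (R * R)%type.
Implicit Types (a : nat -> R) (l z : C) (w : seq bool) (om : nat -> bool).

Lemma cvg_cdistP (u : nat -> C) z :
  u n @[n --> \oo] --> z <->
  forall e : R, 0 < e -> exists N, forall n, (N <= n)%N -> cdist (u n) z < e.
Proof.
split=> [/cvgrPdist_lt h e e0|h].
  have [N _ hN] := h (e / 2) ltac:(by rewrite divr_gt0); exists N => n Nn.
  have := hN n Nn; rewrite /= prod_normE /= gt_max => /andP[h1 h2].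
  rewrite cdistC; apply: le_lt_trans (cnorm_le_sum _) _.
  by rewrite [e]splitr ltrD.
apply/cvgrPdist_lt => e e0; have [N hN] := h e e0.
exists N => // n Nn; rewrite /= prod_normE /= gt_max.
have := hN n Nn; rewrite cdistC => hn.
by rewrite (le_lt_trans (cnorm_re _) hn) (le_lt_trans (cnorm_im _) hn).
Qed.

Lemma mkseqD (T : Type) (f : nat -> T) m n :
  mkseq f (m + n) = mkseq f m ++ mkseq (fun i => f (m + i)%N) n.
Proof.
rewrite /mkseq iotaD map_cat add0n; congr (_ ++ _).
by rewrite -[m in LHS]addn0 iotaDl -map_comp.
Qed.

Lemma psum_split a l m n : psum a l (m + n) =
  psum a l m + cmul (cexp l m) (psum (fun i => a (m + i)%N) l n).
Proof. by rewrite !psum_hev mkseqD hev_cat size_mkseq. Qed.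

Lemma psum_bound a l n : (forall k, `|a k| <= 1) -> cnorm l < 1 ->
  cnorm (psum a l n) <= (1 - cnorm l)^-1.
Proof.
move=> ha l1; rewrite psum_hev; apply: hev_bound => //.
by apply/allP => x /mapP[k _ ->].
Qed.

Lemma psum_diff a l m n : (forall k, `|a k| <= 1) -> cnorm l < 1 -> (m <= n)%N ->
  cdist (psum a l n) (psum a l m) <= (1 - cnorm l)^-1 * cnorm l ^+ m.
Proof.
move=> ha l1 /subnKC <-; rewrite psum_split /cdist addrC addKr cnormM cnorm_cexp mulrC.
by apply: ler_wpM2r; [rewrite exprn_ge0|apply: psum_bound].
Qed.

Lemma psum_tail a l z m : (forall k, `|a k| <= 1) -> cnorm l < 1 ->
  psum a l n @[n --> \oo] --> z ->
  cdist z (psum a l m) <= (1 - cnorm l)^-1 * cnorm l ^+ m.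
Proof.
move=> ha l1 /cvg_cdistP h; apply/ler_addgt0Pr => e e0.
have [N hN] := h e e0.
apply: le_trans (ler_cdistD (psum a l (maxn m N)) _ _) _.
rewrite addrC; apply: lerD; first by apply: psum_diff => //; rewrite leq_maxl.
by rewrite cdistC; apply/ltW/hN; rewrite leq_maxr.
Qed.

Lemma psum_cvg a l : (forall k, `|a k| <= 1) -> cnorm l < 1 ->
  exists z, psum a l n @[n --> \oo] --> z.
Proof.
move=> ha l1.
have E n : psum a l n = (\sum_(0 <= k < n) a k * (cexp l k).1,
    \sum_(0 <= k < n) a k * (cexp l k).2).
  rewrite /psum !big_mkord; elim: n => [|n IH]; first by rewrite !big_ord0.
  by rewrite !big_ord_recr /= IH.
have cvg_comp (u : nat -> R) : (forall k, `|u k| <= cnorm l ^+ k) -> cvgn (series u).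
  move=> hu; apply: normed_cvg.
  apply: (@series_le_cvg _ _ (geometric 1 (cnorm l))) => [n|n|n|].
  - by rewrite /= normr_ge0.
  - by rewrite /geometric /= mul1r exprn_ge0.
  - by rewrite /geometric /= mul1r.
  - by apply: is_cvg_geometric_series; rewrite ger0_norm.
have bd k (x : R) : `|x| <= cnorm (cexp l k) -> `|a k * x| <= cnorm l ^+ k.
  by rewrite cnorm_cexp => hx; rewrite normrM -[leRHS]mul1r ler_pM.
have h1 := cvg_comp (fun k => a k * (cexp l k).1) (fun k => bd _ _ (cnorm_re _)).
have h2 := cvg_comp (fun k => a k * (cexp l k).2) (fun k => bd _ _ (cnorm_im _)).
exists (limn (series (fun k => a k * (cexp l k).1)), limn (series (fun k => a k * (cexp l k).2))).
under eq_fun do rewrite E.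
exact: (cvg_pair h1 h2).
Qed.

Lemma psum_lim_unique a l z z' :
  psum a l n @[n --> \oo] --> z -> psum a l n @[n --> \oo] --> z' -> z = z'.
Proof. by move=> h h'; apply: cvg_unique h h'; exact: norm_hausdorff. Qed.

Definition sg (b : bool) : R := if b then 1 else -1.

Lemma sg_norm b : `|sg b| <= 1. Proof. by case: b; rewrite /= ?normrN normr1. Qed.

Definition pw w l : C := hev (map sg w) l.

Lemma pw_cat u v l : pw (u ++ v) l = pw u l + cmul (cexp l (size u)) (pw v l).
Proof. by rewrite /pw map_cat hev_cat size_map. Qed.

Lemma pw_mkseq om l n : pw (mkseq om n) l = psum (sg \o om) l n.
Proof. by rewrite psum_hev /pw /mkseq -map_comp. Qed.

(** The limit is selected by [xget], with value 0 where the series diverges; for [cnorm l < 1] it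
    converges. *)
Definition code_point l om : C :=
  xget (0 : C) ([set z | psum (sg \o om) l n @[n --> \oo] --> z] : set C).

Lemma code_point_cvg l om : cnorm l < 1 -> psum (sg \o om) l n @[n --> \oo] --> code_point l om.
Proof.
move=> l1; have [z hz] := @psum_cvg (sg \o om) l (fun k => sg_norm _) l1.
exact: (xgetPex (0 : C) (P := [set z | psum (sg \o om) l n @[n --> \oo] --> z] : set C) (ex_intro _ z hz)).
Qed.

Lemma code_point_tail l om n : cnorm l < 1 ->
  cdist (code_point l om) (pw (mkseq om n) l) <= (1 - cnorm l)^-1 * cnorm l ^+ n.
Proof.
move=> l1; rewrite pw_mkseq; apply: psum_tail => //; last exact: code_point_cvg.
by move=> k; exact: sg_norm.
Qed.

Lemma code_point_shift l om n : cnorm l < 1 ->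
  code_point l om = pw (mkseq om n) l +
    cmul (cexp l n) (code_point l (fun i => om (n + i)%N)).
Proof.
move=> l1; apply: (psum_lim_unique (sg \o om) l); first exact: code_point_cvg.
apply/cvg_cdistP => e e0.
have /cvg_cdistP/(_ e e0)[N hN] := code_point_cvg l (fun i => om (n + i)%N) l1.
exists (n + N)%N => m nm; have nm' : (n <= m)%N by exact: leq_trans (leq_addr _ _) nm.
rewrite -(subnKC nm') psum_split pw_mkseq /cdist opprD addrACA subrr add0r -cmulBr cnormM.
rewrite cnorm_cexp; apply: le_lt_trans (hN (m - n)%N _); last by rewrite leq_subRL.
by rewrite ler_piMl// exprn_ile1// ltW.
Qed.

Lemma AsetE l : cnorm l < 1 -> Aset l = range (code_point l).
Proof.
move=> l1; apply/seteqP; split => z /= [a].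
  move=> [ha hz]; exists (fun k => a k == 1) => //.
  have aE : a = sg \o (fun k => a k == 1).
    apply/funext => k /=; have [->|->] := ha k; first by rewrite eqxx.
    by rewrite lt_eqF//; lra.
  by rewrite aE in hz; exact: (psum_lim_unique _ _ _ _ (code_point_cvg _ _ l1) hz).
move=> _ <-; exists (sg \o a); split; last exact: code_point_cvg.
by move=> n /=; case: (a n); [left|right].
Qed.

Lemma sdim_gt0 l : l != 0 -> cnorm l < 1 -> 0 < sdim l.
Proof.
move=> l0 l1; rewrite /sdim (negbTE l0) divr_gt0 ?ln_gt0 ?ltr1n// oppr_gt0 ln_lt0//.
by rewrite cnorm_gt0.
Qed.

(** The defining property of the similarity dimension: one contraction by [l] halves the weight, so
    a cylinder of level [n] weighs [2 ^- n]. *)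
Lemma powR_sdim l n : l != 0 -> cnorm l < 1 -> (cnorm l ^+ n) `^ sdim l = 2 ^- n.
Proof.
move=> l0 l1; have p0 := cnorm_gt0 _ l0.
have nz : ln (cnorm l) != 0 by rewrite lt_eqF// ln_lt0// p0.
have h : cnorm l `^ sdim l = 2^-1.
  rewrite /powR gt_eqF// /sdim (negbTE l0).
  have -> : ln 2 / - ln (cnorm l) * ln (cnorm l) = - ln 2 by field.
  by rewrite expRN lnK// posrE.
rewrite -powR_mulrn ?ltW// -powRrM mulrC powRrM h powR_mulrn ?invr_ge0//.
by rewrite exprVn.
Qed.

Lemma sdim_ge0 l : cnorm l < 1 -> 0 <= sdim l.
Proof.
move=> l1; have [->|l0] := eqVneq l 0; first by rewrite /sdim eqxx.
exact/ltW/sdim_gt0.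
Qed.

End Codes.

(** * Close words force zero Hausdorff measure *)

Section ZeroHausdorff.
Context {R : realType}.
Local Notation C := (R * R)%type.
Implicit Types (l z x : C) (u v w : seq bool) (E : set C) (s e : R).

Lemma ball_cover_le s e e' E : e <= e' -> ball_cover s e E -> ball_cover s e' E.
Proof.
move=> ee [c [r [r0 cv sm]]]; exists c, r; split => //.
by apply: le_trans sm _; rewrite lee_fin.
Qed.

Lemma ball_cover0 s : 0 < s -> ball_cover s 0 (set0 : set C).
Proof.
move=> s0; apply: (@ball_cover_finite _ s 0 set0 [::] 0) => //.
by rewrite mul0r.
Qed.

Lemma ball_coverU s e1 e2 E F : 0 < s -> 0 <= e1 -> 0 <= e2 ->
  ball_cover s e1 E -> ball_cover s e2 F -> ball_cover s (e1 + e2) (E `|` F).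
Proof.
move=> s0 e10 e20 h1 h2.
apply: (@ball_cover_sub _ _ _ _
  (\bigcup_k (if k is 0 then E else if k is 1 then F else set0))).
  by move=> x [Ex|Fx]; [exists 0%N|exists 1%N].
apply: (@ball_cover_bigcup _ _ _ _ (fun k => if k is 0 then e1 else if k is 1 then e2 else 0)).
  by move=> [|[|k]] //; exact: ball_cover0.
rewrite (nneseries_split 0 2); last by move=> [|[|k]] _; rewrite lee_fin.
rewrite [X in (_ + X)%E]eseries0 ?adde0; last by move=> [|[|k]].
by rewrite add0n !big_nat_recr//= big_nil add0e.
Qed.

Lemma ball_cover_seq (T : eqType) s e (xs : seq T) (E : T -> set C) : 0 < s -> 0 <= e ->
  (forall x : T, x \in xs -> ball_cover s e (E x)) ->
  ball_cover s ((size xs)%:R * e) [set z | exists2 x, x \in xs & E x z].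
Proof.
move=> s0 e0; elim: xs => [|x xs IH] h.
  by rewrite mul0r; apply: ball_cover_sub (ball_cover0 _ s0) => z [].
have hx := h x (mem_head _ _).
have hxs := IH (fun y yx => h y (@mem_behead _ (x :: xs) y yx)).
rewrite /= -natr1 mulrDl mul1r addrC.
apply: ball_cover_sub (ball_coverU s e ((size xs)%:R * e) _ _ s0 e0 _ hx hxs).
  move=> z [y]; rewrite inE => /predU1P[->|yx] Ey; first by left.
  by right; exists y.
by rewrite mulr_ge0.
Qed.

(** The similarity that carries [Aset l] onto its cylinder with code prefix [w]. *)
Definition sim w l x : C := pw w l + cmul (cexp l (size w)) x.

Lemma sim_cdist w l x y : cdist (sim w l x) (sim w l y) = cnorm l ^+ size w * cdist x y.
Proof. by rewrite /cdist /sim opprD addrACA subrr add0r -cmulBr cnormM cnorm_cexp. Qed.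

Lemma ball_cover_sim l w e E : l != 0 -> cnorm l < 1 -> 
  ball_cover (sdim l) e E -> ball_cover (sdim l) (2 ^- size w * e) (sim w l @` E).
Proof.
move=> l0 l1 [c [r [r0 cv sm]]].
exists (fun i => sim w l (c i)), (fun i => cnorm l ^+ size w * r i); split.
- by move=> i; rewrite mulr_ge0// exprn_ge0.
- move=> _ [x /cv[i _ xi] <-]; exists i => //; rewrite /cball /= sim_cdist.
  by rewrite ler_wpM2l// exprn_ge0.
- rewrite (eq_eseriesr (g := fun i => ((2 ^- size w)%:E * (r i `^ sdim l)%:E)%E)); last first.
    by move=> i _; rewrite powRM ?exprn_ge0// powR_sdim.
  rewrite nneseriesZl; last by move=> *; rewrite lee_fin powR_ge0.
  by rewrite EFinM lee_pmul2l// lte_fin invr_gt0 exprn_gt0.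
Qed.

Definition words n : seq (seq bool) := [seq val t | t : n.-tuple bool].

Lemma mem_words n w : (w \in words n) = (size w == n).
Proof.
apply/mapP/eqP => [[t _ ->]|sw]; first exact: size_tuple.
by exists (Tuple (introT eqP sw)); rewrite ?mem_enum.
Qed.

Lemma uniq_words n : uniq (words n).
Proof. by rewrite map_inj_uniq ?enum_uniq//; exact: val_inj. Qed.

Lemma size_words n : size (words n) = (2 ^ n)%N.
Proof. by rewrite size_map -cardE card_tuple card_bool. Qed.

Lemma size_words_notin n (U : seq (seq bool)) : uniq U -> all (fun u => size u == n) U ->
  ((size [seq w <- words n | w \notin U]) + size U = 2 ^ n)%N.
Proof.
move=> uU aU; rewrite -(size_words n) size_filter -(count_predC (mem U) (words n)) addnC.
congr addn; rewrite -size_filter; apply: perm_size; apply: uniq_perm => //.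
  by rewrite filter_uniq// uniq_words.
move=> u; rewrite mem_filter /= mem_words; case: (boolP (u \in U)) => //= uu.
by rewrite (allP aU _ uu).
Qed.

Lemma Aset_sim l n z : cnorm l < 1 -> Aset l z ->
  exists2 w, size w = n & (sim w l @` Aset l) z.
Proof.
move=> l1; rewrite AsetE// => -[om _ <-]; exists (mkseq om n); first by rewrite size_mkseq.
exists (code_point l (fun i => om (n + i)%N)); first by exists (fun i => om (n + i)%N).
by rewrite /sim size_mkseq -code_point_shift.
Qed.

Lemma Aset_bound l z : cnorm l < 1 -> Aset l z -> cnorm z <= (1 - cnorm l)^-1.
Proof.
move=> l1; rewrite AsetE// => -[om _ <-].
have := @code_point_tail _ l om 0 l1.
by rewrite pw_mkseq /psum big_ord0 expr0 mulr1 /cdist subr0.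
Qed.

(** For words of equal length [sim u l] and [sim v l] differ by a translation; the condition says
    that it is small relative to their common contraction ratio. *)
Definition close_words l e := exists u v,
  [/\ size u = size v, u != v & cdist (pw u l) (pw v l) <= e * cnorm l ^+ size u].

(** Doubling: each word of a cluster of size 2^k is prefixed by either member of a close pair. The
    prefixes have equal length, so the old distances shrink by the right factor. *)
Lemma many_close_words l k : l != 0 -> (forall e, 0 < e -> close_words l e) ->
  forall d : R, 0 < d -> exists n (U : seq (seq bool)),
    [/\ uniq U, size U = (2 ^ k)%N, all (fun u => size u == n) U &
        {in U &, forall u v, cdist (pw u l) (pw v l) <= d * cnorm l ^+ n}].
Proof.
move=> l0 hl; have p0 := cnorm_gt0 _ l0; elim: k => [|k IH] d d0.
  exists 0%N, [:: [::]]; split => // u v; rewrite !inE => /eqP -> /eqP ->.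
  by rewrite cdistxx mulr_ge0// ltW.
have [n [U [uU sU aU cU]]] := IH (d / 2) ltac:(by rewrite divr_gt0).
(* The prefix pair must be close relative to the final length [size u0 + n], hence the extra factor
   [cnorm l ^+ n]. *)
have [u0 [v0 [suv neq cl]]] := hl (d / 2 * cnorm l ^+ n)
  ltac:(by rewrite mulr_gt0 ?exprn_gt0// divr_gt0).
exists (size u0 + n)%N, ([seq u0 ++ u | u <- U] ++ [seq v0 ++ u | u <- U]).
have inj w : injective (cat w) by move=> x y /eqP; rewrite eqseq_cat// eqxx => /eqP.
have bd a b u v : a \in [:: u0; v0] -> b \in [:: u0; v0] -> u \in U -> v \in U ->
    cdist (pw (a ++ u) l) (pw (b ++ v) l) <= d * cnorm l ^+ (size u0 + n).
  move=> ha hb hu hv.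
  have sa c : c \in [:: u0; v0] -> size c = size u0.
    by rewrite !inE => /orP[/eqP ->|/eqP ->].
  rewrite /cdist !pw_cat (sa _ ha) (sa _ hb) opprD addrACA -cmulBr.
  apply: le_trans (ler_cnormD _ _) _; rewrite cnormM cnorm_cexp.
  have h1 : cnorm (pw a l - pw b l) <= d / 2 * cnorm l ^+ (size u0 + n).
    have := cl; rewrite -mulrA -exprD addnC => h.
    have h0 : 0 <= d / 2 * cnorm l ^+ (size u0 + n) by rewrite mulr_ge0 ?exprn_ge0// divr_ge0// ltW.
    move: ha hb; rewrite !inE => /orP[/eqP ->|/eqP ->] /orP[/eqP ->|/eqP ->] //.
    - by rewrite subrr cnorm0.
    - by rewrite -/(cdist _ _) cdistC.
    - by rewrite subrr cnorm0.
  have h2 : cnorm l ^+ size u0 * cnorm (pw u l - pw v l) <= d / 2 * cnorm l ^+ (size u0 + n).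
    by rewrite exprD mulrCA ler_wpM2l ?exprn_ge0//; exact: cU.
  by apply: le_trans (lerD h1 h2) _; rewrite -mulrDl -splitr.
split.
- rewrite cat_uniq !map_inj_uniq ?uU//=; try exact: inj.
  rewrite andbT; apply/hasPn => _ /mapP[u hu ->]; apply/negP => /mapP[v hv].
  by move=> /eqP; rewrite eqseq_cat// eq_sym (negbTE neq).
- by rewrite size_cat !size_map sU expnS mul2n addnn.
- by rewrite all_cat !all_map; apply/andP; split; apply/allP => u /(allP aU)/eqP su /=;
    rewrite size_cat su// suv.
- move=> x y; rewrite !mem_cat => /orP[]/mapP[u hu ->] /orP[]/mapP[v hv ->];
  by apply: bd; rewrite ?inE ?eqxx ?orbT.
Qed.

(** The cylinders of all words in [U] lie in one ball of radius comparable to |l|^n; the other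
    cylinders of level [n] receive scaled copies of the given cover. *)
Lemma Aset_cover_step l n (U : seq (seq bool)) e : l != 0 -> cnorm l < 1 -> 0 <= e ->
  uniq U -> all (fun u => size u == n) U ->
  {in U &, forall u v, cdist (pw u l) (pw v l) <= cnorm l ^+ n} ->
  ball_cover (sdim l) e (Aset l) ->
  ball_cover (sdim l) ((1 + (1 - cnorm l)^-1) `^ sdim l * 2 ^- n +
    (1 - (size U)%:R * 2 ^- n) * e) (Aset l).
Proof.
move=> l0 l1 e0 uU aU cU cA; set D := (1 - cnorm l)^-1.
have D0 : 0 <= D by rewrite invr_ge0 subr_ge0 ltW.
have p2 : 0 < (2 : R) ^- n by rewrite invr_gt0 exprn_gt0.
set V := [seq w <- words n | w \notin U].
have sV : (size V)%:R = 2 ^+ n - (size U)%:R :> R.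
  by rewrite -natrX -(size_words_notin n U uU aU) natrD addrK.
have cV : ball_cover (sdim l) ((1 - (size U)%:R * 2 ^- n) * e)
    [set z | exists2 w, w \in V & (sim w l @` Aset l) z].
  have -> : (1 - (size U)%:R * 2 ^- n) * e = (size V)%:R * (2 ^- n * e).
    by rewrite sV; field; rewrite gt_eqF// exprn_gt0.
  apply: ball_cover_seq; [exact: sdim_gt0|by rewrite mulr_ge0// ltW|].
  move=> w; rewrite mem_filter mem_words => /andP[_ /eqP <-].
  exact: ball_cover_sim.
have cU' : ball_cover (sdim l) ((1 + D) `^ sdim l * 2 ^- n)
    [set z | exists2 w, w \in U & (sim w l @` Aset l) z].
  apply: (@ball_cover_finite _ _ _ _ [:: pw (head [::] U) l] ((1 + D) * cnorm l ^+ n)).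
  - exact: sdim_gt0.
  - by rewrite mulr_ge0 ?addr_ge0// exprn_ge0.
  - move=> z [w wU [x Ax <-]]; exists (pw (head [::] U) l); rewrite ?inE//.
    have hU : head [::] U \in U by case: (U) wU => //= a b _; rewrite mem_head.
    apply: le_trans (ler_cdistD (pw w l) _ _) _; rewrite mulrDl mul1r lerD ?cU//.
    rewrite /cdist /sim opprD addrA subrr sub0r cnormN cnormM cnorm_cexp.
    rewrite (eqP (allP aU _ wU)) mulrC ler_wpM2r ?exprn_ge0//.
    exact: Aset_bound.
  - by rewrite mul1r powRM ?addr_ge0 ?exprn_ge0// powR_sdim.
apply: ball_cover_sub (ball_coverU _ _ _ _ _ (sdim_gt0 _ l0 l1) _ _ cU' cV).
- move=> z Az; have [w sw hw] := Aset_sim l n z l1 Az.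
  have [wU|wU] := boolP (w \in U); [by left; exists w|right; exists w => //].
  by rewrite mem_filter wU mem_words sw eqxx.
- by rewrite mulr_ge0 ?powR_ge0// ltW.
- rewrite mulr_ge0// subr_ge0 ler_pdivrMr ?exprn_gt0// mul1r.
  by rewrite -subr_ge0 -sV.
Qed.

(** Iterating [Aset_cover_step] with a cluster of [N = 2^k] words gives an affine recursion for the
    total weight. It contracts by [q < 1] towards its fixed point [c / N], which is small for large
    [k]. *)
Lemma close_words_null_set l : l != 0 -> cnorm l < 1 -> (forall e, 0 < e -> close_words l e) ->
  null_set (sdim l) (Aset l).
Proof.
move=> l0 l1 hl e e0; set D := (1 - cnorm l)^-1.
have D0 : 0 <= D by rewrite invr_ge0 subr_ge0 ltW.
have s0 := sdim_gt0 _ l0 l1.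
set c := (1 + D) `^ sdim l; have c0 : 0 < c by rewrite powR_gt0// ltr_wpDr.
have [k hk] : exists k, c / (2 ^ k)%:R <= e / 2.
  have h2 : 0 <= (2^-1 : R) by [].
  have [k hk] := geometric_small 2^-1 (e / 2 / c) h2 ltac:(lra)
     ltac:(by rewrite !divr_gt0).
  exists k; have := ltW (hk k (leqnn k)); rewrite ler_pdivlMr// mulrC.
  by rewrite natrX exprVn.
have [n [U [uU sU aU cU]]] := many_close_words l k l0 hl 1 ltr01.
have {}cU : {in U &, forall u v, cdist (pw u l) (pw v l) <= cnorm l ^+ n}.
  by move=> u v hu hv; have := cU u v hu hv; rewrite mul1r.
have p2 : 0 < (2 : R) ^+ n by rewrite exprn_gt0.
set N : R := (size U)%:R; have N0 : 0 < N by rewrite ltr0n sU expn_gt0.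
pose q := 1 - N * 2 ^- n.
have q0 : 0 <= q.
  rewrite subr_ge0 ler_pdivrMr// mul1r -natrX ler_nat -(size_words_notin n U uU aU).
  by rewrite leq_addl.
have q1 : q < 1 by rewrite ltrBlDr ltrDl divr_gt0.
have it K : ball_cover (sdim l) (c / N + q ^+ K * D `^ sdim l) (Aset l).
  elim: K => [|K IH].
    rewrite mul1r; apply: ball_cover_le (_ : ball_cover _ (D `^ sdim l) _).
      by rewrite lerDr divr_ge0// ltW.
    apply: (@ball_cover_finite _ _ _ _ [:: 0] D) => //; last by rewrite mul1r.
    move=> x Ax; exists 0; rewrite ?inE// cdistC /cdist subr0.
    exact: Aset_bound.
  have -> : c / N + q ^+ K.+1 * D `^ sdim l =
     c * 2 ^- n + q * (c / N + q ^+ K * D `^ sdim l).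
    by rewrite exprS mulrDr mulrA addrA; congr (_ + _); rewrite /q; field; rewrite !gt_eqF.
  apply: Aset_cover_step => //.
  by rewrite addr_ge0// ?mulr_ge0 ?exprn_ge0 ?powR_ge0 ?invr_ge0// ltW.
have Ds : 0 < D `^ sdim l + 1 by rewrite ltr_wpDl// powR_ge0.
have [K hK] := geometric_small q (e / 2 / (D `^ sdim l + 1)) q0 q1
  ltac:(by rewrite !divr_gt0).
apply: ball_cover_le (it K); rewrite [leRHS]splitr lerD//; first by rewrite /N sU.
have := ltW (hK K (leqnn K)); rewrite ler_pdivlMr//; apply: le_trans.
by rewrite ler_wpM2l ?exprn_ge0// lerDl.
Qed.

End ZeroHausdorff.

(** * Vanishing of the Hausdorff measure *)

Section BadSet.
Context {R : realType}.
Local Notation C := (R * R)%type.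
Implicit Types (l z x : C) (s : seq R).

Lemma lt_invsqrt2 (x : R) : 0 <= x -> (x < 1 / Num.sqrt 2) = (x ^+ 2 < 1/2).
Proof.
move=> x0; have s0 : 0 < Num.sqrt (2 : R) by rewrite sqrtr_gt0.
rewrite -(@ltr_pXn2r _ 2 _ x)// ?nnegrE ?divr_ge0// ?ltW//.
by rewrite expr_div_n expr1n sqr_sqrtr.
Qed.

Lemma sqr_lt_half (x : R) : 0 <= x -> x ^+ 2 < 1/2 -> x < 71/100.
Proof.
move=> x0 h; rewrite ltNge; apply/negP => hx.
have : (71/100) ^+ 2 <= x ^+ 2 by rewrite lerXn2r ?nnegrE//; lra.
lra.
Qed.

Lemma Mset_coef l : Mset l -> exists2 a : nat -> R, [/\ a 0%N = 1,
    forall k, a k = 1 \/ a k = 0 \/ a k = -1 & forall k, `|a k| <= 1] &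
    psum a l N @[N --> \oo] --> (0 : C).
Proof.
move=> [_ [a [a0 [ha hz]]]]; exists a => //.
have ha' k : a k = 1 \/ a k = 0 \/ a k = -1 by case: k => [|k]; [left|apply: ha].
by split => // k; have [->|[->|->]] := ha' k; rewrite ?normrN ?normr0 ?normr1.
Qed.

(** The leading 1 must be cancelled by the remaining terms, whose sum is at most |l| / (1 - |l|). *)
Lemma Mset_norm_ge l : Mset l -> 1/2 <= cnorm l.
Proof.
move=> hM; have [l1 _] := hM; have [a [a0 _ ha] hz] := Mset_coef _ hM.
have := psum_tail a l 0 1 ha l1 hz.
rewrite /psum big_ord1 a0 /cdist sub0r cnormN cnormZ normr1 mul1r.
rewrite cnorm_cexp expr0 expr1 ler_pdivlMl ?subr_gt0// mulr1; lra.
Qed.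

(** Each of 1, 0, -1 is half the difference of two signs; the leading 1 makes the two words differ
    at once. *)
Lemma words_of_trinary s : head 0 s = 1 -> all (fun a => [|| a == 1, a == 0 | a == -1]) s ->
  exists u v : seq bool, [/\ size u = size s, size v = size s, u != v &
    forall z, pw u z - pw v z = cscale 2 (hev s z)].
Proof.
move=> hd al; exists [seq a != -1 | a <- s], [seq a != 1 | a <- s].
rewrite !size_map; split => //.
  case: s hd al => [|a s] /=; first by move=> /eqP; rewrite eq_sym oner_eq0.
  have n1 : (1 : R) == -1 = false by rewrite gt_eqF//; lra.
  by move=> -> _; rewrite eqseq_cons eqxx n1.
move=> z; elim: s al {hd} => [|a s IH] /=.
  by rewrite subrr => _; apply: cpair_eq => /=; ring.
move=> /andP[ha /IH h].
have -> : cscale 2 ((a, 0) + cmul z (hev s z)) =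
    cscale 2 (a, 0) + cmul z (cscale 2 (hev s z)) by apply: cpair_eq => /=; ring.
rewrite -h /pw /= opprD addrACA -cmulBr; congr (_ + _).
have n1 : (1 : R) == -1 = false by rewrite gt_eqF//; lra.
have n2 : (0 : R) == -1 = false by rewrite gt_eqF//; lra.
have n3 : (0 : R) == 1 = false by rewrite lt_eqF.
have n4 : (-1 : R) == 1 = false by rewrite lt_eqF//; lra.
by case/or3P: ha => /eqP ->; rewrite ?eqxx ?n1 ?n2 ?n3 ?n4 /=; apply: cpair_eq => /=; ring.
Qed.

Lemma bernoulli_sub (x : R) n : 0 <= x <= 1 -> 1 - n%:R * x <= (1 - x) ^+ n.
Proof.
move=> /andP[x0 x1]; elim: n => [|n IH]; first by rewrite mul0r subr0.
rewrite exprS; apply: (@le_trans _ _ ((1 - x) * (1 - n%:R * x))).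
  by rewrite -natr1; have := @mulr_ge0 R n%:R (x * x) (ler0n _ _) (mulr_ge0 x0 x0); lra.
by rewrite ler_wpM2l// subr_ge0.
Qed.

Lemma natmul_geometric_small (e : R) : 0 < e ->
  exists m, forall n, (m <= n)%N -> n%:R * (3/4) ^+ n < e.
Proof.
(* Since [27/32 = 9/8 * (3/4)], the growth of (9/8)^n, at least n/8 by Bernoulli, absorbs the factor
   n. *)
move=> e0; have h3 : (0 : R) <= 27/32 by lra.
have [m hm] := geometric_small (27/32) (e / 8) h3 ltac:(lra) ltac:(by rewrite divr_gt0).
exists m => n mn; have := hm n mn; rewrite ltr_pdivlMr// => h.
apply: le_lt_trans h; have -> : (27/32 : R) = 9/8 * (3/4) by field.
have b n' : 1 + n'%:R * (1/8) <= (9/8 : R) ^+ n'.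
  elim: n' => [|k IH]; first by rewrite mul0r addr0.
  rewrite exprS -natr1; have := ler0n R k; have := IH; nra.
have q0 : 0 <= (3/4 : R) ^+ n by rewrite exprn_ge0//; lra.
have := b n; rewrite [(9/8 * (3/4)) ^+ n]exprMn.
set X := (9/8 : R) ^+ n; set Y := (3/4 : R) ^+ n in q0 * => hX.
by rewrite mulrAC; apply: ler_wpM2r => //; lra.
Qed.

(** As [cnorm l >= 1/2], the ratio |z|/|l| is at least 1 - 2d with d the distance, and Bernoulli's
    inequality bounds its n-th power below by 1/2. *)
Lemma cnorm_pow_ge l z n : 1/2 <= cnorm l -> n%:R * cdist z l <= 1/4 -> (0 < n)%N ->
  cnorm l ^+ n <= 2 * cnorm z ^+ n.
Proof.
move=> l2 hn n0; have p : 0 < cnorm l by lra.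
set d := cdist z l in hn.
have d0 : 0 <= d by rewrite /d.
have d1 : d <= 1/4.
  by apply: le_trans hn; rewrite ler_peMl// ler1n.
have zl : cnorm l - d <= cnorm z by have := lerB_cnorm l z; rewrite -/(cdist l z) cdistC -/d; lra.
have h1 : cnorm l * (1 - 2 * d) <= cnorm z by nra.
have h2 : (cnorm l * (1 - 2 * d)) ^+ n <= cnorm z ^+ n.
  by rewrite lerXn2r ?nnegrE// mulr_ge0//; lra.
rewrite exprMn in h2.
have h3 := bernoulli_sub (2 * d) n ltac:(by apply/andP; split; lra).
have pn : 0 <= cnorm l ^+ n by rewrite exprn_ge0.
have h4 : 1/2 <= (1 - 2 * d) ^+ n by lra.
have := ler_wpM2l pn h4; lra.
Qed.

(** The sign [b] fixes a side of the real axis. Countably many choices of [e] and [eta] exhaust the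
    exceptional parameters off the axis. *)
Definition bad_set (e eta : R) b : set C := [set l | [/\ Mset l, cnorm l ^+ 2 < 1/2,
  eta <= sg b * l.2 & ~ close_words l e]].

(** The constant of [transversality]. *)
Definition kappa (eta : R) := eta ^+ 3 / 200.

Lemma kappa_gt0 eta : 0 < eta -> 0 < kappa eta.
Proof. by move=> h; rewrite /kappa; have := exprn_gt0 3 h; lra. Qed.

Lemma kappa_le1 eta : 0 <= eta <= 1 -> kappa eta <= 1.
Proof. by move=> /andP[h0 h1]; rewrite /kappa; have := exprn_ile1 3 h0 h1; lra. Qed.

(* One chord step from l to the approximate root l' suffices: the error of the secant
   method is of second order, so it is negligible against e |l|^n. *)
Lemma chord_step (s : seq R) l l2 (K k tau : R) :
  all (fun a => `|a| <= 1) s -> 0 < k -> cnorm l <= 71/100 ->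
  cnorm l2 <= 3/4 -> l2 != l -> cdist l2 l <= tau -> tau <= 1/100 ->
  cnorm (hev s l) <= K -> K / k <= tau ->
  k * cdist l2 l <= cdist (hev s l2) (hev s l) ->
  exists2 l', cdist l' l <= K / k & cnorm (hev s l') <= K / k * (128 * tau).
Proof.
move=> hs k0 hl hl2 ne t2 tau1 hK hKt hk.
have d0 : 0 < cdist l2 l by apply: cnorm_gt0; rewrite subr_eq0.
set D := dq s l2 l.
have hD : k <= cnorm D.
  by move: hk; rewrite {2}/cdist dqP cnormM mulrC ler_pM2l.
have Dn0 : D != 0.
  by apply/eqP => D0; move: hD; rewrite D0 cnorm0 leNgt k0.
pose l' := l - cmul (hev s l) (cinv D).
have K0 : 0 <= K by exact: le_trans (cnorm_ge0 _) hK.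
have dl' : cdist l' l <= K / k.
  rewrite /cdist /l' addrAC subrr sub0r cnormN cnormM cnormV// ler_pM// ?invr_ge0//.
  by rewrite lef_pV2 ?posrE// (lt_le_trans k0).
have l'n : cnorm l' <= 3/4.
  have := lerB_cnorm l' l; rewrite -/(cdist _ _) => h.
  have : cnorm l' - cnorm l <= 1/100.
    exact: le_trans h (le_trans dl' (le_trans hKt tau1)).
  by clear -hl; lra.
have hl34 : cnorm l <= 3/4 by apply: le_trans hl _; lra.
exists l' => //.
have -> : hev s l' = cmul (l' - l) (dq s l' l - D).
  have := dqP s l' l; have : cmul (l' - l) D = - hev s l.
    rewrite /l' addrAC subrr sub0r; transitivity (- cmul (hev s l) (cmul D (cinv D))).
      by apply: cpair_eq => /=; ring.
    by rewrite cmulV// cmulr1.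
  by rewrite cmulBr => -> <-; rewrite opprK subrK.
rewrite cnormM ler_pM//; apply: le_trans (dq_lip _ _ _ _ hs l'n hl2 hl34) _.
have : cdist l' l2 <= tau + tau.
  apply: le_trans (ler_cdistD l _ _) _; rewrite lerD//; first exact: le_trans hKt.
  by rewrite cdistC.
by clear; lra.
Qed.

(** A truncation at [n] of a series vanishing at [l] is at most [4 * cnorm l ^+ n] there.
    Transversality bounds a chord slope at [l] from below, and one chord step then gives a much
    better approximate zero nearby. *)
Lemma Mset_approximate_zero l (eta tau : R) n : Mset l -> cnorm l ^+ 2 < 1/2 ->
  0 < eta -> eta <= 1 -> eta <= `|l.2| -> 0 < tau -> tau <= 1/64/64 -> (0 < n)%N ->
  let k := kappa (eta / 2) in 4 * cnorm l ^+ n <= k * tau ->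
  exists s l', [/\ size (1 :: s) = n, all (fun a => [|| a == 1, a == 0 | a == -1]) (1 :: s),
    cdist l' l <= 4 * cnorm l ^+ n / k &
    cnorm (hev (1 :: s) l') <= 4 * cnorm l ^+ n / k * (128 * tau)].
Proof.
move=> hM lh eta0 eta1 im1 tau0 tau1 n_gt0 k hk.
have k0 : 0 < k by apply: kappa_gt0; rewrite divr_gt0.
have l71 : cnorm l < 71/100 by exact: sqr_lt_half.
have tau1' : tau <= 1/100 by clear -tau1; lra.
have tau11 : tau <= 1 by clear -tau1; lra.
have p0 : 0 < cnorm l by have := Mset_norm_ge l hM; clear; lra.
have l34 : cnorm l <= 3/4 by clear -l71; lra.
have lne1 : cnorm l < 1 by clear -l71; lra.
have [a [a0 ha ha1] hz] := Mset_coef _ hM.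
pose s := mkseq (fun i => a i.+1) n.-1.
have sE : mkseq a n = 1 :: s.
  by rewrite -(prednK n_gt0) -[(n.-1).+1]add1n mkseqD /= a0.
have hs' : all (fun x : R => `|x| <= 1) s by apply/allP => x /mapP[i _ ->].
have hs : all (fun x : R => `|x| <= 1) (1 :: s) by rewrite /= normr1 lexx.
have small : cnorm (hev (1 :: s) l) <= 4 * cnorm l ^+ n.
  rewrite -sE -psum_hev.
  have := psum_tail a l 0 n ha1 lne1 hz; rewrite /cdist sub0r cnormN => h.
  apply: le_trans h _; rewrite ler_wpM2r ?exprn_ge0//.
  by rewrite -[leRHS]invrK lef_pV2 ?posrE//; clear -l34; lra.
(* A second point for the chord, on the same side of the axis: contracting [l] radially keeps it in
   the disc. *)
pose l2 : C := cscale (1 - tau) l.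
have dl2 : cdist l2 l = tau * cnorm l.
  rewrite -[in RHS](gtr0_norm tau0) -cnormZ -[RHS]cnormN; congr cnorm.
  by apply: cpair_eq => /=; ring.
have nl2 : cnorm l2 <= cnorm l.
  by rewrite cnormZ ger0_norm ?subr_ge0// ler_piMl// lerBlDr lerDl ltW.
have tauk : 4 * cnorm l ^+ n / k <= tau by rewrite ler_pdivrMr// mulrC [tau * k]mulrC -[leLHS]mulrC.
have smallk : 4 * cnorm l ^+ n <= k by apply: le_trans hk _; rewrite ler_piMr// ltW.
have tr : k * cdist l2 l <= cdist (hev (1 :: s) l2) (hev (1 :: s) l).
  (* Halving [eta] leaves room for the factor [1 - tau] in the imaginary part of [l2]. *)
  have e20 : 0 < eta / 2 by rewrite divr_gt0.
  have e21 : eta / 2 <= 1 by clear -eta0 eta1; lra.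
  have e2 : eta / 2 <= `|l.2| by move: im1; clear -eta0; lra.
  apply: transversality => //; first exact: ltW.
  - by apply: le_trans (ltW lh); rewrite lerXn2r ?nnegrE.
  - rewrite /= normrM ger0_norm ?subr_ge0//.
    by move: im1; clear -tau1 eta0; set x := `|_|; nra.
  - have -> : l2.2 + l.2 = (2 - tau) * l.2 by rewrite /=; ring.
    rewrite normrM ger0_norm; last by clear -tau1; lra.
    by move: im1; clear -tau1 eta0; set x := `|_|; nra.
  - exact: le_trans small smallk.
have n2 : cnorm l2 <= 3/4 by exact: le_trans l34.
have ne : l2 != l.
  by apply/eqP => E; move: dl2; rewrite E cdistxx => /esym/eqP; rewrite mulf_eq0 !gt_eqF.
have dl2' : cdist l2 l <= tau by rewrite dl2 ler_piMr// ltW.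
have [l' hl' hf'] := chord_step _ _ _ _ _ _ hs k0 (ltW l71) n2 ne dl2' tau1' small tauk tr.
exists s, l'; split => //; first by rewrite -sE size_mkseq.
rewrite -sE; apply/allP => x /mapP[i _ ->].
by have [->|[->|->]] := ha i; rewrite eqxx ?orbT.
Qed.

(** The Lipschitz constant 16 gives |f(z)| at most (e/8 + 16 e/128) |l|^n, that is e/4 times |l|^n.
    The word difference is 2f and |l|^n is at most 2|z|^n, which uses up the factor 4. *)
Lemma close_words_near (s : seq R) l l' z (e : R) :
  0 < e -> 1/2 <= cnorm l -> cnorm l' <= 3/4 -> cnorm z <= 3/4 ->
  all (fun a => [|| a == 1, a == 0 | a == -1]) (1 :: s) ->
  cnorm (hev (1 :: s) l') <= e / 8 * cnorm l ^+ size (1 :: s) ->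
  cdist l' z <= e / 128 * cnorm l ^+ size (1 :: s) ->
  (size (1 :: s))%:R * cdist z l <= 1/4 -> close_words z e.
Proof.
move=> e0 l2 l'34 z34 tri hf hzl hn.
have hs : all (fun a : R => `|a| <= 1) (1 :: s).
  apply: sub_all tri => x /or3P[] /eqP ->; by rewrite ?normrN ?normr1 ?normr0 ?ler01.
have fz : cnorm (hev (1 :: s) z) <= e / 4 * cnorm l ^+ size (1 :: s).
  have := lerB_cnorm (hev (1 :: s) z) (hev (1 :: s) l').
  have := hev_lip _ _ _ hs z34 l'34; rewrite cdistC [cdist z l']cdistC.
  rewrite -/(cdist _ _) [cdist (hev _ z) _]cdistC; move: hf hzl; clear; lra.
have lz : cnorm l ^+ size (1 :: s) <= 2 * cnorm z ^+ size (1 :: s) by exact: cnorm_pow_ge.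
have [u [v [su sv uv huv]]] := words_of_trinary (1 :: s) erefl tri.
exists u, v; split => //; first by rewrite su sv.
rewrite /cdist huv cnormZ ger0_norm// su.
by have := ler_wpM2l (ltW e0) lz; move: fz; clear; lra.
Qed.

(** Near a bad parameter there is an approximate zero [l'] of a truncation, and around [l'] a disc
    of comparable size on which that truncation yields close words: a hole in the bad set. *)
Lemma bad_set_near (e eta : R) b : 0 < e -> e <= 1 -> 0 < eta -> eta <= 1 ->
  let k := kappa (eta / 2) in
  exists n0, forall l n, bad_set e eta b l -> (n0 <= n)%N ->
    exists2 l', cdist l' l <= 4 / k * cnorm l ^+ n &
      forall z, cdist l' z <= e / 128 * cnorm l ^+ n -> ~ bad_set e eta b z.
Proof.
move=> e0 e1 eta0 eta1 k.
have k0 : 0 < k by apply: kappa_gt0; rewrite divr_gt0.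
have k1 : k <= 1 by apply: kappa_le1; clear -eta0 eta1; apply/andP; split; lra.
(* This makes [4 / k * (128 * tau)] equal to [e / 8], the smallness asked by [close_words_near]. *)
pose tau := e * k / 64 / 64.
have ek0 : 0 < e * k by rewrite mulr_gt0.
have ek1 : e * k <= 1 by rewrite mulr_ile1// ltW.
have tau0 : 0 < tau by rewrite /tau !divr_gt0.
have tau1 : tau <= 1/64/64 by rewrite /tau; clear -ek1; lra.
have h34 : (0 : R) <= 3/4 by lra.
have [n1 hn1] := geometric_small (3/4) (k * tau / 4) h34 ltac:(lra)
  ltac:(by rewrite divr_gt0// mulr_gt0).
(* The points [z] in question are within [5 / k * cnorm l ^+ n] of [l], so [k / 20] ensures that n
   times this distance is at most 1/4. *)
have [n2 hn2] := natmul_geometric_small (k / 20) ltac:(by rewrite divr_gt0).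
exists (maxn (maxn n1 n2) 1) => l n [hM lh him _]; rewrite !geq_max => /andP[/andP[nn1 nn2] n_gt0].
have l2 := Mset_norm_ge l hM.
have l71 : cnorm l < 71/100 by exact: sqr_lt_half.
have lq : cnorm l ^+ n <= (3/4) ^+ n.
  by rewrite lerXn2r ?nnegrE//; clear -l71; lra.
have pn : 0 <= cnorm l ^+ n by rewrite exprn_ge0.
have hk : 4 * cnorm l ^+ n <= k * tau.
  by rewrite mulrC -ler_pdivlMr// ltW// (le_lt_trans lq (hn1 n nn1)).
have im1 : eta <= `|l.2|.
  by apply: le_trans him (le_trans (ler_norm _) _); rewrite normrM ler_piMl// sg_norm.
have [s [l' [sn tri hl' hf']]] : exists s l', [/\ size (1 :: s) = n,
    all (fun a => [|| a == 1, a == 0 | a == -1]) (1 :: s),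
    cdist l' l <= 4 * cnorm l ^+ n / k &
    cnorm (hev (1 :: s) l') <= 4 * cnorm l ^+ n / k * (128 * tau)].
  exact: Mset_approximate_zero.
have dl : cdist l' l <= 4 / k * cnorm l ^+ n by rewrite mulrAC.
exists l' => // z hzl [_ zh _ ncl]; apply: ncl.
have z34 : cnorm z <= 3/4.
  by have := sqr_lt_half _ (cnorm_ge0 z) zh; clear; lra.
have qk : 4 * cnorm l ^+ n / k <= tau by rewrite ler_pdivrMr// [tau * k]mulrC.
have l'34 : cnorm l' <= 3/4.
  have := lerB_cnorm l' l; rewrite -/(cdist _ _).
  by move: (le_trans hl' qk) tau1 l71; clear; lra.
apply: (close_words_near s l l') => //; rewrite sn//.
- apply: le_trans hf' _; rewrite /tau.
  rewrite (_ : _ / k * _ = e / 8 * cnorm l ^+ n)//.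
  by field; rewrite gt_eqF.
- have dz : cdist z l <= 5 / k * cnorm l ^+ n.
    apply: le_trans (ler_cdistD l' _ _) _; rewrite cdistC.
    apply: le_trans (lerD hzl dl) _; rewrite -mulrDl ler_wpM2r//.
    have h : e / 128 <= 1 / k.
      by rewrite ler_pdivlMr// mulrAC; move: ek0 ek1; clear; lra.
    by move: h; clear; lra.
  apply: (@le_trans _ _ (5 / k * (n%:R * (3/4) ^+ n))).
    rewrite mulrCA ler_wpM2l//; apply: le_trans dz _.
    by rewrite ler_wpM2l// divr_ge0// ltW.
  apply: (@le_trans _ _ (5 / k * (k / 20))).
    by apply: ler_wpM2l; [rewrite divr_ge0// ltW|rewrite ltW// hn2].
  by rewrite le_eqVlt; apply/orP; left; apply/eqP; field; rewrite gt_eqF.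
Qed.

Lemma bad_set_null (e eta : R) b : 0 < e -> e <= 1 -> 0 < eta -> eta <= 1 ->
  null_set 2 (bad_set e eta b).
Proof.
move=> e0 e1 eta0 eta1.
have [n0 hn0] := bad_set_near e eta b e0 e1 eta0 eta1.
set k := kappa (eta / 2) in hn0.
have k0 : 0 < k by apply: kappa_gt0; lra.
(* The porosity constant: the hole has radius e/128 times |l|^n, and |l|^n will be at least
   [k / 8 * rho]. *)
have c0 : 0 < e / 128 * (k / 8) by rewrite mulr_gt0//; lra.
have k4 : 0 < 4 / k by rewrite divr_gt0.
(* As [cnorm l >= 1/2], scales below this bound only involve levels beyond [n0]. *)
have r00 : 0 < 4 / k * (1/2) ^+ n0.+1 by rewrite mulr_gt0// exprn_gt0//; lra.
apply: (porous_null _ _ _ c0 r00); last first.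
  by move=> z [_ zh _ _]; have := sqr_lt_half _ (cnorm_ge0 z) zh; lra.
move=> l rho lB /andP[rho0 rhor]; have [hM lh _ _] := lB.
have l2 := Mset_norm_ge l hM; have l71 := sqr_lt_half _ (cnorm_ge0 l) lh.
have p0 : 0 < cnorm l by lra.
have ex : exists n, 4 / k * cnorm l ^+ n <= rho.
  have [m hm] := geometric_small (cnorm l) (rho / (4 / k)) (cnorm_ge0 l) ltac:(lra)
    ltac:(by rewrite divr_gt0).
  by exists m; have := ltW (hm m (leqnn m)); rewrite ler_pdivlMr// mulrC.
(* By minimality and [cnorm l >= 1/2] the scale at level [n] is comparable to [rho] from both
   sides. *)
pose n := ex_minn ex.
have [hn hmin] : 4 / k * cnorm l ^+ n <= rho /\
    forall m, 4 / k * cnorm l ^+ m <= rho -> (n <= m)%N by rewrite /n; case: ex_minnP.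
have nn0 : (n0 < n)%N.
  rewrite ltnNge; apply/negP => nn.
  have : 4 / k * (1/2) ^+ n0 <= 4 / k * (1/2) ^+ n0.+1.
    apply: le_trans (le_trans hn rhor); rewrite ler_wpM2l ?(ltW k4)//.
    apply: (@le_trans _ _ (cnorm l ^+ n0)); first by rewrite lerXn2r ?nnegrE//; lra.
    by rewrite ler_wiXn2l//; lra.
  rewrite ler_pM2l// exprS.
  have : 0 < (1/2 : R) ^+ n0 by rewrite exprn_gt0//; lra.
  lra.
have [l' h1 h2] := hn0 l n lB (ltnW nn0).
exists l'; first by rewrite cdistC; exact: le_trans h1 hn.
move=> z hz; apply: h2; apply: le_trans hz _.
rewrite -mulrA; apply: ler_wpM2l; first lra.
have np : (0 < n)%N by exact: leq_ltn_trans nn0.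
have hpred : rho < 4 / k * cnorm l ^+ n.-1.
  by rewrite ltNge; apply/negP => /hmin; rewrite -(prednK np) ltnn.
have : rho * k <= 8 * cnorm l ^+ n; last by clear; lra.
rewrite -(prednK np) exprS.
have X0 : 0 <= cnorm l ^+ n.-1 by rewrite exprn_ge0.
have : rho * k <= 4 * cnorm l ^+ n.-1.
  by have := ltW hpred; rewrite -mulrA [k^-1 * _]mulrC mulrA ler_pdivlMr.
by set X := cnorm l ^+ n.-1 in X0 *; move: l2 X0; clear; nra.
Qed.

(** Transversality gives nothing on the real axis, but a segment is null in every dimension above 1:
    2^m intervals of length 2/2^m have total weight decaying like q^m. *)
Lemma real_axis_null (t : R) : 1 < t -> null_set t ([set z | z.2 = 0 /\ cnorm z <= 1] : set C).
Proof.
move=> t1 e e0; have t0 : 0 < t by lra.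
pose q : R := 2 * (1/2) `^ t.
have q0 : 0 <= q by rewrite mulr_ge0// powR_ge0.
have q1 : q < 1.
  have : (1/2 : R) `^ t < 1/2; last by rewrite /q; lra.
  have h : ln (1/2 : R) < 0 by apply: ln_lt0; apply/andP; split; lra.
  rewrite -[ltRHS]powRr1; last lra.
  by rewrite /powR gt_eqF; [rewrite ltr_expR ltr_nM2r|lra].
have [m hm] := geometric_small q (e / 2 `^ t) q0 q1 ltac:(by rewrite divr_gt0// powR_gt0).
have m0 : (0 < 2 ^ m)%N by rewrite expn_gt0.
have r0 : 0 <= 2 / (2 ^ m)%:R :> R by rewrite divr_ge0.
apply: (@ball_cover_finite _ t _ _
   [seq ((-1 + i%:R * (2 / (2 ^ m)%:R), 0) : C) | i <- iota 0 (2 ^ m)] (2 / (2 ^ m)%:R)) => //.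
  move=> z [z2 z1].
  have z1' : -1 <= z.1 <= -1 + 2.
    have := le_trans (cnorm_re z) z1; rewrite ler_norml => /andP[? ?]; apply/andP; split; lra.
  have [i im /andP[h1 h2]] := grid_cell (-1) z.1 2 (2 ^ m) m0 ltac:(lra) z1'.
  exists ((-1 + i%:R * (2 / (2 ^ m)%:R), 0) : C).
    by apply: map_f; rewrite mem_iota.
  rewrite /cdist; have -> : ((-1 + i%:R * (2 / (2 ^ m)%:R), 0) : C) - z =
      (-1 + i%:R * (2 / (2 ^ m)%:R) - z.1, 0) by apply: cpair_eq => //=; rewrite z2 subr0.
  by rewrite cnorm_real ler_norml; apply/andP; split; lra.
rewrite size_map size_iota.
have := ltW (hm m (leqnn m)); rewrite ler_pdivlMr ?powR_gt0//; apply: le_trans.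
rewrite /q exprMn natrX powRM ?invr_ge0// ?exprn_ge0// -exprVn mulrAC -mulrA.
have -> : (2^-1 ^+ m : R) `^ t = (1/2) `^ t ^+ m.
  by rewrite div1r -powR_mulrn ?powR_ge0// -!powRrM mulrC powRrM powR_mulrn// invr_ge0.
by rewrite mulrCA mulrA.
Qed.

Theorem hausdorff_zero_ae : (@area R).-negligible
  [set l | (@Mset R l /\ cnorm l < 1 / Num.sqrt 2) /\
           ~ (hausdorff_measure (sdim l) (Aset l) = 0%E)].
Proof.
apply: null_set_negligible.
apply: (@null_setS _ _ _ ([set z | z.2 = 0 /\ cnorm z <= 1] `|`
  \bigcup_k \bigcup_m (bad_set k.+1%:R^-1 m.+1%:R^-1 true `|` bad_set k.+1%:R^-1 m.+1%:R^-1 false))).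
  move=> l [[hM]]; rewrite lt_invsqrt2// => lh nh.
  have l71 := sqr_lt_half _ (cnorm_ge0 l) lh.
  have l2 := Mset_norm_ge l hM.
  have l1 : cnorm l < 1 by lra.
  have l0 : l != 0 by apply/eqP => E; move: l2; rewrite E cnorm0; lra.
  have [im0|im0] := eqVneq l.2 0; [by left; split => //; lra|right].
  have [e e0 hcl] : exists2 e : R, 0 < e & ~ close_words l e.
    apply: contrapT => H; apply: nh; apply: null_set_hausdorff; first exact: sdim_gt0.
    apply: close_words_null_set => // e e0; apply: contrapT => ncl.
    by apply: H; exists e.
  pose k := Num.truncn e^-1; exists k => //.
  have hk : k.+1%:R^-1 <= e.
    by rewrite invf_ple ?posrE// ltW// truncnS_gt.
  pose m := Num.truncn `|l.2|^-1; exists m => //.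
  have hm : m.+1%:R^-1 <= `|l.2|.
    by rewrite invf_ple ?posrE ?normr_gt0// ltW// truncnS_gt.
  have ncl : ~ close_words l k.+1%:R^-1.
    move=> [u [v [suv uv h]]]; apply: hcl; exists u, v; split => //.
    by apply: le_trans h _; rewrite ler_wpM2r ?exprn_ge0.
  have [p|n] := ltP 0 l.2; [left|right]; split => //=.
    by rewrite mul1r -(gtr0_norm p).
  by rewrite mulN1r -(ler0_norm n).
apply: null_setU; first by apply: real_axis_null; lra.
apply: null_set_bigcup => k; apply: null_set_bigcup => m.
by apply: null_setU; apply: bad_set_null; rewrite ?invr_gt0 ?invf_le1 ?ltr0n ?ler1n.
Qed.

End BadSet.

(** * Upper bounds for the packing measure *)

Section Kraft.
Context {R : realType}.

Lemma count_cylinder N w : (size w <= N)%N ->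
  count (fun t => take (size w) t == w) (words N) = (2 ^ (N - size w))%N.
Proof.
move=> wN; rewrite -(size_words (N - size w)) -(size_map (cat w)) -size_filter.
apply: perm_size; apply: uniq_perm.
- by rewrite filter_uniq// uniq_words.
- rewrite map_inj_uniq ?uniq_words// => x y /eqP.
  by rewrite eqseq_cat// eqxx => /eqP.
- move=> t; rewrite mem_filter mem_words; apply/andP/mapP => [[/eqP tw /eqP tN]|[v]].
    exists (drop (size w) t); last by rewrite -{1}tw cat_take_drop.
    by rewrite mem_words size_drop tN.
  by rewrite mem_words => /eqP sv ->; rewrite take_size_cat// eqxx size_cat sv subnKC.
Qed.

Lemma count_pairwise_le1 (I : eqType) (P : pred I) (xs : seq I) : uniq xs ->
  {in xs &, forall i j, P i -> P j -> i = j} -> (count P xs <= 1)%N.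
Proof.
elim: xs => //= x xs IH /andP[nx uxs] h.
have h' : {in xs &, forall i j, P i -> P j -> i = j}.
  by move=> i j ix jx; apply: h; rewrite inE ?ix ?jx orbT.
case Px : (P x); last by rewrite add0n IH.
rewrite (_ : count P xs = 0%N)//; apply/eqP; rewrite -leqn0 leqNgt -has_count.
apply/hasPn => y yx; apply/negP => Py; move: nx.
by rewrite (h x y) ?mem_head ?inE ?yx ?orbT.
Qed.

(** Count the words of a large common length: each extends at most one [w i], and if it does then
    its prefix of length [m] lies in [W]. *)
Lemma kraft (I : eqType) (xs : seq I) (w : I -> seq bool) m (W : seq (seq bool)) :
  uniq xs -> all (fun u => size u == m) W ->
  {in xs, forall i, (m <= size (w i))%N /\ take m (w i) \in W} ->
  {in xs &, forall i j, forall t, take (size (w i)) t = w i ->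
     take (size (w j)) t = w j -> i = j} ->
  \sum_(i <- xs) 2 ^- size (w i) <= (size W)%:R * 2 ^- m :> R.
Proof.
move=> uxs aW hw hd; pose N := maxn m (\max_(i <- xs) size (w i)).
have wN i : i \in xs -> (size (w i) <= N)%N.
  by move=> ix; rewrite leq_max (leq_bigmax_seq _ ix)// orbT.
have mN : (m <= N)%N by rewrite leq_maxl.
have key : (\sum_(i <- xs) 2 ^ (N - size (w i)) <= size W * 2 ^ (N - m))%N.
  apply: (@leq_trans (\sum_(t <- words N) count (fun i => take (size (w i)) t == w i) xs)).
    rewrite (eq_bigr (fun t => \sum_(i <- xs | take (size (w i)) t == w i) 1)%N); last first.
      by move=> t _; rewrite sum1_count.
    rewrite (exchange_big_dep xpredT)//= [in leqLHS]big_seq [in leqRHS]big_seq.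
    apply: leq_sum => i ix; rewrite -count_cylinder ?wN//.
    by rewrite -sum1_count.
  apply: (@leq_trans (\sum_(t <- words N) count (fun u => take m t == u) W)).
    rewrite big_seq [in leqRHS]big_seq; apply: leq_sum => t _.
    have [/hasP[i ix /eqP ti]|] := boolP (has (fun i => take (size (w i)) t == w i) xs).
      apply: (@leq_trans 1).
        apply: count_pairwise_le1 => // j k jx kx /eqP tj /eqP tk.
        exact: (hd j k jx kx t).
      rewrite -has_count; apply/hasP; exists (take m (w i)); first by have [] := hw i ix.
      by have [mw _] := hw i ix; rewrite -ti take_takel.
    by rewrite has_count -leqNgt leqn0 => /eqP ->.
  rewrite (eq_bigr (fun t => \sum_(u <- W | take m t == u) 1)%N); last first.
    by move=> t _; rewrite sum1_count.
  rewrite (exchange_big_dep xpredT)//= big_seq.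
  rewrite (eq_bigr (fun=> 2 ^ (N - m))%N).
    by rewrite -big_seq big_const_seq count_predT iter_addn addn0 mulnC.
  move=> u uW; rewrite sum1_count; have su := eqP (allP aW _ uW).
  by rewrite -{1 2}su count_cylinder ?su.
have p2 n : 0 < (2 : R) ^+ n by rewrite exprn_gt0.
have cv n : (n <= N)%N -> (2 : R) ^- n = (2 ^ (N - n))%:R * 2 ^- N.
  move=> nN; have -> : (2 : R) ^+ N = 2 ^+ (N - n) * 2 ^+ n by rewrite -exprD subnK.
  by rewrite natrX invfM mulrA divff ?mul1r// lt0r_neq0.
rewrite big_seq (eq_bigr (fun i => (2 ^ (N - size (w i)))%:R * 2 ^- N)); last first.
  by move=> i ix; rewrite cv// wN.
rewrite -big_seq -mulr_suml -natr_sum (cv m mN) mulrA -natrM.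
by rewrite ler_wpM2r ?invr_ge0 ?(ltW (p2 _))// ler_nat.
Qed.

End Kraft.

(** * Packing measure: countable subadditivity, finiteness, similarities *)

Section PackingUpper.
Context {R : realType}.
Local Notation C := (R * R)%type.
Implicit Types (l z x : C) (E F : set C) (s d K : R).

Lemma packing_delta_ge0 s d E : (0 <= packing_delta s d E)%E.
Proof.
apply: ereal_sup_ubound; exists set0, (fun=> 0), (fun=> 0); split => //; split => //.
by rewrite esum_set0.
Qed.

Lemma packing_premeasure_ge0 s E : (0 <= packing_premeasure s E)%E.
Proof. by apply: le_ereal_inf_tmp => _ [d _ <-]; exact: packing_delta_ge0. Qed.

Lemma packing_measure_ge0 s E : (0 <= packing_measure s E)%E.
Proof.
apply: le_ereal_inf_tmp => _ [F [_ ->]]; apply: nneseries_ge0 => *.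
exact: packing_premeasure_ge0.
Qed.

Lemma packing_premeasure0 s : packing_premeasure s (set0 : set C) = 0%E.
Proof.
apply/eqP; rewrite eq_le packing_premeasure_ge0 andbT.
apply: (@le_trans _ _ (packing_delta s 1 (set0 : set C))).
  by apply: ereal_inf_lbound; exists 1 => //=.
apply: ge_ereal_sup => _ [J [x [r [h [_ ->]]]]].
by rewrite esum1// => i /h[].
Qed.

Lemma packing_measure_le s E (F : nat -> set C) : E `<=` \bigcup_i F i ->
  (packing_measure s E <= \sum_(i <oo) packing_premeasure s (F i))%E.
Proof. by move=> EF; apply: ereal_inf_lbound; exists F. Qed.

Lemma packing_measure_le_premeasure s E : (packing_measure s E <= packing_premeasure s E)%E.
Proof.
apply: le_trans (packing_measure_le s E (fun i => if i is 0 then E else set0) _) _.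
  by move=> x Ex; exists 0%N.
rewrite (nneseries_split 0 1); last by move=> i _; exact: packing_premeasure_ge0.
rewrite [X in (_ + X)%E]eseries0 ?adde0.
  by rewrite add0n big_nat1.
by move=> [|i] // _ _; rewrite packing_premeasure0.
Qed.

Lemma packing_measureS s E F : E `<=` F -> (packing_measure s E <= packing_measure s F)%E.
Proof.
move=> EF; apply: le_ereal_inf => v [G [FG ->]]; exists G; split => //.
exact: subset_trans FG.
Qed.

Lemma packing_measure_bigcup s (E : nat -> set C) :
  (packing_measure s (\bigcup_k E k) <= \sum_(k <oo) packing_measure s (E k))%E.
Proof.
have [fin|] := pselect (forall k, packing_measure s (E k) \is a fin_num); last first.
  move=> /existsNP[k hk]; apply: le_trans (leey _) _.
  have -> : (+oo = packing_measure s (E k))%E.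
    move: hk (packing_measure_ge0 s (E k)); rewrite fin_numE.
    by case: (packing_measure s (E k)) => [r| |]; rewrite ?eqxx // => [[]|].
  apply: (nneseries_term_le (fun k => packing_measure s (E k))) => i.
  exact: packing_measure_ge0.
apply/lee_addgt0Pr => e e0.
have /choice[F hF] : forall k, exists F : nat -> set C, E k `<=` \bigcup_i F i /\
    (\sum_(i <oo) packing_premeasure s (F i) <=
      packing_measure s (E k) + (e / (2 ^ k.+1)%:R)%:E)%E.
  move=> k; have e'0 : 0 < e / (2 ^ k.+1)%:R by rewrite divr_gt0// ltr0n expn_gt0.
  have [_ [F [EF ->]] lt] := lb_ereal_inf_adherent e'0 (fin k).
  by exists F; split => //; exact: ltW.
have [g [gs gE]] := pair_enumeration (R := R).
apply: le_trans (packing_measure_le s _ (fun k => F (g k).1 (g k).2) _) _.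
  move=> x [k _ /(hF k).1[i _ Fx]]; have [j gj] := gs (k, i).
  by exists j => //; rewrite gj.
rewrite (gE (fun k i => packing_premeasure s (F k i))); last first.
  by move=> *; exact: packing_premeasure_ge0.
apply: (@le_trans _ _ (\sum_(k <oo) (packing_measure s (E k) + (e / (2 ^ k.+1)%:R)%:E))%E).
  apply: lee_nneseries => k _; last by have [] := hF k.
  by move=> _; apply: nneseries_ge0 => *; exact: packing_premeasure_ge0.
by apply: (epsilon_trick xpredT) => [k|]; [exact: packing_measure_ge0|exact: ltW].
Qed.

Lemma packing_null_bigcup s (E : nat -> set C) :
  (forall k, packing_measure s (E k) = 0%E) -> packing_measure s (\bigcup_k E k) = 0%E.
Proof.
move=> h; apply/eqP; rewrite eq_le packing_measure_ge0 andbT.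
apply: le_trans (packing_measure_bigcup s E) _.
by rewrite eseries0// => k _ _; exact: h.
Qed.

(** Every small radius has a level [n >= m] at which a cylinder fits into a ball centred at any of
    its points, while the weight of the ball is at most [K] times that of the cylinder. *)
Definition good_scale l K m d := forall r : R, 0 < r <= d ->
  exists n, [/\ (m <= n)%N, 2 * (1 - cnorm l)^-1 * cnorm l ^+ n <= r &
               (2 * r) `^ sdim l <= K * 2 ^- n].

(** For [l = 0] the dimension is 0, every ball weighs 1, and cylinders of level 1 are already
    points. *)
Lemma good_scale0 : good_scale 0 2 0 1.
Proof.
move=> r /andP[r0 _]; exists 1%N; split => //.
  by rewrite cnorm0 mulr0 ltW.
by rewrite /sdim eqxx powRr0 expr1 divff.
Qed.

(** The first level whose cylinders fit is taken. [K] does not depend on [m], which later allows one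
    constant for cylinders of all levels. *)
Lemma good_scale_exists l : l != 0 -> cnorm l < 1 ->
  exists2 K, 0 < K & forall m, exists2 d, 0 < d & good_scale l K m d.
Proof.
move=> l0 l1; have p0 := cnorm_gt0 _ l0; set D := (1 - cnorm l)^-1.
have D0 : 0 < D by rewrite invr_gt0 subr_gt0.
exists ((4 * D / cnorm l) `^ sdim l); first by rewrite powR_gt0// divr_gt0// mulr_gt0.
move=> m; exists (D * cnorm l ^+ m); first by rewrite mulr_gt0// exprn_gt0.
move=> r /andP[r0 rm].
have ex : exists n, 2 * D * cnorm l ^+ n <= r.
  have [n hn] := geometric_small (cnorm l) (r / (2 * D)) (cnorm_ge0 l) l1
    ltac:(by rewrite divr_gt0// mulr_gt0).
  by exists n; have := ltW (hn n (leqnn n)); rewrite ler_pdivlMr ?mulr_gt0// mulrC.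
pose n := ex_minn ex.
have [hn hmin] : 2 * D * cnorm l ^+ n <= r /\
    forall k, 2 * D * cnorm l ^+ k <= r -> (n <= k)%N by rewrite /n; case: ex_minnP.
(* Radii below [D * cnorm l ^+ m] are too small for cylinders of level [m] under the bound
   [2 * D * cnorm l ^+ m]. *)
have mn : (m < n)%N.
  rewrite ltnNge; apply/negP => nm; have := le_trans hn rm.
  rewrite leNgt => /negP; apply; apply: (@le_lt_trans _ _ (D * cnorm l ^+ n)).
    by rewrite ler_pM2l// ler_wiXn2l// ltW.
  by rewrite -mulrA ltr_pMl// ?ltr1n// mulr_gt0// exprn_gt0.
exists n; split => //; first exact: ltnW.
have np : (0 < n)%N by exact: leq_ltn_trans mn.
have hpred : r < 2 * D * cnorm l ^+ n.-1.
  by rewrite ltNge; apply/negP => /hmin; rewrite -(prednK np) ltnn.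
rewrite -(powR_sdim l n l0 l1) -powRM ?exprn_ge0//; last first.
  by rewrite divr_ge0// mulr_ge0// ltW.
apply: ge0_ler_powR; rewrite ?nnegrE ?sdim_ge0//.
- by rewrite mulr_ge0// ltW.
- by rewrite mulr_ge0 ?exprn_ge0// divr_ge0// mulr_ge0// ltW.
have -> : 4 * D / cnorm l * cnorm l ^+ n = 2 * (2 * D * cnorm l ^+ n.-1).
  by rewrite -{1}(prednK np) exprS; field; rewrite gt_eqF.
by rewrite ler_pM2l// ltW.
Qed.

Lemma code_point_near l om om' n : cnorm l < 1 -> mkseq om n = mkseq om' n ->
  cdist (code_point l om) (code_point l om') <= 2 * (1 - cnorm l)^-1 * cnorm l ^+ n.
Proof.
move=> l1 e; apply: le_trans (ler_cdistD (pw (mkseq om n) l) _ _) _.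
rewrite -mulrA mulr_natl mulr2n; apply: lerD; first exact: code_point_tail.
by rewrite e cdistC; exact: code_point_tail.
Qed.

Definition word_ext (t : seq bool) : nat -> bool := nth false t.

Lemma mkseq_word_ext t n : (n <= size t)%N -> mkseq (word_ext t) n = take n t.
Proof.
move=> nt; apply: (@eq_from_nth _ false); first by rewrite size_mkseq size_takel.
by move=> i; rewrite size_mkseq => iN; rewrite nth_mkseq// nth_take.
Qed.

(* Disjoint balls centred on the attractor contain the pieces of pairwise incomparable
   words, so Kraft's inequality bounds the total packing weight. *)
Lemma packing_premeasure_cylinders l K m d (W : seq (seq bool)) F :
  cnorm l < 1 -> 0 <= K -> 0 < d -> good_scale l K m d ->
  all (fun u => size u == m) W ->
  (forall z, F z -> exists2 om, code_point l om = z & mkseq om m \in W) ->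
  (packing_premeasure (sdim l) F <= (K * ((size W)%:R * 2 ^- m))%:E)%E.
Proof.
move=> l1 K0 d0 gs aW hF.
apply: (@le_trans _ _ (packing_delta (sdim l) d F)).
  by apply: ereal_inf_lbound; exists d.
apply: ge_ereal_sup => _ [J [x [r [hx [hdis ->]]]]].
apply: ge_ereal_sup => _ [X [finX XJ] <-].
rewrite fsbig_finite// sumEFin lee_fin.
pose xs : seq nat := finmap.enum_fset (fset_set X); rewrite -/xs.
have xsJ (i : nat) : i \in xs -> J i.
  by move=> ix; apply: XJ; rewrite -(fset_setK finX).
have /choice[f hf] : forall i, exists p : (nat -> bool) * nat, J i ->
    [/\ code_point l p.1 = x i, mkseq p.1 m \in W, (m <= p.2)%N,
        2 * (1 - cnorm l)^-1 * cnorm l ^+ p.2 <= r i &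
        (2 * r i) `^ sdim l <= K * 2 ^- p.2].
  move=> i; have [Ji|nJ] := pselect (J i); last by exists (fun=> true, 0%N).
  have [/hF[om omx omW] /gs[n [mn nr rn]]] := hx i Ji.
  by exists (om, n).
apply: (@le_trans _ _ (\sum_(i <- xs) K * 2 ^- size (mkseq (f i).1 (f i).2))).
  rewrite big_seq [leRHS]big_seq; apply: ler_sum => i /xsJ /hf[_ _ _ _].
  by rewrite size_mkseq.
rewrite -mulr_sumr ler_wpM2l//; apply: (@kraft R nat xs (fun i => mkseq (f i).1 (f i).2) m W) => //.
- exact: finmap.fset_uniq.
- move=> i /xsJ /hf[_ omW mn _ _]; rewrite size_mkseq; split => //.
  by rewrite -(subnKC mn) mkseqD take_size_cat// size_mkseq.
move=> i j /xsJ Ji /xsJ Jj t; rewrite !size_mkseq => ti tj.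
apply: contrapT => ij; have := hdis i j Ji Jj ij.
have [cpi _ _ ri _] := hf i Ji; have [cpj _ _ rj _] := hf j Jj.
have st k : take k t = mkseq (f i).1 k \/ take k t = mkseq (f j).1 k -> (k <= size t)%N.
  move=> h; have : size (take k t) = k by case: h => ->; rewrite size_mkseq.
  by rewrite size_take_min => /minn_idPl.
have near (k : nat) : J k -> take (f k).2 t = mkseq (f k).1 (f k).2 -> ((f k).2 <= size t)%N ->
    cball (x k) (r k) (code_point l (word_ext t)).
  move=> Jk tk sk; have [cpk _ _ rk _] := hf k Jk.
  rewrite /cball /= -cpk; apply: le_trans rk; apply: code_point_near => //.
  by rewrite mkseq_word_ext.
(* A common extension [t] of two chosen words codes a point in both balls, contrary to
   disjointness. *)
move=> /disj_setPS/(_ (code_point l (word_ext t))); apply; split; apply: near => //.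
  by apply: st; left.
by apply: st; right.
Qed.

Lemma packing_measure_finite l : cnorm l < 1 ->
  (packing_measure (sdim l) (Aset l) < +oo)%E.
Proof.
move=> l1; have [K [d [K0 d0 gs]]] : exists K d, [/\ 0 <= K, 0 < d & good_scale l K 0 d].
  have [->|l0] := eqVneq l 0; first by exists 2, 1; split => //; exact: good_scale0.
  have [K K0 /(_ 0%N)[d d0 gs]] := good_scale_exists l l0 l1.
  by exists K, d; split => //; exact: ltW.
apply: le_lt_trans (packing_measure_le_premeasure _ _) _.
apply: le_lt_trans (packing_premeasure_cylinders l K 0 d [:: [::]] _ l1 K0 d0 gs _ _) _ => //.
  by move=> z; rewrite AsetE// => -[om _ <-]; exists om.
exact: ltry.
Qed.

(** The similarity carries a packing of the preimage to one of [F] with scaled radii; since it is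
    onto the plane, disjointness of the balls survives. *)
Lemma packing_delta_sim l w s d F : l != 0 ->
  (packing_delta s d (sim w l @^-1` F) <=
   (((cnorm l ^+ size w) `^ s)^-1)%:E * packing_delta s (cnorm l ^+ size w * d) F)%E.
Proof.
move=> l0; set q := cnorm l ^+ size w.
have q0 : 0 < q by rewrite exprn_gt0// cnorm_gt0.
have qs : 0 < q `^ s by rewrite powR_gt0.
apply: ge_ereal_sup => _ [J [x [r [hx [hdis ->]]]]].
have r0 i : J i -> 0 < r i by move=> /hx[_ /andP[]].
apply: (@le_trans _ _ (((q `^ s)^-1)%:E * \esum_(i in J) ((2 * (q * r i)) `^ s)%:E)%E).
  apply: ge_ereal_sup => _ [X [finX XJ] <-].
  apply: (@le_trans _ _ (((q `^ s)^-1)%:E * \sum_(i \in X) ((2 * (q * r i)) `^ s)%:E)%E).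
    rewrite !fsbig_finite// !sumEFin -EFinM mulr_sumr lee_fin big_seq [leRHS]big_seq.
    apply: ler_sum => i; rewrite in_fset_set// inE => /XJ/r0 ri.
    rewrite mulrCA [(q * _) `^ s]powRM ?(ltW q0) ?mulr_ge0 ?(ltW ri)//.
    by rewrite mulrA mulVf ?mul1r// gt_eqF.
  rewrite lee_pmul2l ?lte_fin ?invr_gt0//.
  by apply: ereal_sup_ubound; exists X.
rewrite lee_pmul2l ?lte_fin ?invr_gt0//.
apply: ereal_sup_ubound; exists J, (sim w l \o x), (fun i => q * r i); split.
  move=> i Ji; have [Fx /andP[ri rd]] := hx i Ji; split => //.
  by rewrite mulr_gt0//= ler_pM2l.
split => // i j Ji Jj ij; apply/disj_setPS => y [yi yj].
have e0 : cexp l (size w) != 0.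
  by apply/eqP => e; move: q0; rewrite /q -cnorm_cexp e cnorm0 ltxx.
pose y' := cmul (cinv (cexp l (size w))) (y - pw w l).
have yE : sim w l y' = y.
  by rewrite /sim /y' cmulA cmulV// cmul1 addrC subrK.
move: yi yj; rewrite -yE /cball /= !sim_cdist -/q !ler_pM2l// => yi yj.
have /disj_setPS/(_ y') := hdis i j Ji Jj ij.
by apply.
Qed.

Lemma packing_premeasure_sim l w s F : l != 0 ->
  (packing_premeasure s (sim w l @^-1` F) <=
   (((cnorm l ^+ size w) `^ s)^-1)%:E * packing_premeasure s F)%E.
Proof.
move=> l0; set q := cnorm l ^+ size w.
have q0 : 0 < q by rewrite exprn_gt0// cnorm_gt0.
have qs : 0 < q `^ s by rewrite powR_gt0.
rewrite lee_pdivlMl//; apply: le_ereal_inf_tmp => _ [d d0 <-].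
rewrite -lee_pdivlMl//.
apply: (@le_trans _ _ (packing_delta s (d / q) (sim w l @^-1` F))).
  by apply: ereal_inf_lbound; exists (d / q) => //=; rewrite divr_gt0.
apply: le_trans (packing_delta_sim l w s (d / q) F l0) _; rewrite -/q.
by rewrite mulrCA divff ?mulr1// gt_eqF.
Qed.

Lemma packing_null_sim l w s F : l != 0 ->
  packing_measure s F = 0%E -> packing_measure s (sim w l @^-1` F) = 0%E.
Proof.
move=> l0 F0; set q := cnorm l ^+ size w.
have q0 : 0 < q by rewrite exprn_gt0// cnorm_gt0.
have qs : 0 < q `^ s by rewrite powR_gt0.
apply/eqP; rewrite eq_le packing_measure_ge0 andbT.
apply/lee_addgt0Pr => e e0; rewrite add0e.
have e'0 : 0 < q `^ s * e by rewrite mulr_gt0.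
have fin : packing_measure s F \is a fin_num by rewrite F0.
have [_ [G [FG ->]]] := lb_ereal_inf_adherent e'0 fin.
rewrite -/(packing_measure s F) F0 add0e => lt.
apply: le_trans (packing_measure_le s _ (fun i => sim w l @^-1` G i) _) _.
  by move=> x /FG[i _ Gx]; exists i.
apply: (@le_trans _ _ (\sum_(i <oo) (((q `^ s)^-1)%:E * packing_premeasure s (G i)))%E).
  apply: lee_nneseries => i _; first by move=> _; exact: packing_premeasure_ge0.
  exact: packing_premeasure_sim.
rewrite nneseriesZl; last by move=> *; exact: packing_premeasure_ge0.
rewrite -lee_pdivlMl ?invr_gt0// invrK -EFinM; exact: ltW.
Qed.

End PackingUpper.

(** * Fair signs *)

Section Coin.
Context {R : realType}.

(** A concrete coin-tossing space for the positivity proof: the uniform law on [0,1), with binary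
    digits as signs. *)
Definition unit_interval_measure : set (measurableTypeR R) -> \bar R :=
  mrestr lebesgue_measure (measurable_itv `[(0 : R), 1[).

HB.instance Definition _ := Measure.on unit_interval_measure.

Let unit_interval_measureT : unit_interval_measure [set: _] = 1%E.
Proof.
rewrite /unit_interval_measure /mrestr setTI.
by apply: etrans (lebesgue_measure_itv _) _; rewrite /= lte_fin ltr01 sube0.
Qed.

HB.instance Definition _ :=
  Measure_isProbability.Build _ _ R unit_interval_measure unit_interval_measureT.

(* Greedy binary expansion: the largest dyadic number of level n not exceeding x. *)
Fixpoint dyadic_floor n (x : R) : R :=
  if n is m.+1 then
    if dyadic_floor m x + 2^-1 ^+ m.+1 <= x then dyadic_floor m x + 2^-1 ^+ m.+1
    else dyadic_floor m x
  else 0.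

Definition binary_sign n (x : R) : R :=
  if dyadic_floor n x + 2^-1 ^+ n.+1 <= x then 1 else -1.

(** Left endpoint of the dyadic interval of level [n] with digit pattern [b]. *)
Fixpoint dyadic_value (b : nat -> R) n : R :=
  if n is m.+1 then dyadic_value b m + (if b m == 1 then 2^-1 ^+ m.+1 else 0) else 0.

Lemma measurable_dyadic_floor n :
  measurable_fun [set: measurableTypeR R] (dyadic_floor n : _ -> measurableTypeR R).
Proof.
elim: n => [|n IH] /=; first exact: measurable_cst.
apply: measurable_fun_ifT => //; last by apply: measurable_funD => //; exact: measurable_cst.
apply: measurable_fun_ler; last exact: measurable_id.
by apply: measurable_funD => //; exact: measurable_cst.
Qed.

Lemma measurable_binary_sign n :
  measurable_fun [set: measurableTypeR R] (binary_sign n : _ -> measurableTypeR R).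
Proof.
apply: measurable_fun_ifT; try exact: measurable_cst.
apply: measurable_fun_ler; last exact: measurable_id.
apply: measurable_funD; [exact: measurable_dyadic_floor|exact: measurable_cst].
Qed.

Lemma dyadic_value_bounds b n : 0 <= dyadic_value b n /\ dyadic_value b n + 2^-1 ^+ n <= 1.
Proof.
elim: n => [|n [h1 h2]] /=; first by rewrite expr0 add0r.
have p : 0 < (2^-1 : R) ^+ n by rewrite exprn_gt0.
by rewrite exprS; case: ifP => _; split; lra.
Qed.

(** The clause on [dyadic_floor] drives the induction: it identifies the threshold against which the
    next digit is decided. *)
Lemma binary_sign_cylinder (b : nat -> R) n (x : R) :
  (forall i, b i = 1 \/ b i = -1) -> 0 <= x < 1 ->
  ((forall i, (i < n)%N -> binary_sign i x = b i) <->
     dyadic_value b n <= x < dyadic_value b n + 2^-1 ^+ n) /\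
  ((forall i, (i < n)%N -> binary_sign i x = b i) -> dyadic_floor n x = dyadic_value b n).
Proof.
move=> hb /andP[x0 x1]; elim: n => [|n [IH1 IH2]].
  by rewrite /= expr0 add0r x0 x1.
have p : 0 < (2^-1 : R) ^+ n by rewrite exprn_gt0.
have n11 : (-1 : R) == 1 = false by rewrite lt_eqF//; lra.
have split_last : (forall i, (i < n.+1)%N -> binary_sign i x = b i) <->
    (forall i, (i < n)%N -> binary_sign i x = b i) /\ binary_sign n x = b n.
  split=> [h|[h hn] i]; first by split=> [i ni|]; apply: h => //; exact: ltnW.
  by rewrite ltnS leq_eqVlt => /predU1P[->//|]; exact: h.
have step : (forall i, (i < n)%N -> binary_sign i x = b i) -> binary_sign n x =
    if dyadic_value b n + 2^-1 ^+ n.+1 <= x then 1 else -1.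
  by move=> h; rewrite /binary_sign IH2.
split; last first.
  move=> /split_last[h hn]; rewrite /= (IH2 h); move: hn; rewrite (step h).
  by case: ifP => _ <-; rewrite ?eqxx// n11 addr0.
rewrite split_last /=; set v := dyadic_value b n in step IH1 IH2 *.
have E : (2^-1 : R) ^+ n.+1 = 2^-1 ^+ n / 2 by rewrite exprS mulrC.
rewrite E in step *; set y := 2^-1 ^+ n in p E step IH1 IH2 *.
split.
  move=> [h]; rewrite (step h); have /andP[h1 h2] := IH1.1 h.
  case: (leP (v + y / 2) x) => hx <-; rewrite ?eqxx ?n11; apply/andP; split; lra.
move=> hx; have h : forall i, (i < n)%N -> binary_sign i x = b i.
  by apply/IH1; move: hx; case: ifP => _ /andP[? ?]; apply/andP; split; lra.
split => //; rewrite (step h); move: hx.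
have [->|->] := hb n; rewrite ?eqxx ?n11 => /andP[h1 h2].
  by rewrite ifT//; lra.
by rewrite ifF//; apply/negbTE; rewrite -ltNge; lra.
Qed.

Lemma fair_signs_binary : fair_signs unit_interval_measure binary_sign.
Proof.
split; first exact: measurable_binary_sign.
split; first by move=> n w; rewrite /binary_sign; case: ifP; [left|right].
move=> n b hb; rewrite /unit_interval_measure /mrestr.
have [b0 b1] := dyadic_value_bounds b n.
have p : 0 < (2^-1 : R) ^+ n by rewrite exprn_gt0.
have E : [set w | forall i, (i < n)%N -> binary_sign i w = b i] `&` `[(0 : R), 1[%classic =
    `[dyadic_value b n, dyadic_value b n + 2^-1 ^+ n[%classic.
  apply/seteqP; split => x /=; rewrite !in_itv /=.
    by move=> [h x01]; apply/(binary_sign_cylinder b n x hb x01).1.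
  move=> hx; have x01 : 0 <= x < 1 by case/andP: hx => h1 h2; apply/andP; split; lra.
  by split => //; apply/(binary_sign_cylinder b n x hb x01).1.
apply: etrans (congr1 lebesgue_measure E) _; apply: etrans (lebesgue_measure_itv _) _.
by rewrite /= lte_fin ltrDl p -EFinB addrAC subrr add0r exprVn.
Qed.

End Coin.

(** * Cylinders and their probabilities *)

Section Cylinders.

Definition code {R : realType} {T : Type} (eps : nat -> T -> R) (w : T) : nat -> bool :=
  fun n => eps n w == 1.

Definition cylinder {R : realType} {T : Type} (eps : nat -> T -> R) n (W : seq (seq bool)) :
  set T := [set w | mkseq (code eps w) n \in W].

Context {R : realType} {d : measure_display} {Omega : measurableType d}
  {P : probability Omega R} {eps : nat -> Omega -> R} (fair : fair_signs P eps).

Lemma eps_sg n w : eps n w = sg (code eps w n).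
Proof.
have [_ [h _]] := fair; rewrite /code; have [->|->] := h n w; first by rewrite eqxx.
by rewrite lt_eqF//; lra.
Qed.

Lemma sg_inj : injective (@sg R).
Proof. by move=> [] [] //=; lra. Qed.

Lemma cylinder1E n u : size u = n ->
  cylinder eps n [:: u] = [set w | forall i, (i < n)%N -> eps i w = sg (nth false u i)].
Proof.
move=> su; apply/seteqP; split => w; rewrite /cylinder /= inE.
  by move=> /eqP <- i ni; rewrite nth_mkseq// eps_sg.
move=> h; apply/eqP; apply: (@eq_from_nth _ false); rewrite size_mkseq ?su// => i ni.
by rewrite nth_mkseq//; apply: sg_inj; rewrite -eps_sg h.
Qed.

Lemma cylinder_prob1 n u : size u = n -> P (cylinder eps n [:: u]) = (2 ^- n)%:E.
Proof.
move=> su; rewrite cylinder1E//; have [_ [_ h]] := fair; apply: h.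
by move=> i; case: nth; [left|right].
Qed.

Lemma measurable_cylinder1 n u : size u = n -> measurable (cylinder eps n [:: u]).
Proof.
move=> su; rewrite cylinder1E//.
rewrite (_ : [set w | _] = \bigcap_(i in `I_n) (eps i @^-1` [set sg (nth false u i)])) //.
apply: bigcap_measurableType => i _; rewrite -[X in measurable X]setTI.
have [h _] := fair; exact: (h i measurableT [set _] (measurable_set1 _)).
Qed.

Lemma cylinder_cons n u W : cylinder eps n (u :: W) = cylinder eps n [:: u] `|` cylinder eps n W.
Proof.
apply/seteqP; split => w; rewrite /cylinder /= !inE.
  by move=> /orP[->|->]; [left|right].
by move=> [->//|->]; rewrite orbT.
Qed.

Lemma measurable_cylinder n W : all (fun u => size u == n) W -> measurable (cylinder eps n W).
Proof.
elim: W => [|u W IH] /=.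
  by move=> _; rewrite (_ : cylinder eps n [::] = set0)//; apply/seteqP; split.
move=> /andP[/eqP su aW]; rewrite cylinder_cons; apply: measurableU; last exact: IH.
exact: measurable_cylinder1.
Qed.

Lemma cylinder_prob n W : uniq W -> all (fun u => size u == n) W ->
  P (cylinder eps n W) = ((size W)%:R * 2 ^- n)%:E.
Proof.
elim: W => [|u W IH] /=.
  move=> _ _; rewrite (_ : cylinder eps n [::] = set0) ?measure0 ?mul0r//.
  by apply/seteqP; split.
move=> /andP[uW uniqW] /andP[/eqP su aW]; rewrite cylinder_cons.
transitivity (P (cylinder eps n [:: u]) + P (cylinder eps n W))%E; last first.
  have e : (size (u :: W))%:R = 1 + (size W)%:R :> R by rewrite /= -addn1 natrD addrC.
  by rewrite e cylinder_prob1// IH// -EFinD mulrDl mul1r.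
apply: measureU; [exact: measurable_cylinder1|exact: measurable_cylinder|].
apply/seteqP; split => // w; rewrite /cylinder /= inE => -[/eqP ->].
by rewrite (negbTE uW).
Qed.

End Cylinders.

(** * Separated nets and packings *)

Section Nets.
Context {R : realType}.
Local Notation C := (R * R)%type.

Lemma maximal_net (F : set C) (rho : R) (M : nat) : 0 <= rho ->
  (forall xs : seq C, (forall x, x \in xs -> F x) ->
     pairwise (fun x y => rho < cdist x y) xs -> (size xs <= M)%N) ->
  exists xs : seq C, [/\ forall x, x \in xs -> F x,
    pairwise (fun x y => rho < cdist x y) xs &
    forall y, F y -> exists2 x, x \in xs & cdist x y <= rho].
Proof.
move=> rho0 hM.
pose Q n := `[< exists xs : seq C, [/\ forall x, x \in xs -> F x,
    pairwise (fun x y => rho < cdist x y) xs & size xs = n] >].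
have Q0 : exists n, Q n by exists 0%N; apply/asboolP; exists [::].
have QM n : Q n -> (n <= M)%N by move=> /asboolP[xs [h1 h2 <-]]; exact: hM.
case: (ex_maxnP Q0 QM) => n /asboolP[xs [xF xp sx]] hmax.
exists xs; split => // y Fy; apply: contrapT => H.
have : Q n.+1.
  apply/asboolP; exists (y :: xs); split => /=; last by rewrite sx.
    by move=> x; rewrite inE => /predU1P[->//|]; exact: xF.
  rewrite xp andbT; apply/allP => x xin; rewrite ltNge; apply/negP => h.
  by apply: H; exists x => //; rewrite cdistC.
by move=> /hmax; rewrite ltnn.
Qed.

Lemma packing_delta_pairwise (s d rho : R) (F : set C) (xs : seq C) : 0 < rho <= d ->
  (forall x, x \in xs -> F x) -> pairwise (fun x y => 2 * rho < cdist x y) xs ->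
  (((size xs)%:R * (2 * rho) `^ s)%:E <= packing_delta s d F)%E.
Proof.
move=> rd xF xp.
apply: (@le_trans _ _ (\esum_(i in `I_(size xs)) ((2 * rho) `^ s)%:E)%E).
  apply: esum_ge; exists `I_(size xs); first by split => //; exact: finite_II.
  by rewrite -fsbig_ord sumEFin big_const_ord iter_addr addr0 mulr_natl.
apply: ereal_sup_ubound; exists `I_(size xs), (nth 0 xs), (fun=> rho); split.
  by move=> i /= ix; split => //; apply: xF; rewrite mem_nth.
split => // i j /= ix jx ij; apply/disj_setPS => y [yi yj].
have lt a b : (a < b)%N -> (b < size xs)%N -> cball (nth 0 xs a) rho y ->
    cball (nth 0 xs b) rho y -> False.
  move=> ab bx; rewrite /cball /= => ya yb.
  have := (pairwiseP 0 xp) a b; rewrite !inE => /(_ (ltn_trans ab bx) bx ab).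
  have := ler_cdistD y (nth 0 xs a) (nth 0 xs b); rewrite [cdist y _]cdistC.
  by lra.
by case: (ltngtP i j) ij => // h _; [apply: (lt i j)|apply: (lt j i)].
Qed.

End Nets.

(** * Positivity of the packing measure *)

Section PositivePacking.
Context {R : realType}.
Local Notation C := (R * R)%type.
Implicit Types (l z x : C) (F : set C) (B L e : R).

Definition close_count B l n u :=
  count (fun v => cdist (pw u l) (pw v l) <= B * cnorm l ^+ n) (words n).

Definition close_pairs B l n := (\sum_(u <- words n) close_count B l n u)%N.

Lemma count_has (T : Type) (I : eqType) (r : seq I) (p : I -> pred T) (xs : seq T) :
  (count (fun u => has (fun i => p i u) r) xs <= \sum_(i <- r) count (p i) xs)%N.
Proof.
elim: r => [|i r IH]; first by rewrite big_nil count_pred0.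
rewrite big_cons; apply: leq_trans (leq_add (leqnn _) IH).
by rewrite -(count_predUI (p i)) leq_addr.
Qed.

(** Balls of radius |l|^n about points more than twice that apart form a packing, each of weight at
    least [2 ^- n], so a maximal separated set is small. *)
Lemma packing_net l e d n F : l != 0 -> cnorm l < 1 -> cnorm l ^+ n <= d ->
  (packing_delta (sdim l) d F <= e%:E)%E ->
  exists ys : seq C, [/\ forall x, x \in ys -> F x, (size ys)%:R <= e * 2 ^+ n &
    forall y, F y -> exists2 x, x \in ys & cdist x y <= 2 * cnorm l ^+ n].
Proof.
move=> l0 l1 ld hd; have p0 : 0 < cnorm l ^+ n by rewrite exprn_gt0// cnorm_gt0.
have p2 : 0 < (2 : R) ^+ n by rewrite exprn_gt0.
have bd (xs : seq C) : (forall x, x \in xs -> F x) ->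
    pairwise (fun x y => 2 * cnorm l ^+ n < cdist x y) xs -> (size xs)%:R <= e * 2 ^+ n.
  move=> xF xp; have := @packing_delta_pairwise _ (sdim l) d (cnorm l ^+ n) F xs
    ltac:(by rewrite p0) xF xp.
  move=> /le_trans/(_ hd); rewrite lee_fin powRM ?(ltW p0)// powR_sdim// => h.
  rewrite -ler_pdivrMr//; apply: le_trans h; rewrite mulrA ler_wpM2r ?invr_ge0 ?(ltW p2)//.
  have h2 : 1 <= (2 : R) `^ sdim l.
    by rewrite -[leLHS](powRr0 (2 : R)) ler_powR ?sdim_ge0// ler1n.
  by rewrite ler_peMr.
have r0 : 0 <= 2 * cnorm l ^+ n by rewrite mulr_ge0// ltW.
have [|ys [yF yp hy]] := maximal_net F (2 * cnorm l ^+ n) (Num.truncn (e * 2 ^+ n)) r0.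
  move=> xs xF xp; have := bd xs xF xp => h.
  rewrite -ltnS -(ltr_nat R); apply: le_lt_trans h _.
  exact: truncnS_gt.
by exists ys; split => //; exact: bd.
Qed.

(** Markov's inequality for [close_count]. *)
Lemma bad_words_count B l n L : 0 < L -> (close_pairs B l n)%:R <= L * 2 ^+ n ->
  (count (fun u => 2 * L < (close_count B l n u)%:R) (words n))%:R <= 2 ^+ n / 2 :> R.
Proof.
move=> L0 h; have : (count (fun u => 2 * L < (close_count B l n u)%:R) (words n))%:R * (2 * L)
    <= (close_pairs B l n)%:R.
  rewrite /close_pairs natr_sum -sum1_count natr_sum mulr_suml big_mkcond.
  apply: ler_sum => u _; case: ifP => [/ltW|_]; first by rewrite mul1r.
  by rewrite ler0n.
move=> /le_trans/(_ h); set x := (count _ _)%:R; set y := 2 ^+ n => hx.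
by rewrite -(ler_pM2r L0); lra.
Qed.

(** All words near one point [x] are mutually close because [2 * D <= B]; if one of them has at most
    [2 * L] close words, this bounds their number. *)
Lemma near_good_count B l n L D (ys : seq C) : 0 <= L -> 2 * D <= B ->
  (count (fun u => has (fun x => (cdist (pw u l) x <= D * cnorm l ^+ n) &&
     ((close_count B l n u)%:R <= 2 * L)) ys) (words n))%:R <= (size ys)%:R * (2 * L).
Proof.
move=> L0 DB.
have := count_has _ _ ys (fun x u => (cdist (pw u l) x <= D * cnorm l ^+ n) &&
     ((close_count B l n u)%:R <= 2 * L)) (words n).
rewrite -(ler_nat R) => /le_trans; apply; rewrite natr_sum.
have -> : (size ys)%:R * (2 * L) = \sum_(x <- ys) 2 * L.
  by rewrite big_const_seq count_predT iter_addr addr0 [LHS]mulr_natl.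
apply: ler_sum => x _; set p := (X in count X).
have [/hasP[u0 _ /andP[h1 h2]]|] := boolP (has p (words n)); last first.
  by rewrite has_count -leqNgt leqn0 => /eqP ->; rewrite mulr_ge0.
apply: le_trans h2; rewrite ler_nat; apply: sub_count => u /andP[hu _].
apply: le_trans (ler_cdistD x _ _) _; rewrite [cdist x _]cdistC.
apply: le_trans (lerD h1 hu) _; rewrite -mulrDl ler_wpM2r ?exprn_ge0//; lra.
Qed.

Lemma probability_bigcup_cvg d (Omega : measurableType d) (P : probability Omega R)
    (E : nat -> set Omega) (c : R) : (forall i, measurable (E i)) ->
  \bigcup_i E i = setT -> (forall I, (P (\big[setU/set0]_(i < I) E i) <= c%:E)%E) -> 1 <= c.
Proof.
move=> mE UE hc; rewrite -lee_fin -(probability_setT P) -UE -bigcup_bigsetU_bigcup.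
have mB I : measurable (\big[setU/set0]_(i < I) E i) by apply: bigsetU_measurable.
have cv := @nondecreasing_cvg_mu _ _ _ P (fun I => \big[setU/set0]_(i < I.+1) E i) (fun I => mB I.+1)
  (bigcupT_measurable _ (fun I => mB I.+1))
  ltac:(by move=> m n mn; apply/subsetPset; exact: subset_bigsetU).
rewrite -(cvg_lim _ cv)//; apply: lime_le; first by apply/cvg_ex; eexists; exact: cv.
by apply: nearW => k; exact: (hc k.+1).
Qed.

(** If the measure vanished, sets of tiny total premeasure would cover [Aset l]. At a large level at
    most half of the words have many close neighbours, and only an eighth can be good and near the
    nets of finitely many covering sets, so the coin-tossing space would not be exhausted. *)
Lemma packing_positive B L l n0 : l != 0 -> cnorm l < 1 ->
  2 * (2 + (1 - cnorm l)^-1) <= B -> 0 < L ->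
  (forall n, (n0 <= n)%N -> (close_pairs B l n)%:R <= L * 2 ^+ n) ->
  (0 < packing_measure (sdim l) (Aset l))%E.
Proof.
move=> l0 l1 hB L0 hL; rewrite lt_neqAle packing_measure_ge0 andbT.
apply/eqP => /esym P0; set D := 2 + (1 - cnorm l)^-1 in hB.
(* Chosen so that [2 * e * (2 * L) = 1/8], the share of good words near the nets. *)
pose e : R := (32 * L)^-1; have e0 : 0 < e by rewrite invr_gt0 mulr_gt0.
have fin : packing_measure (sdim l) (Aset l) \is a fin_num by rewrite P0.
have [_ [F [AF ->]]] := lb_ereal_inf_adherent e0 fin.
rewrite -/(packing_measure _ _) P0 add0e => sF.
have pF0 i : (0 <= packing_premeasure (sdim l) (F i))%E by exact: packing_premeasure_ge0.
have finF i : packing_premeasure (sdim l) (F i) \is a fin_num.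
  rewrite ge0_fin_numE//; apply: le_lt_trans (lt_trans sF (ltry _)).
  exact: (nneseries_term_le (fun i => packing_premeasure (sdim l) (F i))).
have ei0 i : 0 < e / (2 ^ i.+1)%:R by rewrite divr_gt0// ltr0n expn_gt0.
pose ee i := fine (packing_premeasure (sdim l) (F i)) + e / (2 ^ i.+1)%:R.
have see I : \sum_(i < I) ee i <= 2 * e.
  rewrite -lee_fin -sumEFin.
  apply: (@le_trans _ _ (\sum_(i <oo) (packing_premeasure (sdim l) (F i) +
    (e / (2 ^ i.+1)%:R)%:E))%E).
    apply: le_trans (nneseries_lim_ge I _); last first.
      by move=> i _; rewrite adde_ge0// lee_fin ltW.
    by rewrite big_mkord; apply: lee_sum => i _; rewrite /ee EFinD fineK.
  apply: le_trans (epsilon_trick xpredT pF0 (ltW e0)) _.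
  by rewrite mulr_natl mulr2n EFinD leeD2r// ltW.
have /choice[dd hdd] : forall i, exists d : R, 0 < d /\
    (packing_delta (sdim l) d (F i) <= (ee i)%:E)%E.
  move=> i; have [_ [d d0 <-] lt] := lb_ereal_inf_adherent (ei0 i) (finF i).
  by exists d; split => //; rewrite /ee EFinD fineK//; exact: ltW.
have /choice[nn hnn] : forall i, exists m, forall n, (m <= n)%N -> (n0 <= n)%N /\ cnorm l ^+ n <= dd i.
  move=> i; have [d0 _] := hdd i.
  have [m hm] := geometric_small (cnorm l) (dd i) (cnorm_ge0 l) l1 d0.
  exists (maxn m n0) => n; rewrite geq_max => /andP[mn n0n]; split => //.
  exact/ltW/hm.
have /choice[ys hys] : forall p : nat * nat, exists ys : seq C, (nn p.1 <= p.2)%N ->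
    (size ys)%:R <= ee p.1 * 2 ^+ p.2 /\
    forall y, F p.1 y -> exists2 x, x \in ys & cdist x y <= 2 * cnorm l ^+ p.2.
  move=> [i n] /=; have [/hnn[_ h]|] := boolP (nn i <= n)%N; last by exists [::].
  by have [_ hd] := hdd i; have [ys [_ h1 h2]] := packing_net l _ _ _ _ l0 l1 h hd; exists ys.
pose near i n (u : seq bool) := has (fun x => cdist (pw u l) x <= D * cnorm l ^+ n) (ys (i, n)).
pose good n u := (close_count B l n u)%:R <= 2 * L.
have fair := @fair_signs_binary R.
pose P : probability (measurableTypeR R) R := @unit_interval_measure R.
pose cyl n W := cylinder (@binary_sign R : nat -> measurableTypeR R -> R) n W.
(* A measurable substitute for the event that the code point lies in [F i], which is an arbitrary
   set: all late prefixes stay near its nets. *)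
pose E i := \bigcap_k cyl (nn i + k)%N [seq u <- words (nn i + k) | near i (nn i + k)%N u].
have aW n (p : pred (seq bool)) : all (fun u => size u == n) [seq u <- words n | p u].
  by apply/allP => u; rewrite mem_filter mem_words => /andP[_].
have mE i : measurable (E i).
  by apply: bigcapT_measurable => k; apply: (measurable_cylinder fair).
have UE : \bigcup_i E i = setT.
  apply/seteqP; split => // w _; have : Aset l (code_point l (code (@binary_sign R) w)).
    by rewrite AsetE//; exists (code (@binary_sign R) w).
  move=> /AF[i _ Fi]; exists i => // k _; rewrite /cyl /cylinder /= mem_filter mem_words size_mkseq eqxx andbT.
  have [_ /(_ _ Fi)[x xys hx]] := hys (i, (nn i + k)%N) (leq_addr _ _).
  apply/hasP; exists x => //; rewrite cdistC; apply: le_trans (ler_cdistD _ _ _) (le_trans (lerD hx (code_point_tail _ _ _ l1)) _).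
  by rewrite -mulrDl.
have : 1 <= 3/4 :> R; last by lra.
apply: (@probability_bigcup_cvg _ _ P E) => // I.
pose n := maxn n0 (\max_(i < I) nn i).
have nI (i : 'I_I) : (nn i <= n)%N by rewrite leq_max (leq_bigmax (F := nn \o val)) orbT.
have n0n : (n0 <= n)%N by rewrite leq_maxl.
(* The level [n] is past the thresholds of the first [I] sets, so their events all lie in the
   cylinder set of [V]. *)
pose V := [seq u <- words n | ~~ good n u || has (fun i : 'I_I =>
   has (fun x => (cdist (pw u l) x <= D * cnorm l ^+ n) && good n u) (ys (val i, n))) (enum 'I_I)].
have uV : uniq V by rewrite filter_uniq// uniq_words.
apply: (@le_trans _ _ (P (cyl n V))).
  apply: le_measure; rewrite ?inE.
  - by apply: bigsetU_measurable.
  - by apply: (measurable_cylinder fair); exact: aW.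
  move=> w; rewrite -bigcup_mkord => -[i /= iI Ew].
  rewrite /cyl /cylinder /= mem_filter mem_words size_mkseq eqxx andbT.
  case: (boolP (good n _)) => //= hg; apply/hasP; exists (Ordinal iI); first by rewrite mem_enum.
  have := Ew (n - nn i)%N Logic.I; rewrite subnKC ?(nI (Ordinal iI))// /cyl /cylinder /= mem_filter => /andP[/hasP[x xi hx] _].
  by apply/hasP; exists x => //; rewrite hx.
rewrite (cylinder_prob fair)// ?aW// lee_fin ler_pdivrMr ?exprn_gt0//.
have sV : (size V)%:R <= (count (fun u => ~~ good n u) (words n))%:R +
    \sum_(i < I) (size (ys (val i, n)))%:R * (2 * L) :> R.
  rewrite size_filter; set q := fun i : 'I_I => _.
  apply: (@le_trans _ _ (count (fun u => ~~ good n u) (words n) +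
     count (fun u => has (fun i : 'I_I =>
   has (fun x => (cdist (pw u l) x <= D * cnorm l ^+ n) && good n u) (ys (val i, n))) (enum 'I_I)) (words n))%:R).
    by rewrite ler_nat -count_predUI leq_addr.
  rewrite natrD lerD2l.
  have := count_has _ _ (enum 'I_I) (fun (i : 'I_I) u =>
    has (fun x => (cdist (pw u l) x <= D * cnorm l ^+ n) && good n u) (ys (val i, n))) (words n).
  rewrite -(ler_nat R) => /le_trans; apply; rewrite natr_sum big_enum /=.
  apply: ler_sum => i _; apply: near_good_count => //; exact: ltW.
apply: le_trans sV _.
have hb : (count (fun u => ~~ good n u) (words n))%:R <= 2 ^+ n / 2 :> R.
  rewrite (eq_count (a2 := fun u => 2 * L < (close_count B l n u)%:R)).
    by apply: bad_words_count => //; exact: hL.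
  by move=> u; rewrite /good /= -ltNge.
have hs : \sum_(i < I) (size (ys (val i, n)))%:R * (2 * L) <= (2 * e) * 2 ^+ n * (2 * L).
  rewrite -mulr_suml ler_wpM2r//; first by rewrite mulr_ge0// ltW.
  apply: (@le_trans _ _ (\sum_(i < I) ee i * 2 ^+ n)).
    by apply: ler_sum => i _; have [] := hys (val i, n) (nI i).
  by rewrite -mulr_suml ler_wpM2r// exprn_ge0.
apply: le_trans (lerD hb hs) _.
have -> : 2 * e * 2 ^+ n * (2 * L) = 2 ^+ n / 8.
  by rewrite /e; field; rewrite gt_eqF.
have : 0 < (2 : R) ^+ n by rewrite exprn_gt0.
lra.
Qed.

End PositivePacking.

(** * The exceptional set of parameters *)

Section ExceptionalSet.
Context {R : realType}.
Local Notation C := (R * R)%type.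
Implicit Types (l z x : C) (B q eta Rr t : R).

Definition cross_count B l n u :=
  count (fun v => cdist (pw (true :: u) l) (pw (false :: v) l) <= B * cnorm l ^+ n.+1) (words n).

Definition cross_pairs B l n := (\sum_(u <- words n) cross_count B l n u)%N.

Lemma perm_wordsS n :
  perm_eq (words n.+1) ([seq true :: w | w <- words n] ++ [seq false :: w | w <- words n]).
Proof.
apply: uniq_perm; first exact: uniq_words.
  have inj b : injective (cons b : seq bool -> seq bool) by move=> ? ? [].
  rewrite cat_uniq (map_inj_uniq (inj true)) (map_inj_uniq (inj false)) !uniq_words /= andbT.
  by apply/hasPn => _ /mapP[w _ ->]; apply/negP => /mapP[].
move=> [|a w]; rewrite mem_cat mem_words.
  by symmetry; apply/negbTE; rewrite negb_or; apply/andP; split; apply/negP => /mapP[].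
have e b : ((a :: w) \in [seq b :: w | w <- words n]) = (a == b) && (size w == n).
  apply/mapP/andP => [[v]|[/eqP -> sw]]; first by rewrite mem_words => sv [-> ->].
  by exists w; rewrite ?mem_words.
by rewrite !e eqSS; clear e; case: a; rewrite ?orbF.
Qed.

Lemma pw_cons a w l : pw (a :: w) l = (sg a, 0) + cmul l (pw w l).
Proof. by []. Qed.

(** Pairs with equal first letters rescale to pairs of the previous level; by symmetry the others
    come twice from [cross_pairs]. *)
Lemma close_pairsS B l n : l != 0 ->
  close_pairs B l n.+1 = (2 * close_pairs B l n + 2 * cross_pairs B l n)%N.
Proof.
move=> l0; have p0 := cnorm_gt0 _ l0.
have same a u v : (cdist (pw (a :: u) l) (pw (a :: v) l) <= B * cnorm l ^+ n.+1) =
    (cdist (pw u l) (pw v l) <= B * cnorm l ^+ n).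
  rewrite {1}/cdist !pw_cons opprD addrACA subrr add0r -cmulBr cnormM exprS mulrCA.
  by rewrite ler_pM2l.
have cc u : close_count B l n.+1 u =
   (count (fun v => (cdist (pw u l) (pw (true :: v) l) <= B * cnorm l ^+ n.+1)%R) (words n) +
    count (fun v => (cdist (pw u l) (pw (false :: v) l) <= B * cnorm l ^+ n.+1)%R) (words n))%N.
  by rewrite /close_count (permP (perm_wordsS n)) count_cat !count_map.
have M b F : (\sum_(u <- [seq b :: w | w <- words n]) F u = \sum_(w <- words n) F (b :: w))%N.
  exact: big_map.
pose S a b := (\sum_(u <- words n) count (fun v =>
  (cdist (pw (a :: u) l) (pw (b :: v) l) <= B * cnorm l ^+ n.+1)%R) (words n))%N.
have E1 a : S a a = close_pairs B l n.
  by apply: eq_bigr => u _; apply: eq_count => v; exact: same.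
have E2 : S true false = cross_pairs B l n by [].
have E3 : S false true = cross_pairs B l n.
  rewrite /S /cross_pairs /cross_count; under eq_bigr do rewrite -sum1_count.
  rewrite (exchange_big_dep xpredT)//=; apply: eq_bigr => u _.
  by rewrite sum1_count; apply: eq_count => v /=; rewrite cdistC.
transitivity (S true true + S true false + (S false true + S false false))%N; last first.
  by rewrite !E1 E2 E3 [(cross_pairs B l n + _)%N]addnC addnn -mul2n mulnDr.
rewrite /close_pairs (perm_big _ (perm_wordsS n)) big_cat /= !M.
under eq_bigr do rewrite cc.
under [X in (_ + X)%N]eq_bigr do rewrite cc.
by rewrite !big_split.
Qed.

(** Divided by 2^n, the count grows at each step by at most q^n, and these increments have a finite
    sum. *)
Lemma close_pairs_bound B l q n0 : l != 0 -> 0 < q -> q < 1 ->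
  (forall n, (n0 <= n)%N -> (cross_pairs B l n)%:R <= (2 * q) ^+ n) ->
  exists2 L : R, 0 < L & forall n, (n0 <= n)%N -> (close_pairs B l n)%:R <= L * 2 ^+ n.
Proof.
move=> l0 q0 q1 h; have d0 : 0 < 1 - q by rewrite subr_gt0.
pose c : R := (close_pairs B l n0)%:R.
have key k : (close_pairs B l (n0 + k))%:R <= (c + (1 - q ^+ (n0 + k)) / (1 - q)) * 2 ^+ (n0 + k).
  elim: k => [|k IH].
    rewrite addn0 mulrDl; apply: (@le_trans _ _ (c * 2 ^+ n0)).
      by rewrite ler_peMr// exprn_ege1// ler1n.
    rewrite lerDl mulr_ge0 ?exprn_ge0// divr_ge0 ?(ltW d0)// subr_ge0.
    by rewrite exprn_ile1// ltW.
  rewrite addnS close_pairsS// natrD !natrM.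
  have := h (n0 + k)%N (leq_addr _ _); rewrite exprMn.
  move: IH; set x := (close_pairs _ _ _)%:R; set y := (cross_pairs _ _ _)%:R.
  rewrite !exprS; set Q := q ^+ (n0 + k); set T := 2 ^+ (n0 + k) => h1 h2.
  have -> : (c + (1 - q * Q) / (1 - q)) * (2 * T) =
      2 * ((c + (1 - Q) / (1 - q)) * T) + 2 * (T * Q) by field; rewrite gt_eqF.
  by apply: lerD; rewrite ler_pM2l.
exists (c + (1 - q)^-1); first by rewrite ltr_wpDl// invr_gt0.
move=> n /subnKC <-; apply: le_trans (key _) _.
rewrite ler_wpM2r ?exprn_ge0// lerD2l ler_pdivrMr// mulVf ?gt_eqF//.
by rewrite lerBlDr lerDl exprn_ge0// ltW.
Qed.

(** The closeness constant 12 is [2 * (2 + (1 - 3/4)^-1)], as [packing_positive] requires for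
    [cnorm l <= 3/4]. *)
Lemma cross_pairs_large l q n0 : l != 0 -> cnorm l <= 3/4 -> 0 < q -> q < 1 ->
  packing_measure (sdim l) (Aset l) = 0%E ->
  exists2 n, (n0 <= n)%N & (2 * q) ^+ n < (cross_pairs 12 l n)%:R.
Proof.
move=> l0 l34 q0 q1 P0; apply: contrapT => H.
have [n n0n|L L0 hL] := close_pairs_bound 12 l q n0 l0 q0 q1.
  by rewrite leNgt; apply/negP => h; apply: H; exists n.
have l1 : cnorm l < 1 by lra.
have := packing_positive 12 L l n0 l0 l1 _ L0 hL; rewrite P0 ltxx => h.
suff : false by []; apply: h.
have : (1 - cnorm l)^-1 <= 4; last by lra.
by rewrite invf_ple ?posrE; lra.
Qed.

Lemma word_difference u v : size u = size v -> exists2 s : seq R,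
  all (fun a => `|a| <= 1) s & forall z, pw u z - pw v z = cscale 2 (hev s z).
Proof.
elim: u v => [|a u IH] [|b v] //=.
  by move=> _; exists [::] => // z; rewrite subrr; apply: cpair_eq => /=; ring.
move=> [] /IH[s hs h]; exists ((sg a - sg b) / 2 :: s).
  rewrite /= hs andbT; have -> : `|(sg a - sg b) / 2| = `|sg a - sg b| / 2 :> R.
    by rewrite normrM [`|2^-1|]ger0_norm.
  have := ler_normB (sg a : R) (sg b); have := @sg_norm R a; have := @sg_norm R b; lra.
move=> z; rewrite !pw_cons opprD addrACA -cmulBr h /=.
by apply: cpair_eq => /=; field.
Qed.

Definition half_disc Rr eta b : set C := [set l | cnorm l < Rr /\ eta <= sg b * l.2].

(** Different first letters make half of the difference a polynomial with constant term 1 and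
    coefficients in [-1,1], so transversality turns two small values into a small distance of the
    parameters. *)
Lemma cross_close_diam Rr eta b n u v l1 l2 : 0 < Rr -> Rr ^+ 2 < 1/2 -> 0 < eta -> eta <= 1 ->
  size u = n -> size v = n -> half_disc Rr eta b l1 -> half_disc Rr eta b l2 ->
  cdist (pw (true :: u) l1) (pw (false :: v) l1) <= 12 * cnorm l1 ^+ n.+1 ->
  cdist (pw (true :: u) l2) (pw (false :: v) l2) <= 12 * cnorm l2 ^+ n.+1 ->
  cdist l1 l2 <= 12 / kappa eta * Rr ^+ n.+1.
Proof.
move=> Rr0 Rrh eta0 eta1 su sv [n1 i1] [n2 i2].
have k0 := kappa_gt0 _ eta0.
have [s hs h] := word_difference u v (etrans su (esym sv)).
have E z : pw (true :: u) z - pw (false :: v) z = cscale 2 (hev (1 :: s) z).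
  by rewrite !pw_cons opprD addrACA -cmulBr h /=; apply: cpair_eq => /=; ring.
have X0 : 0 < Rr ^+ n.+1 by rewrite exprn_gt0.
have small z : cnorm z < Rr -> cdist (pw (true :: u) z) (pw (false :: v) z) <= 12 * cnorm z ^+ n.+1 ->
    cnorm (hev (1 :: s) z) <= 6 * Rr ^+ n.+1.
  move=> zr; rewrite {1}/cdist E cnormZ ger0_norm//.
  have : cnorm z ^+ n.+1 <= Rr ^+ n.+1 by rewrite lerXn2r ?nnegrE// ltW.
  move: X0; clear; move: (cnorm (hev (1 :: s) z)) (Rr ^+ n.+1) (cnorm z ^+ n.+1) => x y w; lra.
move=> /(small _ n1) f1 /(small _ n2) f2.
rewrite mulrAC ler_pdivlMr//.
have Rr1 : Rr < 71/100 by apply: sqr_lt_half => //; exact: ltW.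
have im z : eta <= sg b * z.2 -> eta <= `|z.2|.
  move=> hz; apply: le_trans hz (le_trans (ler_norm _) _).
  by rewrite normrM ler_piMl// sg_norm.
have [sm|big] := leP (6 * Rr ^+ n.+1) (kappa eta).
  have sq z : cnorm z < Rr -> cnorm z ^+ 2 <= 1/2.
    move=> zr; apply: le_trans (ltW Rrh); rewrite lerXn2r ?nnegrE//; exact: ltW.
  have := @transversality R s l2 l1 eta hs eta0 eta1 (sq _ n2) (sq _ n1) (im _ i2) (im _ i1).
  have -> : 2 * eta <= `|l1.2 + l2.2|.
    apply: le_trans (_ : sg b * (l1.2 + l2.2) <= _).
      by rewrite mulrDr; lra.
    by apply: le_trans (ler_norm _) _; rewrite normrM ler_piMl// sg_norm.
  move=> /(_ isT (le_trans f2 sm)); rewrite -/(kappa eta) mulrC => tr.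
  apply: le_trans tr _; apply: le_trans (ler_cnormB _ _) _.
  apply: le_trans (lerD f1 f2) _; clear; move: (Rr ^+ _) => x; lra.
(* At low levels the value need not be small enough for transversality, but then the claimed bound
   exceeds the diameter 2 of the unit disc. *)
have d2 : cdist l1 l2 <= 2.
  by apply: le_trans (ler_cnormB _ _) _; lra.
apply: le_trans (_ : 2 * kappa eta <= _); first by rewrite ler_wpM2r// ltW.
by move: big; clear; move: (Rr ^+ _) (kappa _) => x y; lra.
Qed.

Definition large_level Rr eta b q n : set C :=
  [set l | half_disc Rr eta b l /\ (2 * q) ^+ n < (cross_pairs 12 l n)%:R].

(* Each of the 4^n pairs of words is close only on a set of diameter O(Rr^n), so a
   separated subset of the level set has at most 4^n / (2 q)^n elements. *)
Lemma large_level_cover Rr eta b q n t : 0 < t -> 0 < Rr -> Rr ^+ 2 < 1/2 ->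
  0 < eta -> eta <= 1 -> 0 < q ->
  ball_cover t ((2 / q) ^+ n * (12 / kappa eta * Rr ^+ n.+1) `^ t) (large_level Rr eta b q n).
Proof.
move=> t0 Rr0 Rrh eta0 eta1 q0; have k0 := kappa_gt0 _ eta0.
set rho := 12 / kappa eta * Rr ^+ n.+1.
have rho0 : 0 <= rho by rewrite ltW// mulr_gt0 ?exprn_gt0// divr_gt0.
have q2 : 0 < (2 * q) ^+ n by rewrite exprn_gt0// mulr_gt0.
have bd (xs : seq C) : (forall x, x \in xs -> large_level Rr eta b q n x) ->
    pairwise (fun x y => rho < cdist x y) xs -> (size xs)%:R <= (2 / q) ^+ n.
  move=> xF xp; suff h : (size xs)%:R * (2 * q) ^+ n <= 4 ^+ n.
    rewrite -(ler_pM2r q2); apply: le_trans h _; rewrite -exprMn.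
    have -> : 2 / q * (2 * q) = 4 by field; rewrite gt_eqF.
    by [].
  apply: (@le_trans _ _ (\sum_(x <- xs) (cross_pairs 12 x n)%:R)).
    rewrite mulr_natl -iter_addr_0 -(@count_predT _ xs) -big_const_seq.
    by rewrite big_seq [leRHS]big_seq; apply: ler_sum => x /xF[_ /ltW].
  rewrite -natr_sum (_ : 4 = (2 * 2)%:R)// -natrX ler_nat expnMn -{1}(size_words n).
  rewrite /cross_pairs exchange_big /= /cross_count.
  apply: (@leq_trans (\sum_(u <- words n) 2 ^ n)); last first.
    by rewrite big_const_seq count_predT iter_addn addn0 mulnC.
  rewrite big_seq [leqRHS]big_seq; apply: leq_sum => u; rewrite mem_words => /eqP su.
  under eq_bigr do rewrite -sum1_count.
  rewrite (exchange_big_dep xpredT)//= -[leqRHS](size_words n) -sum1_size.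
  rewrite big_seq [leqRHS]big_seq; apply: leq_sum => v; rewrite mem_words => /eqP sv.
  (* The pair [u], [v] is close at no more than one of the separated points. *)
  rewrite sum1_count; elim: xs xF xp => //= x xs IH xF /andP[xall xp].
  have xF' y : y \in xs -> large_level Rr eta b q n y by move=> yx; apply: xF; rewrite inE yx orbT.
  case px : (_ <= _); last by rewrite add0n IH.
  rewrite (_ : count _ xs = 0%N)//; apply/eqP; rewrite -leqn0 leqNgt -has_count.
  apply/hasPn => y yx; apply/negP => py.
  have [Jx _] := xF x (mem_head _ _); have [Jy _] := xF' y yx.
  have := allP xall y yx; rewrite ltNge => /negP; apply.
  exact: (cross_close_diam Rr eta b n u v).
have [|ys [yF yp hy]] := maximal_net (large_level Rr eta b q n) rho
    (Num.truncn ((2 / q) ^+ n : R)) rho0.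
  move=> xs xF xp; rewrite -ltnS -(ltr_nat R).
  by apply: le_lt_trans (bd xs xF xp) _; exact: truncnS_gt.
apply: (@ball_cover_finite _ t _ _ ys rho) => //.
by rewrite ler_wpM2r ?powR_ge0// bd.
Qed.

Lemma geometric_nneseries_le (a g : R) : 0 <= a -> 0 <= g -> g < 1 ->
  (\sum_(k <oo) (a * g ^+ k)%:E <= (a / (1 - g))%:E)%E.
Proof.
move=> a0 g0 g1; have d0 : 0 < 1 - g by rewrite subr_gt0.
apply: lime_le.
  by apply: is_cvg_nneseries => k _ _; rewrite lee_fin mulr_ge0// exprn_ge0.
apply: nearW => n; rewrite sumEFin lee_fin.
have -> : \sum_(0 <= k < n) a * g ^+ k = a * (1 - g ^+ n) / (1 - g).
  elim: n => [|n IH]; first by rewrite big_nil expr0 subrr mulr0 mul0r.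
  by rewrite big_nat_recr//= IH exprS; field; rewrite gt_eqF.
rewrite ler_pM2r ?invr_gt0// ler_piMr// lerBlDr lerDl exprn_ge0//.
Qed.

(** The condition on [t] says that 2 Rr^t < 1, so for q between 2 Rr^t and 1 the weights of the
    level covers are summable. Exceptional parameters lie in levels of arbitrarily large index, so a
    tail of the series suffices. *)
Lemma exceptional_null_half_disc Rr eta b t : 0 < Rr -> Rr ^+ 2 < 1/2 -> 0 < eta -> eta <= 1 ->
  ln 2 / - ln Rr < t ->
  null_set t [set l | half_disc Rr eta b l /\ packing_measure (sdim l) (Aset l) = 0%E].
Proof.
move=> Rr0 Rrh eta0 eta1 ht e e0; have k0 := kappa_gt0 _ eta0.
have Rr1 : Rr < 71/100 by apply: sqr_lt_half => //; exact: ltW.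
have lnR : ln Rr < 0 by apply: ln_lt0; rewrite Rr0; lra.
have ln2 : 0 < ln (2 : R) by rewrite ln_gt0// ltr1n.
have t0 : 0 < t by apply: lt_trans ht; rewrite divr_gt0// oppr_gt0.
have Rt : 2 * Rr `^ t < 1.
  rewrite -ltr_pdivlMl// mulr1 /powR gt_eqF//.
  have -> : (2 : R)^-1 = expR (- ln 2) by rewrite expRN lnK// posrE.
  by rewrite ltr_expR; move: ht; rewrite ltr_pdivrMr ?oppr_gt0//; lra.
have Rt0 : 0 < Rr `^ t by rewrite powR_gt0.
(* The midpoint of 2 Rr^t and 1; both [q < 1] and [g < 1] follow. *)
pose q := (1 + 2 * Rr `^ t) / 2.
have q0 : 0 < q by rewrite /q; lra.
have q1 : q < 1 by rewrite /q; lra.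
pose g := 2 / q * Rr `^ t.
have g0 : 0 <= g by rewrite ltW// mulr_gt0// divr_gt0.
have g1 : g < 1 by rewrite /g mulrAC ltr_pdivrMr// mul1r /q; lra.
pose c := (12 / kappa eta * Rr) `^ t.
have c0 : 0 < c by rewrite powR_gt0// mulr_gt0// divr_gt0.
have lev n : (2 / q) ^+ n * (12 / kappa eta * Rr ^+ n.+1) `^ t = c * g ^+ n.
  have -> : 12 / kappa eta * Rr ^+ n.+1 = (12 / kappa eta * Rr) * Rr ^+ n.
    by rewrite exprS mulrA.
  rewrite powRM ?exprn_ge0 ?(ltW Rr0)//; last by rewrite ltW// mulr_gt0// divr_gt0.
  rewrite -/c -[Rr ^+ n]powR_mulrn ?(ltW Rr0)// -powRrM [n%:R * t]mulrC powRrM.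
  by rewrite powR_mulrn ?(ltW Rt0)// /g [(2 / q * _) ^+ n]exprMn; ring.
have d0 : 0 < 1 - g by rewrite subr_gt0.
have [m hm] := geometric_small g (e * (1 - g) / c) g0 g1 ltac:(by rewrite !mulr_gt0// invr_gt0).
apply: (@ball_cover_sub _ _ _ _ (\bigcup_k large_level Rr eta b q (m + k))).
  move=> l [Jl P0]; have [lR il] := Jl.
  have l0 : l != 0.
    by apply/eqP => E; move: il; rewrite E /= mulr0; lra.
  have [n mn hn] := cross_pairs_large l q m l0 ltac:(lra) q0 q1 P0.
  by exists (n - m)%N => //; rewrite subnKC.
apply: (@ball_cover_bigcup _ _ _ _ (fun k => c * g ^+ m * g ^+ k)).
  by move=> k; rewrite -mulrA -exprD -lev; apply: large_level_cover.
apply: le_trans (geometric_nneseries_le _ _ _ g0 g1) _.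
  by rewrite mulr_ge0 ?exprn_ge0// ltW.
rewrite lee_fin ler_pdivrMr// mulrC -ler_pdivlMr//.
exact/ltW/hm.
Qed.

(** For [Rr <= 1/2] the set is empty, because [Mset] lies outside the disc of radius 1/2. Otherwise
    [t > 1], so the real axis is null and countably many half discs cover the rest. *)
Lemma exceptional_null Rr t : 0 < Rr -> Rr < 1 / Num.sqrt 2 -> ln 2 / - ln Rr < t ->
  null_set t [set l | Mset l /\ cnorm l < Rr /\ packing_measure (sdim l) (Aset l) = 0%E].
Proof.
move=> Rr0; rewrite lt_invsqrt2 ?(ltW Rr0)// => Rrh ht.
have Rr1 : Rr < 71/100 by apply: sqr_lt_half => //; exact: ltW.
have lnR : ln Rr < 0 by apply: ln_lt0; rewrite Rr0; lra.
have ln2 : 0 < ln (2 : R) by rewrite ln_gt0// ltr1n.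
have t0 : 0 < t by apply: lt_trans ht; rewrite divr_gt0// oppr_gt0.
have [small|big] := leP Rr (1/2).
  move=> e e0; apply: ball_cover_le (ltW e0) (ball_cover_sub _ _ _ _ _ (ball_cover0 _ t0)).
  by move=> l [/Mset_norm_ge h [h2 _]]; lra.
have t1 : 1 < t.
  apply: lt_trans ht; rewrite ltr_pdivlMr ?oppr_gt0// mul1r.
  rewrite ltrNl -lnV ?posrE// ltr_ln ?posrE ?invr_gt0//.
  by rewrite div1r in big.
apply: (@null_setS _ _ _ ([set z | z.2 = 0 /\ cnorm z <= 1] `|`
  \bigcup_m ([set l | half_disc Rr m.+1%:R^-1 true l /\ packing_measure (sdim l) (Aset l) = 0%E] `|`
   [set l | half_disc Rr m.+1%:R^-1 false l /\ packing_measure (sdim l) (Aset l) = 0%E]))).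
  move=> l [hM [lR P0]]; have [im0|im0] := eqVneq l.2 0; [by left; split => //; lra|right].
  pose m := Num.truncn `|l.2|^-1; exists m => //.
  have hm : m.+1%:R^-1 <= `|l.2|.
    by rewrite invf_ple ?posrE ?normr_gt0// ltW// truncnS_gt.
  have [p|n] := ltP 0 l.2; [left|right]; split => //; split => //=.
    by rewrite mul1r -(gtr0_norm p).
  by rewrite mulN1r -(ler0_norm n).
apply: null_setU; first exact: real_axis_null.
apply: null_set_bigcup => m.
by apply: null_setU; apply: exceptional_null_half_disc;
  rewrite ?invr_gt0 ?invf_le1 ?ltr0n ?ler1n.
Qed.

Lemma exceptional_exponent_lt2 Rr : 0 < Rr -> Rr < 1 / Num.sqrt 2 -> ln 2 / - ln Rr < 2.
Proof.
move=> Rr0; rewrite lt_invsqrt2 ?(ltW Rr0)// => Rrh.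
have Rr1 : Rr < 71/100 by apply: sqr_lt_half => //; exact: ltW.
have lnR : ln Rr < 0 by apply: ln_lt0; rewrite Rr0; lra.
rewrite ltr_pdivrMr ?oppr_gt0//.
have : ln (Rr ^+ 2) < ln (1/2).
  by rewrite ltr_ln ?posrE ?exprn_gt0//; lra.
by rewrite lnXn// div1r lnV ?posrE// mulr2n; lra.
Qed.

Lemma packing_zero_negligible : (@area R).-negligible
  [set l | (@Mset R l /\ cnorm l < 1 / Num.sqrt 2) /\
           ~ (0 < packing_measure (sdim l) (Aset l))%E].
Proof.
apply: null_set_negligible.
(* Radii increasing to 1/sqrt 2; where [Rk k] is not positive the corresponding set is empty. *)
pose Rk k : R := 1 / Num.sqrt 2 - k.+1%:R^-1.
have Rkl k : Rk k < 1 / Num.sqrt 2 by rewrite ltrBlDr ltrDl invr_gt0 ltr0n.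
apply: (@null_setS _ _ _ (\bigcup_k [set l | Mset l /\ cnorm l < Rk k /\
    packing_measure (sdim l) (Aset l) = 0%E])).
  move=> l [[hM hl] nP].
  pose k := Num.truncn (1 / Num.sqrt 2 - cnorm l)^-1; exists k => //; split => //.
  split.
    rewrite /Rk ltrBrDr -ltrBrDl invf_plt ?posrE ?subr_gt0//.
    exact: truncnS_gt.
  apply/eqP; rewrite eq_le packing_measure_ge0 andbT leNgt; exact/negP.
apply: null_set_bigcup => k.
have [Rk0|Rk0] := ltP 0 (Rk k).
  by apply: exceptional_null => //; exact: exceptional_exponent_lt2.
move=> e e0; apply: ball_cover_le (ltW e0) (ball_cover_sub _ _ _ _ _ (ball_cover0 _ _)) => //.
by move=> l [_ [h _]]; have := cnorm_ge0 l; lra.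
Qed.

Lemma exceptional_dim (r Rr : R) : 0 < r -> r < Rr -> Rr < 1 / Num.sqrt 2 ->
  (hausdorff_dim [set l | @Mset R l /\ (r < cnorm l < Rr)%R /\
       packing_measure (sdim l) (Aset l) = 0%E] <= (ln 2 / - ln Rr)%:E)%E.
Proof.
move=> r0 rR hR; have Rr0 : 0 < Rr by exact: lt_trans rR.
have ln2 : 0 < ln (2 : R) by rewrite ln_gt0// ltr1n.
have Rr1 : Rr < 71/100.
  by apply: sqr_lt_half; [exact: ltW|rewrite -lt_invsqrt2// ltW].
have lnR : ln Rr < 0 by apply: ln_lt0; rewrite Rr0; lra.
apply/lee_addgt0Pr => e e0.
set t0 := ln 2 / - ln Rr; have t00 : 0 < t0 by rewrite divr_gt0// oppr_gt0.
apply: ereal_inf_lbound; exists (t0 + e) => //; split; first by rewrite addr_ge0// ltW.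
apply: null_set_hausdorff; first by rewrite addr_gt0.
apply: null_setS (exceptional_null Rr (t0 + e) Rr0 hR _); last by rewrite ltrDl.
by move=> l [hM [/andP[_ h] P0]].
Qed.

End ExceptionalSet.

(** * Equivalence of the law and the packing measure *)

Section EuclideanOpen.
Context {R : realType}.
Local Notation C := (R * R)%type.
Implicit Types (U F : set C).

(** Euclidean openness, phrased with [cball] so that it meets the tail estimates of code points
    directly. *)
Definition dopen U := forall x, U x -> exists2 r : R, 0 < r & cball x r `<=` U.

Definition dclosed F := dopen (~` F).

Lemma dopenT : dopen setT. Proof. by move=> x _; exists 1. Qed.

Lemma dopen_bigcup (U : nat -> set C) : (forall i, dopen (U i)) -> dopen (\bigcup_i U i).
Proof.
by move=> h x [i _ /(h i)[r r0 hr]]; exists r => // y /hr Uy; exists i.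
Qed.

Lemma dclosed_bigsetU (F : nat -> set C) n : (forall i, dclosed (F i)) ->
  dclosed (\big[setU/set0]_(i < n) F i).
Proof.
move=> h; elim/big_rec : _ => [|i A _ hA]; first by rewrite /dclosed setC0; exact: dopenT.
rewrite /dclosed setCU => x [/h[r r0 hr] /hA[r' r'0 hr']].
exists (Num.min r r'); first by rewrite lt_min r0.
by move=> y; rewrite /cball /= le_min => /andP[h1 h2]; split; [apply: hr|apply: hr'].
Qed.

Lemma dopen_lt (g : C -> R) c : (forall x y, `|g x - g y| <= cdist x y) ->
  dopen [set z | g z < c].
Proof.
move=> hg x /= gx; exists ((c - g x) / 2); first by rewrite divr_gt0// subr_gt0.
move=> y; rewrite /cball /= => /(le_trans (hg x y)); rewrite ler_norml => /andP[h1 _].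
lra.
Qed.

Lemma dclosed_le (g : C -> R) c : (forall x y, `|g x - g y| <= cdist x y) ->
  dclosed [set z | g z <= c].
Proof.
move=> hg; rewrite /dclosed (_ : ~` _ = [set z | - g z < - c]); last first.
  by apply/seteqP; split => z /=; rewrite ltrN2 ltNge => /negP.
by apply: dopen_lt => x y; rewrite -opprD normrN; exact: hg.
Qed.

End EuclideanOpen.

(** * The law of the random series *)

Section CodeLaw.
Context {R : realType} {d : measure_display} {Omega : measurableType d}
  {P : probability Omega R} {eps : nat -> Omega -> R} (fair : fair_signs P eps).
Local Notation C := (R * R)%type.
Variable l : C.
Hypotheses (l0 : l != 0) (l1 : cnorm l < 1).
Implicit Types (U F E : set C).

Let D := (1 - cnorm l)^-1.

Let D0 : 0 < D. Proof. by rewrite invr_gt0 subr_gt0. Qed.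

Let p2 n : 0 < (2 : R) ^+ n. Proof. by rewrite exprn_gt0. Qed.

Definition random_point (w : Omega) : C := code_point l (code eps w).

Local Notation X := random_point.

Definition hits F u := `[< exists2 z, F z & cdist (pw u l) z <= D * cnorm l ^+ size u >].

Definition hitting n F := [seq u <- words n | hits F u].

Lemma random_point_tail w n : cdist (pw (mkseq (code eps w) n) l) (X w) <= D * cnorm l ^+ n.
Proof. by rewrite cdistC; exact: code_point_tail. Qed.

(** The exact geometric sum makes the discs of radius D |l|^n about the truncations nested along
    prefixes, as [hits_prefix] needs. *)
Lemma pw_bound_sharp v : cnorm (pw v l) <= D * (1 - cnorm l ^+ size v).
Proof.
have E : D * (1 - cnorm l) = 1 by rewrite mulVf// gt_eqF// subr_gt0.
elim: v => [|b v IH]; first by rewrite /= cnorm0 expr0 subrr mulr0.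
rewrite pw_cons; apply: le_trans (ler_cnormD _ _) _; rewrite cnorm_real cnormM /= exprS.
apply: le_trans (lerD (sg_norm b) (ler_wpM2l (cnorm_ge0 l) IH)) _.
by rewrite -{1}E le_eqVlt; apply/orP; left; apply/eqP; ring.
Qed.

Lemma hits_prefix F u v : hits F (u ++ v) -> hits F u.
Proof.
move=> /asboolP[z Fz h]; apply/asboolP; exists z => //.
apply: le_trans (ler_cdistD (pw (u ++ v) l) _ _) _.
have h1 : cdist (pw u l) (pw (u ++ v) l) <= cnorm l ^+ size u * (D * (1 - cnorm l ^+ size v)).
  rewrite cdistC /cdist pw_cat addrAC subrr add0r cnormM cnorm_cexp.
  by rewrite ler_wpM2l ?exprn_ge0// pw_bound_sharp.
apply: le_trans (lerD h1 h) _; rewrite size_cat exprD.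
by rewrite le_eqVlt; apply/orP; left; apply/eqP; ring.
Qed.

Lemma all_filter_words n (p : pred (seq bool)) :
  all (fun u => size u == n) [seq u <- words n | p u].
Proof. by apply/allP => u; rewrite mem_filter mem_words => /andP[_]. Qed.

Lemma cylinder_filter n (p : pred (seq bool)) w :
  cylinder eps n [seq u <- words n | p u] w <-> p (mkseq (code eps w) n).
Proof. by rewrite /cylinder /= mem_filter mem_words size_mkseq eqxx andbT. Qed.

Lemma measurable_cylinder_filter n (p : pred (seq bool)) :
  measurable (cylinder eps n [seq u <- words n | p u]).
Proof. by apply: (measurable_cylinder fair); exact: all_filter_words. Qed.

Lemma prob_cylinder_filter n (p : pred (seq bool)) :
  P (cylinder eps n [seq u <- words n | p u]) = ((size [seq u <- words n | p u])%:R * 2 ^- n)%:E.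
Proof.
by apply: (cylinder_prob fair); [rewrite filter_uniq// uniq_words|exact: all_filter_words].
Qed.

(** The discs about the truncations shrink to the random point, so a closed set meeting all of them
    contains it. This gives measurability, and probabilities as limits of word counts. *)
Lemma preimage_dclosed F : dclosed F -> X @^-1` F = \bigcap_n cylinder eps n (hitting n F).
Proof.
move=> cF; apply/seteqP; split => w.
  move=> Fw n _; apply/cylinder_filter/asboolP; exists (X w) => //.
  by rewrite size_mkseq; exact: random_point_tail.
move=> h; apply: contrapT => /cF[r r0 hr].
have [n hn] := geometric_small (cnorm l) (r / (2 * D)) (cnorm_ge0 l) l1
  ltac:(by rewrite divr_gt0// mulr_gt0).
have /cylinder_filter/asboolP[z Fz hz] := h n I.
apply: (hr z) => //; rewrite /cball /=; apply: le_trans (ler_cdistD _ _ _) _; last first.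
  rewrite cdistC; apply: le_trans (lerD (random_point_tail w n) hz) _.
  rewrite size_mkseq; have := ltW (hn n (leqnn n)); rewrite ler_pdivlMr ?mulr_gt0//.
  by move: (_ ^+ n) => x; lra.
Qed.

Lemma measurable_preimage_dclosed F : dclosed F -> measurable (X @^-1` F).
Proof.
move=> cF; rewrite preimage_dclosed//; apply: bigcapT_measurable => n.
exact: measurable_cylinder_filter.
Qed.

Lemma measurable_preimage_dopen U : dopen U -> measurable (X @^-1` U).
Proof.
move=> oU; rewrite (_ : X @^-1` U = ~` (X @^-1` (~` U))); last by rewrite -preimage_setC setCK.
by apply: measurableC; apply: measurable_preimage_dclosed; rewrite /dclosed setCK.
Qed.

Lemma measurable_preimage_diff U F : dopen U -> dclosed F -> measurable (X @^-1` (U `\` F)).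
Proof.
move=> oU cF.
exact: measurableD (measurable_preimage_dopen U oU) (measurable_preimage_dclosed F cF).
Qed.

Lemma prob_setU_le (A B : set Omega) : measurable A -> measurable B ->
  (P (A `|` B) <= P A + P B)%E.
Proof. exact: measureU2. Qed.

Lemma prob_dclosed_le F n : dclosed F ->
  (P (X @^-1` F) <= ((size (hitting n F))%:R * 2 ^- n)%:E)%E.
Proof.
move=> cF; rewrite -prob_cylinder_filter; apply: le_measure; rewrite ?inE.
- exact: measurable_preimage_dclosed.
- exact: measurable_cylinder_filter.
- by rewrite preimage_dclosed//; exact: bigcap_inf.
Qed.

Lemma prob_dclosed_ge F (c : R) : dclosed F ->
  (forall n, c <= (size (hitting n F))%:R * 2 ^- n) -> (c%:E <= P (X @^-1` F))%E.
Proof.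
move=> cF h; rewrite preimage_dclosed//.
have mc n : measurable (cylinder eps n (hitting n F)) by exact: measurable_cylinder_filter.
have cv := @nonincreasing_cvg_mu _ _ _ P (fun n => cylinder eps n (hitting n F))
  ltac:(by apply: le_lt_trans (probability_le1 P _) (ltry _)) mc
  (bigcapT_measurable mc)
  ltac:(move=> m n mn; apply/subsetPset => w /cylinder_filter hw; apply/cylinder_filter;
    by move: hw; rewrite -(subnKC mn) mkseqD => /hits_prefix).
rewrite -(cvg_lim _ cv)//; apply: lime_ge; first by apply/cvg_ex; eexists; exact: cv.
apply: nearW => n; rewrite /= prob_cylinder_filter lee_fin; exact: h.
Qed.

Lemma measure_decreasing_small (G : nat -> set Omega) (e : R) : 0 < e ->
  (forall n, measurable (G n)) -> (forall n, G n.+1 `<=` G n) -> \bigcap_n G n = set0 ->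
  exists n, (P (G n) <= e%:E)%E.
Proof.
move=> e0 mG ni G0; apply: contrapT => H.
have cv := @nonincreasing_cvg_mu _ _ _ P G
  ltac:(by apply: le_lt_trans (probability_le1 P _) (ltry _)) mG
  (bigcapT_measurable mG)
  ltac:(by apply/nonincreasing_seqP => n; apply/subsetPset; exact: ni).
have : (e%:E <= P (\bigcap_n G n))%E.
  rewrite -(cvg_lim _ cv)//; apply: lime_ge; first by apply/cvg_ex; eexists; exact: cv.
  apply: nearW => n /=; rewrite leNgt; apply/negP => /ltW h.
  by apply: H; exists n.
by rewrite G0 measure0 lee_fin leNgt e0.
Qed.

(** Inner and outer regularity of the law of the random point, kept together with measurability of
    the preimage so that both pass to the generated sigma-algebra at once. *)
Definition regular_set E := measurable (X @^-1` E) /\ forall e : R, 0 < e ->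
  exists F U, [/\ dclosed F, dopen U, F `<=` E, E `<=` U & (P (X @^-1` (U `\` F)) <= e%:E)%E].

Lemma regular_setC E : regular_set E -> regular_set (~` E).
Proof.
move=> [mE rE]; split; first by rewrite preimage_setC; exact: measurableC.
move=> e /rE[F [U [cF oU FE EU h]]]; exists (~` U), (~` F); split.
- by rewrite /dclosed setCK.
- exact: cF.
- by move=> x nU Ex; apply: nU; exact: EU.
- by move=> x nE Fx; apply: nE; exact: FE.
- by rewrite setDE setCK setIC -setDE.
Qed.

Lemma regular_set_bigcup (E : nat -> set C) :
  (forall i, regular_set (E i)) -> regular_set (\bigcup_i E i).
Proof.
move=> h; split.
  by rewrite preimage_bigcup; apply: bigcupT_measurable => i; have [] := h i.
move=> e e0; have e20 : 0 < e / 2 by rewrite divr_gt0.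
have /choice[F /choice[U FU]] : forall i, exists F U, [/\ dclosed F, dopen U, F `<=` E i,
    E i `<=` U & (P (X @^-1` (U `\` F)) <= (e / 2 / (2 ^ i.+1)%:R)%:E)%E].
  by move=> i; have [_ r] := h i; apply: r; rewrite divr_gt0// ltr0n expn_gt0.
have cF i : dclosed (F i) by have [] := FU i.
have oU i : dopen (U i) by have [_] := FU i.
have mF i := measurable_preimage_dclosed _ (cF i).
have mU i := measurable_preimage_dopen _ (oU i).
have mB n : measurable (X @^-1` (\big[setU/set0]_(i < n) F i)).
  by apply: measurable_preimage_dclosed; exact: dclosed_bigsetU.
have mUF : measurable (X @^-1` \bigcup_i F i).
  by rewrite preimage_bigcup; exact: bigcupT_measurable.
(* An infinite union of closed sets need not be closed; a finite part of it is kept at the cost of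
   [e / 2]. *)
have [n hn] : exists n, (P (X @^-1` (\bigcup_i F i) `\` X @^-1` (\big[setU/set0]_(i < n) F i)) <=
    (e / 2)%:E)%E.
  apply: measure_decreasing_small => //.
  - by move=> n; apply: measurableD.
  - move=> n w [h1 h2]; split => // h3; apply: h2.
    by rewrite /preimage /= big_ord_recr; left.
  - apply/seteqP; split => // w H; have [[i _ Fw] _] := H 0%N I.
    have [_] := H i.+1 I; apply.
    by rewrite /preimage /= big_ord_recr; right.
exists (\big[setU/set0]_(i < n) F i), (\bigcup_i U i); split.
- exact: dclosed_bigsetU.
- exact: dopen_bigcup.
- move=> x; rewrite -bigcup_mkord => -[i _ Fx]; exists i => //.
  by have [_ _ FE _ _] := FU i; exact: FE.
- move=> x [i _ Ex]; exists i => //.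
  by have [_ _ _ EU _] := FU i; exact: EU.
set S := \bigcup_i (X @^-1` (U i `\` F i)).
have mUFi i : measurable (X @^-1` (U i `\` F i)) by exact: measurable_preimage_diff.
have mS : measurable S by apply: bigcupT_measurable.
apply: (@le_trans _ _ (P (S `|`
    (X @^-1` (\bigcup_i F i) `\` X @^-1` (\big[setU/set0]_(i < n) F i))))).
  apply: le_measure; rewrite ?inE.
  - by apply: measurable_preimage_diff; [exact: dopen_bigcup|exact: dclosed_bigsetU].
  - by apply: measurableU => //; exact: measurableD.
  move=> w [[i _ Uw] nF]; have [Fw|nFw] := pselect (F i (X w)).
    by right; split => //; exists i.
  by left; exists i.
apply: le_trans (prob_setU_le _ _ _ _) _ => //; first exact: measurableD.
rewrite (splitr e) EFinD; apply: leeD => //.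
apply: le_trans (measure_sigma_subadditive P mUFi mS (fun x => id)) _.
apply: le_trans (epsilon_trick0 xpredT (ltW e20)).
by apply: lee_nneseries => // i _; have [] := FU i.
Qed.

Lemma regular_set0 : regular_set set0.
Proof.
split; first by rewrite preimage_set0.
move=> e e0; exists set0, set0; split => //; first by rewrite /dclosed setC0; exact: dopenT.
by rewrite setD0 preimage_set0 measure0 lee_fin ltW.
Qed.

Lemma sigma_algebra_regular : sigma_algebra setT regular_set.
Proof.
split; first exact: regular_set0.
- by move=> A /regular_setC; rewrite setTD.
- by move=> A; exact: regular_set_bigcup.
Qed.

Lemma regular_setD E F : regular_set E -> regular_set F -> regular_set (E `\` F).
Proof.
move=> rE rF; rewrite -[E `\` F]setCK setDE setCI setCK.
apply: regular_setC; rewrite -bigcup2E; apply: regular_set_bigcup.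
by move=> [|[|i]] //=; [exact: regular_setC|exact: regular_set0].
Qed.

Lemma regular_ray (g : C -> R) c : (forall x y, `|g x - g y| <= cdist x y) ->
  regular_set [set z | g z <= c].
Proof.
move=> hg; pose F := [set z | g z <= c]; have cF : dclosed F by exact: dclosed_le.
split; first exact: measurable_preimage_dclosed.
move=> e e0; pose U n := [set z | g z < c + n.+1%:R^-1].
have oU n : dopen (U n) by exact: dopen_lt.
have [n hn] : exists n, (P (X @^-1` (U n `\` F)) <= e%:E)%E.
  apply: measure_decreasing_small => //.
  - by move=> n; exact: measurable_preimage_diff.
  - move=> n w [h1 h2]; split => //; apply: lt_le_trans h1 _.
    by rewrite lerD2l lef_pV2 ?posrE// ler_nat.
  - apply/seteqP; split => // w H; have [_ /= /negP] := H 0%N I.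
    rewrite -ltNge -subr_gt0 => gw.
    have [h _] := H (Num.truncn (g (X w) - c)^-1) I; move: h; rewrite /U /= -ltrBlDl.
    by rewrite ltNge => /negP; apply; rewrite invf_ple ?posrE// ltW// truncnS_gt.
exists F, (U n); split => // z /= h.
by apply: le_lt_trans h _; rewrite ltrDl invr_gt0.
Qed.

(** The Borel sets are generated by coordinate preimages of half-open intervals, differences of
    sublevel sets of 1-Lipschitz functions; those are regular by [regular_ray]. *)
Lemma measurable_regular (E : set (measurableTypeR R * measurableTypeR R)%type) :
  measurable E -> regular_set E.
Proof.
have coord (g : C -> R) (A : set (measurableTypeR R)) :
    (forall x y, `|g x - g y| <= cdist x y) -> measurable A -> regular_set (setT `&` g @^-1` A).
  move=> hg; rewrite setTI; move: A; apply: smallest_sub.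
    split.
    - by rewrite preimage_set0; exact: regular_set0.
    - by move=> A /regular_setC; rewrite setTD preimage_setC.
    - by move=> A hA; rewrite preimage_bigcup; exact: regular_set_bigcup.
  move=> _ [[a b] _ <-] /=.
  rewrite (_ : g @^-1` _ = [set z | g z <= b] `\` [set z | g z <= a]).
    by apply: regular_setD; exact: regular_ray.
  apply/seteqP; split => z /=; rewrite in_itv /=.
    by move=> /andP[h1 h2]; split => //; apply/negP; rewrite -ltNge.
  by move=> [h1 /negP]; rewrite -ltNge => h2; apply/andP.
move: E; apply: smallest_sub; first exact: sigma_algebra_regular.
move=> _ [[A mA <-]|[A mA <-]]; apply: (coord _ A) => // x y.
- exact: cnorm_re (x - y).
- exact: cnorm_im (x - y).
Qed.

Definition inside U u := `[< cball (pw u l) (D * cnorm l ^+ size u) `<=` U >].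

(** Minimality makes these words pairwise incomparable, so their cylinders partition the preimage of
    an open set. *)
Definition first_inside U u := inside U u && all (fun k => ~~ inside U (take k u)) (iota 0 (size u)).

Lemma first_inside_exists U om : dopen U -> U (code_point l om) ->
  exists n, first_inside U (mkseq om n).
Proof.
move=> oU /oU[r r0 hr].
have ex : exists n, inside U (mkseq om n).
  have [n hn] := geometric_small (cnorm l) (r / (2 * D)) (cnorm_ge0 l) l1
    ltac:(by rewrite divr_gt0// mulr_gt0).
  exists n; apply/asboolP => y hy; apply: hr; rewrite /cball /= in hy *.
  apply: le_trans (ler_cdistD _ _ _) (le_trans (lerD (code_point_tail l om n l1) hy) _).
  rewrite size_mkseq; have := ltW (hn n (leqnn n)); rewrite ler_pdivlMr ?mulr_gt0//.
  by rewrite -/D; move: (_ ^+ n) => x; lra.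
case: (ex_minnP ex) => n hn hmin; exists n; rewrite /first_inside hn /=.
apply/allP => k; rewrite mem_iota add0n size_mkseq /= => kn; apply/negP => hk.
have : (n <= k)%N; last by rewrite leqNgt kn.
apply: hmin; move: hk; rewrite -(subnKC (ltnW kn)) mkseqD take_size_cat//.
by rewrite size_mkseq.
Qed.

Lemma packing_null_of_open_null F : F `<=` Aset l ->
  (forall e : R, 0 < e -> exists U, [/\ dopen U, F `<=` U & (P (X @^-1` U) <= e%:E)%E]) ->
  packing_measure (sdim l) F = 0%E.
Proof.
move=> FA hF; apply/eqP; rewrite eq_le packing_measure_ge0 andbT.
apply/lee_addgt0Pr => e e0; rewrite add0e.
have [K K0 gK] := good_scale_exists l l0 l1.
have [U [oU FU PU]] := hF (e / K) ltac:(by rewrite divr_gt0).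
pose W m := [seq u <- words m | first_inside U u].
pose G m := [set z | F z /\ exists2 om, code_point l om = z & mkseq om m \in W m].
have mW m : measurable (cylinder eps m (W m)) by exact: measurable_cylinder_filter.
have tW : trivIset setT (fun m => cylinder eps m (W m)).
  have lt m n w : (m < n)%N -> cylinder eps m (W m) w -> cylinder eps n (W n) w -> False.
    move=> mn /cylinder_filter/andP[h1 _] /cylinder_filter/andP[_ /allP h2].
    have := h2 m; rewrite mem_iota add0n size_mkseq /= => /(_ mn).
    by rewrite -(subnKC (ltnW mn)) mkseqD take_size_cat ?size_mkseq// h1.
  move=> m n _ _ [w [h1 h2]]; case: (ltngtP m n) => // h.
    by case: (lt m n w h h1 h2).
  by case: (lt n m w h h2 h1).
have sW : (\sum_(m <oo) P (cylinder eps m (W m)) <= (e / K)%:E)%E.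
  apply: le_trans PU.
  rewrite -(@eq_eseriesl _ [pred i | i \in setT] xpredT); last by move=> i; exact: in_setT.
  rewrite -(measure_bigcup P setT _ (fun m _ => mW m) tW).
  apply: le_measure; rewrite ?inE; [exact: bigcupT_measurable|exact: measurable_preimage_dopen|].
  move=> w [m _ /cylinder_filter/andP[/asboolP h _]]; apply: h.
  by rewrite /cball /= size_mkseq; exact: random_point_tail.
apply: (@le_trans _ _ (\sum_(m <oo) packing_premeasure (sdim l) (G m))%E).
  apply: packing_measure_le => z Fz; have := FA z Fz; rewrite AsetE// => -[om _ omz].
  have [n hn] := first_inside_exists U om oU ltac:(by rewrite omz; exact: FU).
  exists n => //; split => //; exists om => //.
  by rewrite mem_filter hn mem_words size_mkseq eqxx.
apply: (@le_trans _ _ (\sum_(m <oo) (K%:E * P (cylinder eps m (W m))))%E).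
  apply: lee_nneseries => m _; first by move=> _; exact: packing_premeasure_ge0.
  rewrite prob_cylinder_filter -EFinM; have [dd dd0 gs] := gK m.
  apply: (packing_premeasure_cylinders l K m dd) => //; first exact: ltW.
    exact: all_filter_words.
  by move=> z [_].
rewrite nneseriesZl//; apply: (@le_trans _ _ (K%:E * (e / K)%:E)%E).
  by rewrite lee_pmul2l// lte_fin.
by rewrite -EFinM mulrCA divff ?mulr1// gt_eqF.
Qed.

Lemma packing_null_of_law_null (E : set (measurableTypeR R * measurableTypeR R)%type) :
  measurable E -> P (X @^-1` E) = 0%E -> packing_measure (sdim l) (Aset l `&` E) = 0%E.
Proof.
move=> /measurable_regular[mE rE] PE; apply: packing_null_of_open_null; first by move=> z [].
move=> e e0; have [F [U [cF oU FE EU h]]] := rE e e0; exists U; split => //.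
  by move=> z [_ /EU].
apply: (@le_trans _ _ (P (X @^-1` E `|` X @^-1` (U `\` F)))).
  have mU := measurable_preimage_dopen _ oU.
  have mUF : measurable (X @^-1` (U `\` F)).
    by exact: measurable_preimage_diff.
  apply: le_measure; rewrite ?inE//; first exact: measurableU.
  move=> w Uw; have [Fw|nFw] := pselect (F (X w)); [left; exact: FE|by right].
apply: le_trans (prob_setU_le _ _ mE (measurable_preimage_diff _ _ oU cF)) _.
by rewrite PE add0e.
Qed.

Lemma count_wordsD m n (p : pred (seq bool)) :
  count p (words (m + n)) = (\sum_(u <- words m) count (fun v => p (u ++ v)) (words n))%N.
Proof.
have S k (q : pred (seq bool)) : count q (words k.+1) =
    (count (fun v => q (true :: v)) (words k) + count (fun v => q (false :: v)) (words k))%N.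
  by rewrite (permP (perm_wordsS k)) count_cat !count_map.
elim: m p => [|m IH] p.
  have E : perm_eq (words 0) [:: [::]].
    apply: uniq_perm => //; first exact: uniq_words.
    by move=> u; rewrite mem_words inE size_eq0.
  by rewrite (perm_big _ E) big_seq1.
have M b (F : seq bool -> nat) :
    (\sum_(u <- [seq b :: w | w <- words m]) F u = \sum_(w <- words m) F (b :: w))%N.
  exact: big_map.
by rewrite addSn S !IH (perm_big _ (perm_wordsS m)) big_cat /= !M.
Qed.

Lemma hits_sim F u v : hits F (u ++ v) -> hits (sim u l @^-1` F) v.
Proof.
move=> /asboolP[z Fz h]; apply/asboolP.
have e0 : cexp l (size u) != 0.
  by apply/eqP => e; have := exprn_gt0 (size u) (cnorm_gt0 _ l0); rewrite -cnorm_cexp e cnorm0 ltxx.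
pose z' := cmul (cinv (cexp l (size u))) (z - pw u l).
have zE : sim u l z' = z by rewrite /sim /z' cmulA cmulV// cmul1 addrC subrK.
exists z'; first by rewrite /preimage /= zE.
move: h; rewrite -zE pw_cat -/(sim u l (pw v l)) sim_cdist size_cat exprD mulrCA.
by rewrite ler_pM2l// exprn_gt0// cnorm_gt0.
Qed.

Lemma size_hitting_decr F m n : (m <= n)%N ->
  (size (hitting n F))%:R * 2 ^- n <= (size (hitting m F))%:R * 2 ^- m :> R.
Proof.
move=> mn; rewrite -(subnKC mn); set k := (n - m)%N.
have h : (size (hitting (m + k) F) <= size (hitting m F) * 2 ^ k)%N.
  rewrite !size_filter count_wordsD.
  apply: (@leq_trans (\sum_(u <- words m | hits F u) 2 ^ k)).
    rewrite [leqRHS]big_mkcond; apply: leq_sum => u _; case: ifPn => hu.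
      by rewrite -(size_words k) count_size.
    rewrite leqNgt -has_count; apply/hasPn => v _.
    by apply: contra hu; exact: hits_prefix.
  by rewrite big_const_seq iter_addn_0 mulnC.
have p := p2 k; rewrite exprD invfM mulrA ler_pdivrMr//.
rewrite [leRHS]mulrAC ler_wpM2r ?invr_ge0 ?(ltW (p2 m))//.
by rewrite -natrX -natrM ler_nat.
Qed.

(* Zooming into a word along which a closed set of positive probability is hit too
   often makes its preimage almost full. *)
Lemma almost_full_word F (c : R) : dclosed F -> (0 < P (X @^-1` F))%E -> 0 < c -> c < 1 ->
  exists u, forall m, c <= (size (hitting m (sim u l @^-1` F)))%:R * 2 ^- m.
Proof.
move=> cF PF c0 c1; have finP : P (X @^-1` F) \is a fin_num.
  by apply: fin_num_measure; exact: measurable_preimage_dclosed.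
pose s := fine (P (X @^-1` F)); have sE : P (X @^-1` F) = s%:E by rewrite fineK.
have s0 : 0 < s by rewrite -lte_fin -sE.
apply: contrapT => H.
have /choice[m hm] : forall u, exists m, (size (hitting m (sim u l @^-1` F)))%:R * 2 ^- m < c.
  move=> u; apply: contrapT => Hu; apply: H; exists u => m.
  by rewrite leNgt; apply/negP => h; apply: Hu; exists m.
(* The hitting fractions decrease to the probability [s], which is below [s / c]. *)
have [n hn] : exists n, (size (hitting n F))%:R * 2 ^- n < s / c.
  apply: contrapT => Hn; have : ((s / c)%:E <= P (X @^-1` F))%E.
    apply: prob_dclosed_ge => // n; rewrite leNgt; apply/negP => h.
    by apply: Hn; exists n.
  rewrite sE lee_fin ler_pdivrMr// leNgt => /negP; apply.
  by rewrite gtr_pMr.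
(* Hitting fractions decrease with the level, so one [M] serves all words of length [n]. At level
   [n + M] the fraction would fall below [s]. *)
pose M := \max_(u <- words n) m u.
have hM u : u \in words n -> (size (hitting M (sim u l @^-1` F)))%:R <= c * 2 ^+ M.
  move=> uw; rewrite -ler_pdivrMr//.
  apply: le_trans (size_hitting_decr (sim u l @^-1` F) (m u) M _) (ltW (hm u)).
  by rewrite /M (leq_bigmax_seq _ uw).
have : s * 2 ^+ (n + M) <= (size (hitting (n + M) F))%:R.
  by have := prob_dclosed_le F (n + M) cF; rewrite sE lee_fin ler_pdivlMr.
have : (size (hitting (n + M) F))%:R <= (size (hitting n F))%:R * (c * 2 ^+ M).
  rewrite !size_filter count_wordsD natr_sum.
  apply: (@le_trans _ _ (\sum_(u <- words n | hits F u) c * 2 ^+ M)).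
    rewrite [leRHS]big_mkcond big_seq [leRHS]big_seq; apply: ler_sum => u uw.
    case: ifPn => hu; last first.
      rewrite (_ : count _ _ = 0%N)//; apply/eqP; rewrite -leqn0 leqNgt -has_count.
      by apply/hasPn => v _; apply: contra hu; exact: hits_prefix.
    apply: le_trans (hM u uw); rewrite ler_nat size_filter; apply: sub_count => v.
    exact: hits_sim.
  by rewrite big_const_seq iter_addr addr0 mulr_natl.
move=> h1 h2; have := le_trans h2 h1; rewrite leNgt => /negP; apply.
move: hn; rewrite ltr_pdivrMr// => hn.
have p := p2 M; rewrite exprD mulrA [ltRHS]mulrA ltr_pM2r//.
have := ltr_pM2r c0 (size (hitting n F))%:R (s / c * 2 ^+ n); rewrite hn => h.
have : (size (hitting n F))%:R * c < s / c * 2 ^+ n * c by rewrite h.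
by rewrite mulrAC divfK// gt_eqF.
Qed.

Lemma sim_Aset u z : Aset l z -> Aset l (sim u l z).
Proof.
rewrite AsetE// => -[om _ <-].
exists (fun i => if (i < size u)%N then nth false u i else om (i - size u)%N) => //.
rewrite (code_point_shift _ _ (size u))//; congr (_ + cmul _ _).
  congr pw; apply: (@eq_from_nth _ false); rewrite size_mkseq// => i iu.
  by rewrite nth_mkseq// iu.
by congr code_point; apply/funext => i; rewrite ltnNge leq_addr /= addKn.
Qed.

Lemma dclosed_sim u F : dclosed F -> dclosed (sim u l @^-1` F).
Proof.
move=> cF x /(cF (sim u l x))[r r0 hr].
have q0 : 0 < cnorm l ^+ size u by rewrite exprn_gt0// cnorm_gt0.
exists (r / cnorm l ^+ size u); first by rewrite divr_gt0.
move=> y; rewrite /cball /= => h; apply: hr; rewrite /cball /= sim_cdist.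
by rewrite mulrC -ler_pdivlMr.
Qed.

Lemma law_null_of_packing_null (E : set (measurableTypeR R * measurableTypeR R)%type) :
  (0 < packing_measure (sdim l) (Aset l))%E -> measurable E ->
  packing_measure (sdim l) (Aset l `&` E) = 0%E -> P (X @^-1` E) = 0%E.
Proof.
move=> PA /measurable_regular[mE rE] P0; apply/eqP; rewrite eq_le measure_ge0 andbT leNgt.
apply/negP => PE.
have finE : P (X @^-1` E) \is a fin_num by exact: fin_num_measure.
pose p := fine (P (X @^-1` E)); have pE : P (X @^-1` E) = p%:E by rewrite fineK.
have p0 : 0 < p by rewrite -lte_fin -pE.
have [F [U [cF oU FE EU h]]] := rE (p / 2) ltac:(by rewrite divr_gt0).
have mF := measurable_preimage_dclosed _ cF.
have mUF : measurable (X @^-1` (U `\` F)).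
  by exact: measurable_preimage_diff.
have PF : (0 < P (X @^-1` F))%E.
  rewrite lt_neqAle measure_ge0 andbT; apply/eqP => /esym F0.
  have : (P (X @^-1` E) <= P (X @^-1` F `|` X @^-1` (U `\` F)))%E.
    apply: le_measure; rewrite ?inE//; first exact: measurableU.
    by move=> w Ew; have [Fw|nFw] := pselect (F (X w)); [left|right; split => //; exact: EU].
  move=> /le_trans/(_ (prob_setU_le _ _ mF mUF)); rewrite F0 add0e => /le_trans/(_ h).
  by rewrite pE lee_fin; lra.
(* The shift by 2 keeps [c 0] positive. *)
pose c k : R := 1 - k.+2%:R^-1.
have /choice[u hu] : forall k, exists u, forall m,
    c k <= (size (hitting m (sim u l @^-1` F)))%:R * 2 ^- m.
  move=> k; apply: almost_full_word => //.
    by rewrite /c subr_gt0 invf_lt1 ?ltr0n// ltr1n.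
  by rewrite /c ltrBlDr ltrDl invr_gt0 ltr0n.
pose V k := sim (u k) l @^-1` F.
have cV k : dclosed (V k) by exact: dclosed_sim.
have N1 : packing_measure (sdim l) (Aset l `&` ~` \bigcup_k V k) = 0%E.
  apply: packing_null_of_open_null; first by move=> z [].
  move=> e e0; pose k := Num.truncn e^-1; exists (~` V k); split.
  - exact: cV.
  - by move=> z [_ nV] Vk; apply: nV; exists k.
  have mV : measurable (X @^-1` V k) by exact: measurable_preimage_dclosed.
  rewrite (_ : X @^-1` (~` V k) = ~` (X @^-1` V k))// (probability_setC _ mV).
  have : ((c k)%:E <= P (X @^-1` V k))%E by exact: prob_dclosed_ge.
  have fV : P (X @^-1` V k) \is a fin_num.
    by apply: fin_num_measure; exact: measurable_preimage_dclosed.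
  rewrite -(fineK fV) -EFinB !lee_fin /c => hc.
  apply: (@le_trans _ _ (k.+2%:R^-1)); first by rewrite lerBlDl -lerBlDr; exact: hc.
  rewrite invf_ple ?posrE ?ltr0n//; apply/ltW/(lt_trans (truncnS_gt _)).
  by rewrite ltr_nat.
(* The similarity along [u k] maps this part of the attractor into [Aset l]&[E]. *)
have N2 k : packing_measure (sdim l) (Aset l `&` V k) = 0%E.
  apply/eqP; rewrite eq_le packing_measure_ge0 andbT.
  rewrite -(packing_null_sim l (u k) (sdim l) _ l0 P0); apply: packing_measureS.
  by move=> z [Az Vz]; split; [exact: sim_Aset|exact: FE].
move: PA; rewrite ltNge => /negP; apply.
have N : packing_measure (sdim l)
    (\bigcup_k (if k is j.+1 then Aset l `&` V j else Aset l `&` ~` \bigcup_k V k)) = 0%E.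
  by apply: packing_null_bigcup => -[|k].
rewrite -N; apply: packing_measureS => z Az.
have [[k _ Vz]|nV] := pselect ((\bigcup_k V k) z); first by exists k.+1.
by exists 0%N.
Qed.

End CodeLaw.

(** * Equivalence of the two measures and assembly *)

Section Equivalence.
Context {R : realType}.
Local Notation C := (R * R)%type.

Lemma nu_equiv_of_packing_positive (l : C) : l != 0 -> cnorm l < 1 ->
  (0 < packing_measure (sdim l) (Aset l))%E -> nu_equiv_packing l.
Proof.
move=> l0 l1 PA d Omega P eps fair E mE.
have -> : [set w | exists z, E z /\ psum (fun n => eps n w) l N @[N --> \oo] --> z] =
    random_point (eps := eps) l @^-1` E.
  have sgE w : (fun n => eps n w) = sg \o code eps w.
    by apply/funext => n; rewrite /= -(eps_sg fair).
  apply/seteqP; split => w /=.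
    move=> [z [Ez]]; rewrite sgE => hz; rewrite /random_point.
    by rewrite (psum_lim_unique _ _ _ _ (code_point_cvg _ (code eps w) l1) hz).
  by move=> Ew; exists (random_point (eps := eps) l w); split => //; rewrite sgE; exact: code_point_cvg.
split; first exact: (packing_null_of_law_null fair).
exact: (law_null_of_packing_null fair).
Qed.

End Equivalence.

Theorem mainTheorem15 (R : realType) :
  (* (i) *)
  (@area R).-negligible
    [set l | (@Mset R l /\ cnorm l < 1 / Num.sqrt 2) /\
             ~ (hausdorff_measure (sdim l) (Aset l) = 0%E)] /\
  (* (ii) *)
  (forall l : (R * R)%type, cnorm l < 1 ->
     (packing_measure (sdim l) (Aset l) < +oo)%E) /\
  (@area R).-negligible
    [set l | (@Mset R l /\ cnorm l < 1 / Num.sqrt 2) /\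
             ~ (0 < packing_measure (sdim l) (Aset l))%E] /\
  (forall r Rr : R, 0 < r -> r < Rr -> Rr < 1 / Num.sqrt 2 ->
     (hausdorff_dim
        [set l | @Mset R l /\ (r < cnorm l < Rr)%R /\
                 packing_measure (sdim l) (Aset l) = 0%E]
      <= (ln 2 / - ln Rr)%:E)%E /\ ln 2 / - ln Rr < 2) /\
  (* (iii) *)
  (@area R).-negligible
    [set l | (@Mset R l /\ cnorm l < 1 / Num.sqrt 2) /\ ~ nu_equiv_packing l].
Proof.
split; first exact: hausdorff_zero_ae.
split; first by move=> l; exact: packing_measure_finite.
split; first exact: packing_zero_negligible.
split.
  move=> r Rr r0 rR hR; split; first exact: exceptional_dim rR hR.
  by apply: exceptional_exponent_lt2 => //; exact: lt_trans rR.
(* Equivalence holds wherever the packing measure is positive, so the exceptional set of (iii) lies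
   in that of (ii). *)
apply: negligibleS packing_zero_negligible => l [[Ml hl] nE]; split => // PA; apply: nE.
have hl2 := Mset_norm_ge l Ml; have l1 : cnorm l < 1 by case: Ml.
apply: nu_equiv_of_packing_positive => //.
by apply/eqP => l0; move: hl2; rewrite l0 cnorm0; lra.
Qed.
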